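(* Let $\eta>0$ and $\gamma>0$. For every $\alpha_0>0$ and every $B>0$, the Bayes estimator $\hat\theta_\Pi$ based on $\Pi$ is non-asymptotically minimax adaptive: there exists a positive constant $C_3$ depending only on $\alpha_0$, $\eta$ and $\gamma$ (in particular, not on $B$ or $\varepsilon$) such that $$\sup_{\theta\in\mathcal{E}(\alpha_0,B)}R(\theta,\hat\theta_\Pi)\ \le\ C_3\ \inf_{\hat\theta}\ \sup_{\theta\in\mathcal{E}(\alpha_0,B)}R(\theta,\hat\theta)\qquad\text{for any }0<\varepsilon\le B,$$ where the infimum is over all estimators $\hat\theta$ (measurable functions of $X$).
   Context: Here $\mathbb{N}=\{1,2,\ldots\}$, and $\|v\|^2=\sum_{i\ge1}v_i^2$ for $v\in l_2$. Gaussian infinite sequence model: for $\theta\in l_2$ and $\varepsilon>0$, the observation $X=(X_1,X_2,\ldots)$ has law $P_{\theta,\varepsilon^2}=\otimes_{i=1}^\infty\mathcal{N}(\theta_i,\varepsilon^2)$; $\mathrm{E}_{\theta,\varepsilon^2}$ denotes expectation under $P_{\theta,\varepsilon^2}$. The variance $\varepsilon^2$ is known (estimators may depend on it). Sobolev ellipsoid: $\mathcal{E}(\alpha_0,B)=\{\theta\in l_2:\sum_{i=1}^\infty i^{2\alpha_0}\theta_i^2\le B^2\}$. The normalized risk of an estimator $\hat\theta$ is $R(\theta,\hat\theta)=\mathrm{E}_{\theta,\varepsilon^2}\big[\|\hat\theta(X)-\theta\|^2\big]/B^2$. Prior: $\mathcal N(0,0)$ denotes the point mass at $0$. For $d\in\mathbb{N}$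 and $\alpha>0$ let $\mathrm{S}(\cdot\mid d,\alpha)=\big[\otimes_{i=1}^d\mathcal{N}(0,\varepsilon^2 d^{2\alpha+1}i^{-(2\alpha+1)})\big]\otimes\big[\otimes_{i=d+1}^\infty\mathcal{N}(0,0)\big]$, a distribution on $l_2$. Let $M$ and $F$ be the probability distributions on $\mathbb{N}$ with $M(d)\propto\exp(-\eta d)$ and $F(k)\propto\exp(-\gamma k)$. Put $\mathrm{S}_M(\cdot\mid\alpha)=\sum_{d=1}^\infty M(d)\,\mathrm{S}(\cdot\mid d,\alpha)$ and $\Pi=\sum_{k=1}^\infty F(k)\,\mathrm{S}_M(\cdot\mid\alpha=k)$ (so $\Pi$ depends on $\varepsilon,\eta,\gamma$ but not on $\alpha_0$ or $B$). The Bayes estimator $\hat\theta_\Pi$ is the posterior mean $\int\theta\,d\Pi(\theta\mid X)$, where $\Pi(\cdot\mid X)$ is the posterior distribution of $\theta$ given $X$. *)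

(* Defs.v *)
From HB Require Import structures.
From mathcomp Require Import all_boot all_order all_algebra.
From mathcomp Require Import all_classical all_reals all_analysis.
Set Implicit Arguments.
Unset Strict Implicit.
Unset Printing Implicit Defensive.
Import Order.TTheory GRing.Theory Num.Theory.
Import numFieldNormedType.Exports.
Local Open Scope classical_set_scope.
Local Open Scope ring_scope.

(* Sequences are indexed by nat: index [i] stands for the coordinate [i.+1] of
   a sequence indexed by {1, 2, ...}. *)

Section sequence_space.
Context {R : realType}.

Definition coord_preimages : set_system (nat -> R) :=
  [set A | exists i, exists2 U : set R, measurable U &
           A = (fun x : nat -> R => x i) @^-1` U].

(* R^N with the product sigma-algebra. *)
Definition seqspace := g_sigma_algebraType coord_preimages.

Definition is_product_prob (mu : nat -> probability (measurableTypeR R) R)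
    (P : probability seqspace R) : Prop :=
  forall (n : nat) (U : nat -> set (measurableTypeR R)), (forall i, measurable (U i)) ->
    P [set x : seqspace | forall i, (i < n)%N -> U i (x i)] =
    (\prod_(i < n) mu i (U i))%E.

(* The infinite product of the [mu i]: the probability measure, which exists
   and is unique, with these values on the measurable cylinders. *)
Definition product_prob (mu : nat -> probability (measurableTypeR R) R) :
  probability seqspace R := get (is_product_prob mu).

(* ||x||^2, equal to +oo when x is not in l_2. *)
Definition sqnorm (x : nat -> R) : \bar R :=
  (\sum_(0 <= i <oo) ((x i) ^+ 2)%:E)%E.

Definition l2 : set (nat -> R) := [set x | (sqnorm x < +oo)%E].

Definition ellipsoid (alpha0 B : R) : set (nat -> R) :=
  [set theta | l2 theta /\
    (\sum_(0 <= i <oo) (i.+1%:R `^ (2 * alpha0) * (theta i) ^+ 2)%:E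
      <= (B ^+ 2)%:E)%E].

(* N(m, v), parametrized by the variance; N(m, 0) is the point mass at m
   (the library's [normal_prob m 0] is a uniform distribution). *)
Definition gauss (m v : R) : probability (measurableTypeR R) R :=
  if v == 0 then @dirac _ (measurableTypeR R) m R : probability _ R
  else normal_prob m (Num.sqrt v) : probability _ R.

Definition model (eps : R) (theta : nat -> R) : probability seqspace R :=
  product_prob (fun i => gauss (theta i) (eps ^+ 2)).

Definition estimator : set (seqspace -> seqspace) := measurable_fun setT.

Definition risk (eps B : R) (theta : nat -> R) (est : seqspace -> seqspace) :
    \bar R :=
  (((B ^+ 2)^-1)%:E *
   \int[model eps theta]_x sqnorm (fun i => est x i - theta i)%R)%E.

Definition sup_risk (eps alpha0 B : R) (est : seqspace -> seqspace) : \bar R :=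
  ereal_sup [set risk eps B theta est | theta in ellipsoid alpha0 B].

Definition sieve_prior (eps : R) (d : nat) (alpha : R) :
    probability seqspace R :=
  product_prob (fun i => gauss 0
    (if (i < d)%N
     then eps ^+ 2 * d%:R `^ (2 * alpha + 1) * i.+1%:R `^ (- (2 * alpha + 1))
     else 0)).

(* The mass at k of the distribution on {1, 2, ...} proportional to
   exp (- c k). *)
Definition exp_weight (c : R) (k : nat) : R :=
  expR (- (c * k%:R)) / fine (\sum_(1 <= j <oo) (expR (- (c * j%:R)))%:E)%E.

Lemma exp_weight_ge0 (c : R) (k : nat) : 0 <= exp_weight c k.
Proof.
by rewrite /exp_weight divr_ge0 ?expR_ge0// fine_ge0// nneseries_ge0//.
Qed.

(* The measure \sum_(k >= 1) w_k mu_k, with w_k = exp_weight c k. *)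
Definition exp_mixture (c : R) (mu : nat -> {measure set seqspace -> \bar R}) :
    {measure set seqspace -> \bar R} :=
  mseries (fun k => mscale (NngNum (exp_weight_ge0 c k)) (mu k)) 1.

Definition sieve_mixture (eps eta alpha : R) :
    {measure set seqspace -> \bar R} :=
  exp_mixture eta (fun d => sieve_prior eps d alpha).

Definition prior (eps eta gamma : R) : {measure set seqspace -> \bar R} :=
  exp_mixture gamma (fun k => sieve_mixture eps eta k%:R).

(* [post] is a version of the conditional distribution of theta given X when
   theta ~ Pi and X | theta ~ model eps theta: for data events A and parameter
   events D, E[post(X, D); X in A] = Pr[X in A, theta in D]. *)
Definition is_posterior (eps : R) (Pi : {measure set seqspace -> \bar R})
    (post : R.-pker seqspace ~> seqspace) : Prop :=
  forall A D : set seqspace, measurable A -> measurable D ->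
    (\int[Pi]_theta \int[model eps theta]_(x in A) post x D =
     \int[Pi]_(theta in D) model eps theta A)%E.

(* The l_2-valued posterior mean, taken coordinatewise. *)
Definition posterior_mean (post : R.-pker seqspace ~> seqspace) :
    seqspace -> seqspace :=
  fun x i => Rintegral (post x) setT (fun theta : seqspace => theta i).

End sequence_space.

Arguments seqspace R : clear implicits.

(* Main.v *)
Require Import Defs.
From HB Require Import structures.
From mathcomp Require Import all_boot all_order all_algebra.
From mathcomp Require Import all_classical all_reals all_analysis.
From mathcomp Require Import measurable_realfun lebesgue_measure lebesgue_integral ring lra.
Set Implicit Arguments.
Unset Strict Implicit.
Unset Printing Implicit Defensive.
Import Order.TTheory GRing.Theory Num.Theory.
Import numFieldNormedType.Exports.
Local Open Scope classical_set_scope.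
Local Open Scope ring_scope.

(** Write [v = eps ^ 2], let [D] be the largest integer for which
    [v D ^ (2 alpha0 + 1) <= B ^ 2], and put [N = D + 1]. Up to constants both
    sides of the inequality equal [v N / B ^ 2].

    Lower bound. The ellipsoid contains the [2 ^ D] sequences whose first [D]
    coordinates are [eps] or [- eps] and whose other coordinates vanish. The laws
    of the observation at two vertices that differ in one sign overlap by a fixed
    amount, so every estimator pays a fixed multiple of [v] in each of the [D]
    coordinates on average over the vertices ([hypercube_lower_bound],
    [sup_risk_lower]).

    Upper bound. Inside the component [(d, k)] of the prior everything is Gaussian
    and explicit: with [s i = shrink d k i] the posterior has mean [(1 - s i) x i]
    and variance [v (1 - s i)] in the [i]th coordinate, and its total mass, the
    evidence, is the product [marg eps d k x] ([component_posterior]). By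
    Jensen's inequality the loss of the posterior mean is at most the posterior
    average of the losses of the components. The loss of one component is at most
    a budget of expectation at most [64 v N], plus [1200 v h], where the excess
    [h = excess_sum eps N d k x] is large only when [d] or [k] suits [theta] badly
    ([loss_le]). Such components have to receive little posterior weight.

    To see this, bound [h] by [A + exp (h - A)] with [A] a multiple of [N], and
    compare with the component [(N, k0)], where [k0 >= alpha0]. If [w] and [w0]
    are the posterior weights of [(d, k)] and of [(N, k0)], then [w w0 <= 1], that
    is, [w <= sqrt (w / w0)]. The ratio [w / w0] no longer contains the normalizing
    integral: it is a ratio of prior weights times a ratio of evidences. So
    [sqrt (w / w0) exp h] is a product of functions of single coordinates, and its
    expectation is a product of one-dimensional Gaussian integrals, at most
    [exp ((2 k0 + 5) N)] uniformly in [(d, k)] ([integral_ratio_prod]). The square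
    roots of the prior weights sum like geometric series. The posterior average of
    [exp h] therefore has expectation at most a constant times [exp A] when
    [A = (2 k0 + 5 + eta / 2) N], and the risk is at most a multiple of [v N]
    ([posterior_risk_le]).

    Measure theory. The infinite product measures have to be constructed: the
    averages over single coordinates define a content on the cylinders, and a failure
    of sigma-subadditivity would allow one to build, coordinate by coordinate, a
    point that the cover misses ([cyl_prob_sigma_subadditive]). A posterior is only known through an integral
    identity, which yields Bayes' formula almost surely under the law [base eps]
    of pure noise ([posterior_ae]). The formula holds almost surely under the law
    at [theta] because that law is absolutely continuous with respect to
    [base eps] for every square-summable [theta] ([model_dominated]). *)

(** * Infinite product measures: cylinders *)

Definition ge0_measurable {R : realType} d (T : measurableType d) (f : T -> \bar R) :=
  measurable_fun setT f /\ forall x, (0 <= f x)%E.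

Section sequence_measurability.
Context {R : realType}.

Lemma measurable_coord i : measurable_fun setT (fun x : seqspace R => x i).
Proof.
move=> _ U mU; rewrite setTI; apply: sub_sigma_algebra; by exists i, U.
Qed.

Lemma measurable_coord_preimage i (U : set (measurableTypeR R)) : measurable U ->
  measurable ((fun x : seqspace R => x i) @^-1` U).
Proof. by move=> mU; rewrite -[X in measurable X]setTI; exact: measurable_coord. Qed.

Lemma measurable_seqspace d (T : measurableType d) (f : T -> seqspace R) :
  (forall i, measurable_fun setT (fun t => f t i)) -> measurable_fun setT f.
Proof.
move=> mf; apply: (@measurability _ _ T (seqspace R) setT f coord_preimages) => //.
move=> _ [_ [i [U mU ->]] <-]; rewrite setTI.
by have := mf i measurableT U mU; rewrite setTI.
Qed.

End sequence_measurability.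

Lemma nneseries_term_le {R : realType} (u : (\bar R)^nat) m j : (m <= j)%N ->
  (forall i, 0 <= u i)%E -> (u j <= \sum_(m <= i <oo) u i)%E.
Proof.
move=> mj u0; apply: le_trans (nneseries_lim_ge j.+1 _) => //.
by rewrite big_nat_recr//= leeDr// sume_ge0.
Qed.

Section product_existence.
Context {R : realType}.
Variable mu : nat -> probability (measurableTypeR R) R.
Implicit Types (f : seqspace R -> \bar R) (x y : seqspace R) (A B : set (seqspace R)).

Definition upd x k (t : R) : seqspace R := fun i => if i == k then t else x i.

Lemma measurable_upd k :
  measurable_fun setT (fun p : seqspace R * measurableTypeR R => upd p.1 k p.2).
Proof.
apply: measurable_seqspace => i; rewrite /upd; case: eqP => _.
  exact: measurable_snd.
by apply: (measurableT_comp (measurable_coord i)); exact: measurable_fst.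
Qed.

Lemma measurable_updr x k : measurable_fun setT (upd x k : measurableTypeR R -> _).
Proof.
apply: measurable_seqspace => i; rewrite /upd; case: eqP => _; first exact: measurable_id.
exact: measurable_cst.
Qed.

(** The infinite product is approached through conditional expectations:
    [avgs k n f] integrates out the coordinates [k], ..., [k + n - 1], starting
    from the last one. *)
Definition avg k f x : \bar R := (\int[mu k]_t f (upd x k t))%E.

Fixpoint avgs k n f : seqspace R -> \bar R :=
  if n is n'.+1 then avg k (avgs k.+1 n' f) else f.

(** A function that depends on finitely many coordinates is encoded by its
    invariance under changes of the other coordinates, so that no projection onto
    a finite product is needed. *)
Definition depends n f := forall x y, (forall i, (i < n)%N -> x i = y i) -> f x = f y.

Lemma ge0_measurable_slice f x k : ge0_measurable f ->
  measurable_fun setT (fun t : measurableTypeR R => f (upd x k t)).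
Proof. by case=> mf _; apply: measurableT_comp => //; exact: measurable_updr. Qed.

Lemma ge0_measurable_avg k f : ge0_measurable f -> ge0_measurable (avg k f).
Proof.
case=> mf f0; split; last by move=> x; apply: integral_ge0 => *; exact: f0.
apply: (@measurable_fun_fubini_tonelli_F _ _ _ _ R (mu k)
  (fun p : seqspace R * measurableTypeR R => f (upd p.1 k p.2))) => [|p].
  by apply: measurableT_comp => //; exact: measurable_upd.
exact: f0.
Qed.

Lemma ge0_measurable_avgs k n f : ge0_measurable f -> ge0_measurable (avgs k n f).
Proof. by elim: n k => //= n IH k nf; apply/ge0_measurable_avg/IH. Qed.

Lemma avg_depends_id k f : depends k f -> avg k f = f.
Proof.
move=> df; apply/funext => x; rewrite /avg.
transitivity (\int[mu k]_t cst (f x) t)%E.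
  apply: eq_integral => t _; apply: df => i ik; rewrite /upd; case: eqP => // e.
  by rewrite e ltnn in ik.
rewrite integral_cst// [X in (_ * X)%E](_ : _ = 1%E) ?mule1//; exact: probability_setT.
Qed.

Lemma depends_avg k f : depends k.+1 f -> depends k (avg k f).
Proof.
move=> df x y xy; apply: eq_integral => t _; apply: df => i; rewrite ltnS /upd.
by case: eqP => // /eqP ik; rewrite leq_eqVlt (negbTE ik) => /xy.
Qed.

Lemma dependsW m n f : (m <= n)%N -> depends m f -> depends n f.
Proof. by move=> mn df x y xy; apply: df => i im; apply: xy; exact: leq_trans im mn. Qed.

Lemma depends_avgs k n f : depends (k + n) f -> depends k (avgs k n f).
Proof.
elim: n k => [|n IH] k /=; first by rewrite addn0.
by rewrite addnS -addSn => /IH /depends_avg.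
Qed.

Lemma avgs_depends k n p f : depends (k + n) f -> avgs k (n + p) f = avgs k n f.
Proof.
elim: n k p => [|n IH] k p /=; last by rewrite addnS -addSn => /IH ->.
rewrite addn0 add0n => df; elim: p k df => //= p IHp k df.
by rewrite IHp ?avg_depends_id//; exact: dependsW df.
Qed.

Lemma avgs0 k n : avgs k n (cst 0%E) = cst 0%E.
Proof. by elim: n k => //= n IH k; rewrite IH avg_depends_id. Qed.

Lemma avgsD k n f g : ge0_measurable f -> ge0_measurable g ->
  avgs k n (fun x => f x + g x)%E = (fun x => avgs k n f x + avgs k n g x)%E.
Proof.
elim: n k => //= n IH k nf ng; rewrite IH//; apply/funext => x.
have [nf' ng'] := (ge0_measurable_avgs k.+1 n nf, ge0_measurable_avgs k.+1 n ng).
rewrite /avg ge0_integralD//.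
- by move=> t _; exact: nf'.2.
- exact: ge0_measurable_slice.
- by move=> t _; exact: ng'.2.
- exact: ge0_measurable_slice.
Qed.

Definition ind A x : \bar R := (\1_A x)%:E.

Lemma ge0_measurable_indic A : measurable A -> ge0_measurable (ind A).
Proof.
move=> mA; split; last by move=> x; rewrite /ind lee_fin.
by apply/measurable_EFinP; exact: measurable_indic.
Qed.

Definition cylinder A := measurable A /\ exists n, depends n (ind A).

Definition level A := xget 0%N [set n | depends n (ind A)].

Lemma levelP A : cylinder A -> depends (level A) (ind A).
Proof. by move=> [_ An]; exact: (xgetPex 0%N An). Qed.

(** For a cylinder [A], the conditional probability of [A] given the first [k]
    coordinates under the product measure that is being constructed. *)
Definition section_prob k A := avgs k (level A - k) (ind A).

Lemma ge0_measurable_section_prob k A : cylinder A -> ge0_measurable (section_prob k A).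
Proof. by move=> [mA _]; apply/ge0_measurable_avgs/ge0_measurable_indic. Qed.

Lemma avg_section_prob k A : cylinder A ->
  avg k (section_prob k.+1 A) = section_prob k A.
Proof.
move=> /levelP dA; rewrite /section_prob.
have [kl|lk] := ltnP k (level A); first by rewrite -[in RHS]subnSK.
move: (lk); rewrite -subn_eq0 => /eqP ->; rewrite (_ : _ - _ = 0)%N /=.
  by apply: avg_depends_id; exact: dependsW dA.
by apply/eqP; rewrite subn_eq0 ltnW.
Qed.

Lemma depends_section_prob k A : cylinder A -> depends k (section_prob k A).
Proof.
move=> /levelP dA; have [kl|lk] := leqP k (level A).
  by apply: depends_avgs; rewrite subnKC.
rewrite /section_prob (_ : _ - _ = 0)%N /=; first by apply: dependsW dA; exact: ltnW.
by apply/eqP; rewrite subn_eq0 ltnW.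
Qed.

Lemma section_prob_level k A : (level A <= k)%N -> section_prob k A = ind A.
Proof. by rewrite -subn_eq0 => /eqP lk; rewrite /section_prob lk. Qed.

Definition cyl_prob A : \bar R := section_prob 0 A (fun=> 0).

Lemma section_prob0 A x : cylinder A -> section_prob 0 A x = cyl_prob A.
Proof. by move=> cA; apply: (depends_section_prob cA). Qed.

Lemma cyl_probE n A x : measurable A -> depends n (ind A) ->
  cyl_prob A = avgs 0 n (ind A) x.
Proof.
move=> mA dA; have cA : cylinder A by split => //; exists n.
rewrite -(section_prob0 x cA) /section_prob subn0.
have [ln|/ltnW nl] := leqP (level A) n.
  by rewrite -[in RHS](subnKC ln) avgs_depends//; exact: levelP.
by rewrite -[in LHS](subnKC nl) avgs_depends.
Qed.

(** If a gap persists after averaging over the [k]th coordinate, some value of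
    that coordinate keeps the gap open. *)
Lemma section_prob_step k (F : (set (seqspace R))^nat) A x :
  cylinder A -> (forall i, cylinder (F i)) ->
  (\sum_(0 <= i <oo) section_prob k (F i) x < section_prob k A x)%E ->
  exists t, (\sum_(0 <= i <oo) section_prob k.+1 (F i) (upd x k t) <
    section_prob k.+1 A (upd x k t))%E.
Proof.
move=> cA cF; apply: contraPP => /forallNP nt; apply/negP; rewrite -leNgt.
rewrite -avg_section_prob// /avg.
under eq_eseriesr do rewrite -avg_section_prob// /avg.
rewrite -integral_nneseries//.
- apply: ge0_le_integral => //.
  + by move=> t _; exact: (ge0_measurable_section_prob _ _).2.
  + by apply: ge0_measurable_slice; exact: ge0_measurable_section_prob.
  + by apply: ge0_emeasurable_sum => [i t _ _|i _];
      [exact: (ge0_measurable_section_prob _ _).2|apply: ge0_measurable_slice; exact: ge0_measurable_section_prob].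
  + by move=> t _; rewrite leNgt; apply/negP; exact: nt.
- by move=> i; apply: ge0_measurable_slice; exact: ge0_measurable_section_prob.
- by move=> i t _; exact: (ge0_measurable_section_prob _ _).2.
Qed.

(** Tulcea's argument. Suppose that the inequality fails; by [section_prob_step]
    the coordinates of a point can be chosen one after the other so that all its
    conditional probabilities keep the gap. A cylinder that contains the limit
    point has conditional probability one from its own level on, so the limit
    point lies in [A], hence in some [F j], which contradicts the gap. *)
Lemma cyl_prob_sigma_subadditive A (F : (set (seqspace R))^nat) :
  cylinder A -> (forall i, cylinder (F i)) -> A `<=` \bigcup_i F i ->
  (cyl_prob A <= \sum_(0 <= i <oo) cyl_prob (F i))%E.
Proof.
move=> cA cF AF; rewrite leNgt; apply/negP => FA.
pose bad k x := (\sum_(0 <= i <oo) section_prob k (F i) x < section_prob k A x)%E.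
pose xs := fix xs k := if k is k'.+1 then
  upd (xs k') k' (xget 0 [set t | bad k'.+1 (upd (xs k') k' t)]) else (fun=> 0).
have bads k : bad k (xs k).
  elim: k => [|k IH]; first by rewrite /bad /=.
  by have /xgetPex := section_prob_step cA cF IH; apply.
pose x : seqspace R := fun i => xs i.+1 i.
have xsx k i : (i < k)%N -> xs k i = x i.
  elim: k => // k IH; rewrite ltnS leq_eqVlt => /predU1P[->//|ik].
  by rewrite -IH// /= /upd ltn_eqF.
have badx k : bad k x.
  have -> : bad k x = bad k (xs k); last by exact: bads.
  rewrite /bad; congr (_ < _)%E; last by apply: (depends_section_prob cA) => i /xsx.
  apply: eq_eseriesr => j _.
  by apply: (depends_section_prob (cF j)) => i /xsx.
have Ax : A x.
  have := badx (level A); rewrite /bad section_prob_level// /ind indicE.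
  have [/set_mem//|_] := boolP (x \in A).
  rewrite ltNge nneseries_ge0// => i _ _.
  exact: (ge0_measurable_section_prob _ _).2.
have [j _ Fjx] := AF _ Ax.
have := badx (maxn (level A) (level (F j))).
rewrite /bad (section_prob_level (leq_maxl _ _)) /ind indicE mem_set//= ltNge => /negP; apply.
apply: le_trans (nneseries_term_le (leq0n j) _); last first.
  by move=> *; exact: (ge0_measurable_section_prob _ _).2.
by rewrite (section_prob_level (leq_maxr _ _)) /ind indicE mem_set.
Qed.

Lemma depends_indP n A :
  depends n (ind A) <-> forall x y, (forall i, (i < n)%N -> x i = y i) -> A x -> A y.
Proof.
split=> dA x y xy => [Ax|]; last first.
  rewrite /ind !indicE; congr (_%:R%:E); congr nat_of_bool; apply/idP/idP => /set_mem h; apply/mem_set.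
    exact: dA h.
  by apply: dA h => i /xy.
have := dA _ _ xy; rewrite /ind !indicE mem_set//=.
by have [/set_mem//|_ []/eqP] := boolP (y \in A); rewrite oner_eq0.
Qed.

Lemma cylinderT : cylinder [set: seqspace R].
Proof. by split => //; exists 0%N; apply/depends_indP. Qed.

Lemma cylinderD A B : cylinder A -> cylinder B -> cylinder (A `\` B).
Proof.
move=> [mA [n /depends_indP dA]] [mB [m /depends_indP dB]]; split; first exact: measurableD.
exists (maxn n m); apply/depends_indP => x y xy [Ax nBx]; split.
  by apply: dA Ax => i im; apply: xy; rewrite leq_max im.
by move=> By; apply: nBx; apply: dB By => i im; rewrite xy// leq_max im orbT.
Qed.

End product_existence.

(** The sequence space carrying the algebra of cylinders, instead of the
    sigma-algebra that it generates, as its measurable sets: this is the structure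
    from which a measure is extended. *)
Definition cylspace (R : realType) := seqspace R.
HB.instance Definition _ (R : realType) := Pointed.on (cylspace R).
HB.instance Definition _ (R : realType) :=
  @isAlgebraOfSets_setD.Build default_measure_display (cylspace R)
    (@cylinder R) (@cylinderT R) (@cylinderD R).

(** * Infinite product measures: extension *)

Lemma cylinder_bigsetU {R : realType} (F : (set (seqspace R))^nat) n :
  (forall i, cylinder (F i)) -> cylinder (\big[setU/set0]_(i < n) F i).
Proof.
move=> cF; elim: n => [|n IH]; first by rewrite big_ord0; exact: (@measurable0 _ (cylspace R)).
rewrite big_ord_recr; exact: (@measurableU _ (cylspace R) _ _ IH (cF n)).
Qed.

Section product_measure_existence.
Context {R : realType}.
Variable mu : nat -> probability (measurableTypeR R) R.

Definition cyl_content (A : set (cylspace R)) : \bar R := cyl_prob mu A.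

Let cyl_content_ge0 A : (0 <= cyl_content A)%E.
Proof.
suff avgs_ge0 k n f x : (forall y, 0 <= f y)%E -> (0 <= avgs mu k n f x)%E.
  by apply: avgs_ge0 => y; rewrite lee_fin.
elim: n k x => //= n IH k x f0; apply: integral_ge0 => t _; exact: IH.
Qed.

Let cyl_content_semi_additive : measure_function.semi_additive cyl_content.
Proof.
apply/additive2P.
  rewrite /cyl_content /cyl_prob /section_prob (_ : ind set0 = cst 0%E) ?avgs0//.
  by apply/funext => x; rewrite /ind indic0.
move=> A B cA cB AB0.
have [_ [n dAB]] : cylinder (A `|` B) by exact: (@measurableU _ (cylspace R)).
have dA := levelP cA; have dB := levelP cB.
pose m := maxn n (maxn (level A) (level B)).
have [mA _] := cA; have [mB _] := cB.
rewrite /cyl_content !(@cyl_probE _ mu m _ (fun=> 0))//.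
- rewrite (_ : ind (A `|` B) = (fun x => ind A x + ind B x)%E).
    by rewrite avgsD//; exact: ge0_measurable_indic.
  apply/funext => x; rewrite /ind -EFinD; congr EFin; rewrite !indicE in_setU.
  have [/set_mem Ax|_] := boolP (x \in A); last by rewrite add0r.
  have [/set_mem Bx|_] := boolP (x \in B); last by rewrite addr0.
  by exfalso; rewrite -[False]/(set0 x) -AB0; split.
- by apply: dependsW dB; rewrite !leq_max leqnn !orbT.
- by apply: dependsW dA; rewrite !leq_max leqnn !orbT.
- exact: measurableU.
- by apply: dependsW dAB; rewrite leq_max leqnn.
Qed.

HB.instance Definition _ :=
  isContent.Build _ (cylspace R) R cyl_content cyl_content_ge0 cyl_content_semi_additive.

Let cyl_content_subadditive : measurable_subset_sigma_subadditive cyl_content.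
Proof. by move=> A F cF cA AF; exact: cyl_prob_sigma_subadditive. Qed.

HB.instance Definition _ := Content_SigmaSubAdditive_isMeasure.Build _ R
  (cylspace R) cyl_content cyl_content_subadditive.

Let sub_cyl_measurable (A : set (seqspace R)) : measurable A ->
  measurable (A : set (g_sigma_algebraType (@measurable _ (cylspace R)))).
Proof.
apply: sub_smallest2r => // _ [i [U mU ->]].
split; first exact: measurable_coord_preimage.
exists i.+1; apply/depends_indP => x y xy; rewrite /= xy//.
Qed.

Definition cyl_extension (A : set (seqspace R)) : \bar R :=
  measure_extension (cyl_content : {measure set (cylspace R) -> \bar R}) A.

Lemma cyl_extensionE A : cylinder A -> cyl_extension A = cyl_prob mu A.
Proof. by move=> cA; rewrite /cyl_extension /measure_extension measurable_mu_extE. Qed.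

Let cyl_extension0 : cyl_extension set0 = 0%E.
Proof. exact: measure0. Qed.

Let cyl_extension_ge0 A : (0 <= cyl_extension A)%E.
Proof. exact: measure_ge0. Qed.

Let cyl_extension_sigma_additive : semi_sigma_additive cyl_extension.
Proof.
move=> F mF tF mUF; apply: (@measure_semi_sigma_additive _ _ _
  (measure_extension (cyl_content : {measure set (cylspace R) -> \bar R})));
  by [move=> i; exact: sub_cyl_measurable| |exact: sub_cyl_measurable].
Qed.

HB.instance Definition _ := isMeasure.Build _ (seqspace R) R cyl_extension
  cyl_extension0 cyl_extension_ge0 cyl_extension_sigma_additive.

Let cyl_extension_setT : cyl_extension setT = 1%E.
Proof.
rewrite cyl_extensionE; last exact: cylinderT.
by rewrite (@cyl_probE _ mu 0 _ (fun=> 0))//= /ind indicT.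
Qed.

HB.instance Definition _ := Measure_isProbability.Build _ (seqspace R) R
  cyl_extension cyl_extension_setT.

Lemma avgs_prod (g : nat -> R -> \bar R) k n x :
  (forall i, measurable_fun setT (g i : measurableTypeR R -> \bar R)) ->
  (forall i t, 0 <= g i t)%E ->
  avgs mu k n (fun x => \prod_(i < k + n) g i (x i))%E x =
  ((\prod_(i < k) g i (x i)) * \prod_(k <= i < k + n) \int[mu i]_t g i t)%E.
Proof.
move=> mg g0; elim: n k x => [|n IH] k x /=.
  by rewrite addn0 big_geq// mule1.
rewrite /avg addnS -addSn.
under eq_integral do rewrite IH big_ord_recr/=.
rewrite [X in _ = (_ * X)%E]big_ltn; last by rewrite addSn ltnS leq_addr.
set C := (\prod_(k.+1 <= i < _) _)%E.
have C0 : (0 <= C)%E by apply: prode_ge0 => i _; exact: integral_ge0.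
have p0 : (0 <= \prod_(i < k) g i (x i))%E by exact: prode_ge0.
transitivity (\int[mu k]_t ((\prod_(i < k) g i (x i)) * (g k t * C)))%E.
  apply: eq_integral => t _; rewrite -muleA; congr (_ * (_ * _))%E.
    by apply: eq_bigr => i _; rewrite /upd ltn_eqF.
  by rewrite /upd eqxx.
rewrite ge0_integralZl//.
- by rewrite ge0_integralZr.
- by apply: emeasurable_funM.
- by move=> t _; rewrite mule_ge0.
Qed.

Lemma rectangle_cylinder n (U : nat -> set (measurableTypeR R)) :
  (forall i, measurable (U i)) ->
  cylinder [set x : seqspace R | forall i, (i < n)%N -> U i (x i)].
Proof.
move=> mU; split.
  rewrite [X in measurable X](_ : _ = \bigcap_i ((fun x : seqspace R => x i) @^-1`
      (if (i < n)%N then U i else setT))).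
    apply: bigcapT_measurable => i; apply: measurable_coord_preimage.
    by case: ifP.
  by apply/seteqP; split => [x Ux i _ /=|x Ux i ilt]; [case: ifP => // /Ux|have := Ux i I; rewrite /= ilt].
exists n; apply/depends_indP => x y xy Ux i ilt; rewrite -xy//; exact: Ux.
Qed.

Lemma ind_rectangle n (U : nat -> set (measurableTypeR R)) (x : seqspace R) :
  ind [set x : seqspace R | forall i, (i < n)%N -> U i (x i)] x =
  (\prod_(i < n) (\1_(U i) (x i))%:E)%E.
Proof.
rewrite /ind indicE; have [/set_mem Ux|] := boolP (x \in _).
  by rewrite big1// => i _; rewrite indicE mem_set//; exact: Ux.
rewrite notin_setE => nUx.
have [i iUx] : exists i : 'I_n, ~ U i (x i).
  apply: contrapT => /forallNP h; apply: nUx => i ilt.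
  by have /contrapT := h (Ordinal ilt).
by rewrite (bigD1 i)//= indicE memNset// mul0e.
Qed.

Lemma cyl_extension_product :
  is_product_prob mu (cyl_extension : probability (seqspace R) R).
Proof.
move=> n U mU /=; have cU := rectangle_cylinder n mU.
rewrite cyl_extensionE// (@cyl_probE _ mu n _ (fun=> 0))//; last 2 first.
- by case: cU.
- apply/depends_indP => x y xy Ux i ilt; rewrite -xy//; exact: Ux.
rewrite [X in avgs _ _ _ X](_ : _ =
    (fun x : seqspace R => \prod_(i < 0 + n) (\1_(U i) (x i))%:E)%E); last first.
  by apply/funext => x; rewrite ind_rectangle.
rewrite (@avgs_prod (fun i t => (\1_(U i) t)%:E) 0 n)//.
  rewrite big_ord0 mul1e big_mkord; apply: eq_bigr => i _.
  by rewrite integral_indic ?setIT.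
by move=> i; apply/measurable_EFinP; exact: measurable_indic.
Qed.

(** The sets on which an infinite product is prescribed; being closed under
    intersection, they determine it. *)
Definition rectangles : set_system (seqspace R) :=
  [set A | exists n (U : nat -> set (measurableTypeR R)),
    (forall i, measurable (U i)) /\ A = [set x | forall i, (i < n)%N -> U i (x i)]].

Lemma measurable_rectangles : @measurable _ (seqspace R) = <<s rectangles >>.
Proof.
apply/seteqP; split.
  apply: sub_smallest2r => // _ [i [U mU ->]].
  exists i.+1, (fun j => if j == i then U else setT); split.
    by move=> j; case: ifP.
  apply/seteqP; split => [x Ux j _ |x /(_ i (ltnSn i))]; last by rewrite /= eqxx.
  by case: eqP => [->|].
apply: smallest_sub; first exact: sigma_algebra_measurable.
by move=> _ [n [U [mU ->]]]; have [] := rectangle_cylinder n mU.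
Qed.

Lemma rectangles_setI : setI_closed rectangles.
Proof.
move=> _ _ [n [U [mU ->]]] [m [V [mV ->]]].
exists (maxn n m), (fun i => (if (i < n)%N then U i else setT) `&` (if (i < m)%N then V i else setT)); split.
  by move=> i; apply: measurableI; case: ifP.
apply/seteqP; split => [x [Ux Vx] i _|x UVx].
  by split; case: ifP => // h; [exact: Ux|exact: Vx].
split=> i ilt.
  by have [] := UVx i; rewrite ?ilt ?leq_max ?ilt.
by have [] := UVx i; rewrite ?ilt ?leq_max ?ilt ?orbT.
Qed.

Lemma rectanglesT : rectangles setT.
Proof. by exists 0%N, (fun=> setT); split => //; apply/seteqP; split. Qed.

Lemma rectangle_unique (P Q : probability (seqspace R) R) :
  is_product_prob mu P -> is_product_prob mu Q -> forall A, measurable A -> P A = Q A.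
Proof.
move=> hP hQ; apply: (@measure_unique _ _ _ rectangles (fun=> setT)).
- exact: measurable_rectangles.
- exact: rectangles_setI.
- by move=> _; exact: rectanglesT.
- by rewrite -subTset => x _; exists 0%N.
- by move=> _ [n [U [mU ->]]]; exact: etrans (hP _ _ mU) (esym (hQ _ _ mU)).
- by move=> _; rewrite (le_lt_trans (probability_le1 _ _))// ltry.
Qed.

Lemma product_probP : is_product_prob mu (product_prob mu).
Proof. exact: (getPex (ex_intro _ _ cyl_extension_product)). Qed.

Lemma product_prob_unique (P : probability (seqspace R) R) :
  is_product_prob mu P -> forall A, measurable A -> product_prob mu A = P A.
Proof. by move=> hP A mA; exact: rectangle_unique product_probP hP _ mA. Qed.

(** An infinite product coincides with the outer measure of its values on the
    cylinders, so measurable sets are covered efficiently by cylinders. This is what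
    transfers estimates from cylinders to null sets. *)
Lemma product_prob_cover A (e : R) : measurable A ->
  (product_prob mu A < e%:E)%E ->
  exists F : (set (seqspace R))^nat, [/\ forall i, cylinder (F i),
    A `<=` \bigcup_i F i & (\sum_(0 <= i <oo) product_prob mu (F i) < e%:E)%E].
Proof.
move=> mA; rewrite (product_prob_unique cyl_extension_product)//= /cyl_extension.
move=> /ereal_inf_lt[_ [F [cF AF] <-] Fe]; exists F; split => //.
apply: le_lt_trans Fe; apply: lee_nneseries => // i _.
have cFi : cylinder (F i) := cF i; have [mF _] := cFi.
by rewrite (product_prob_unique cyl_extension_product)//= cyl_extensionE.
Qed.

End product_measure_existence.

(** * Densities *)

Section nonneg_induction.
Import HBNNSimple.
Context {R : realType} d (T : measurableType d).
Variable P : (T -> \bar R) -> Prop.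

(** The standard machine, in the form used for identities between integrals of
    extended-real functions: sums and multiples of indicators give the simple
    functions, and these increase to [f]. *)
Lemma ge0_measurable_induction :
  (forall A, measurable A -> P (fun x => (\1_A x)%:E)) ->
  (forall (k : R) f, 0 <= k -> ge0_measurable f -> P f -> P (fun x => k%:E * f x)%E) ->
  (forall f g, ge0_measurable f -> ge0_measurable g -> P f -> P g ->
    P (fun x => f x + g x)%E) ->
  (forall f : (T -> \bar R)^nat, (forall n, ge0_measurable (f n)) ->
    (forall x, nondecreasing_seq (f ^~ x)) -> (forall n, P (f n)) ->
    P (fun x => limn (f ^~ x))) ->
  forall f, ge0_measurable f -> P f.
Proof.
move=> Pind PZ PD Plim f [mf f0]; pose f_ := nnsfun_approx measurableT mf.
have Pf n : P (fun x => (f_ n x)%:E).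
  pose s : seq R := finmap.enum_fset (fset_set (f_ n @` setT)); pose t := size s.
  rewrite (_ : (fun _ => _) = fun x => \sum_(i < t)
     ((s`_i)%:E * (\1_(f_ n @^-1` [set s`_i]) x)%:E))%E; last first.
    by apply/funext => x; rewrite fimfunEord -sumEFin; apply: eq_bigr.
  have t0 i : (i < t)%N -> 0 <= s`_i.
    move=> it; have : s`_i \in s by exact: mem_nth.
    by rewrite /s in_fset_set// => /set_mem[x _ <-].
  elim: {-2}t (leqnn t) => [_|m IH mt].
    rewrite (_ : (fun _ => _) = (fun x => (\1_(@set0 T) x)%:E)); first exact: Pind.
    by apply/funext => x; rewrite big_ord0 indic0.
  rewrite (_ : (fun _ => _) = (fun x => \sum_(i < m) ((s`_i)%:E * (\1_(f_ n @^-1` [set s`_i]) x)%:E) +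
     (s`_m)%:E * (\1_(f_ n @^-1` [set s`_m]) x)%:E)%E); last first.
    by apply/funext => x; rewrite big_ord_recr.
  have gind i : ge0_measurable (fun x => (\1_(f_ n @^-1` [set s`_i]) x : R)%:E).
    by split => [|x]; [apply/measurable_EFinP; exact: measurable_indic|rewrite lee_fin].
  apply: PD.
  - split; first by apply: emeasurable_sum => i; apply: measurable_funeM; exact: (gind i).1.
    by move=> x; apply: sume_ge0 => i _; rewrite mule_ge0// lee_fin// t0// (leq_trans _ mt)// ltnW// ltnS.
  - split; first by apply: measurable_funeM; exact: (gind m).1.
    by move=> x; rewrite mule_ge0// lee_fin// t0.
  - by apply: IH; exact: ltnW.
  - by apply: PZ => //; [exact: t0|exact: Pind].
rewrite (_ : f = fun x => limn (fun n => (f_ n x)%:E)).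
  apply: Plim => // [n|x m n mn].
    by split => [|x]; [exact/measurable_EFinP|rewrite lee_fin].
  by rewrite lee_fin; exact/lefP/nd_nnsfun_approx.
by apply/funext => x; apply/esym/cvg_lim => //; exact: cvg_nnsfun_approx.
Qed.

End nonneg_induction.

Lemma ge0_measurable_mul {R : realType} d (T : measurableType d) (f g : T -> \bar R) :
  ge0_measurable f -> ge0_measurable g -> ge0_measurable (fun x => f x * g x)%E.
Proof.
move=> [mf f0] [mg g0]; split; first exact: emeasurable_funM.
by move=> x; rewrite mule_ge0.
Qed.

Lemma integral_prob_cst {R : realType} d (T : measurableType d) (P : probability T R)
  (c : \bar R) : (\int[P]_x c = c)%E.
Proof.
transitivity (c * P setT)%E; last by rewrite probability_setT mule1.
exact: integral_cst.
Qed.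

Section density.
Context {R : realType} d (T : measurableType d).
Variables (P : {measure set T -> \bar R}) (h : T -> R).
Hypothesis mh : measurable_fun setT h.
Hypothesis h0 : forall x, 0 <= h x.

Let gh : ge0_measurable (EFin \o h).
Proof. by split => [|x]; [exact/measurable_EFinP|rewrite lee_fin]. Qed.

Definition density_measure (A : set T) : \bar R := (\int[P]_(x in A) (h x)%:E)%E.

Let density_measure0 : density_measure set0 = 0%E.
Proof. exact: integral_set0. Qed.

Let density_measure_ge0 A : (0 <= density_measure A)%E.
Proof. by apply: integral_ge0 => x _; exact: gh.2. Qed.

Let density_measure_sigma_additive : semi_sigma_additive density_measure.
Proof.
move=> F mF tF mUF; rewrite /density_measure ge0_integral_bigcup//.
- by apply: is_cvg_ereal_nneg_natsum_cond => n _ _; exact: density_measure_ge0.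
- by apply: measurable_funTS; exact: gh.1.
- by move=> x _; exact: gh.2.
Qed.

HB.instance Definition _ := isMeasure.Build _ _ _ density_measure density_measure0
  density_measure_ge0 density_measure_sigma_additive.

(** Stated for a packed probability, so that a density can be turned into a measure
    in the middle of a proof. *)
Lemma density_probability : (\int[P]_x (h x)%:E = 1)%E ->
  exists Q : probability T R, forall A, (Q A = \int[P]_(x in A) (h x)%:E)%E.
Proof.
move=> hT; have dT : density_measure setT = 1%E by [].
by exists (HB.pack_for (probability T R) density_measure
  (Measure_isProbability.Build _ _ _ density_measure dT)).
Qed.

Lemma integral_density (Q : {measure set T -> \bar R}) f :
  (forall A, measurable A -> Q A = \int[P]_(x in A) (h x)%:E)%E ->
  ge0_measurable f -> (\int[Q]_x f x = \int[P]_x (f x * (h x)%:E))%E.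
Proof.
move=> QE; move: f; apply: ge0_measurable_induction.
- move=> A mA; rewrite integral_indic// setIT QE// integral_mkcond.
  by apply: eq_integral => x _; rewrite /= patchE indicE; case: ifP; rewrite ?mul1e ?mul0e.
- move=> k f k0 [mf f0] IH; rewrite ge0_integralZl// IH -ge0_integralZl//.
  + by apply: eq_integral => x _; rewrite muleA.
  + by apply: emeasurable_funM => //; exact: gh.1.
  + by move=> x _; rewrite mule_ge0//; exact: gh.2.
- move=> f g [mf f0] [mg g0] IHf IHg; rewrite ge0_integralD// IHf IHg -ge0_integralD//.
  + by apply: eq_integral => x _; rewrite ge0_muleDl.
  + by move=> x _; rewrite mule_ge0//; exact: gh.2.
  + by apply: emeasurable_funM => //; exact: gh.1.
  + by move=> x _; rewrite mule_ge0//; exact: gh.2.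
  + by apply: emeasurable_funM => //; exact: gh.1.
- move=> f gf ndf IH.
  transitivity (limn (fun n => \int[P]_x (f n x * (h x)%:E)))%E.
    rewrite monotone_convergence//.
    + by under eq_fun do rewrite IH.
    + by move=> n; exact: (gf n).1.
    + by move=> n x _; exact: (gf n).2.
  rewrite -monotone_convergence//.
  + apply: eq_integral => x _; apply/cvg_lim => //.
    by apply: cvgeZr => //; apply: ereal_nondecreasing_is_cvgn; exact: ndf.
  + by move=> n; apply: emeasurable_funM; [exact: (gf n).1|exact: gh.1].
  + by move=> n x _; rewrite mule_ge0 ?lee_fin//; exact: (gf n).2.
  + by move=> x _ m n mn; rewrite lee_wpmul2r ?lee_fin//; exact: ndf.
Qed.

End density.

(** * Integrals over infinite products *)

Section law.
Context {R : realType} d d' (T : measurableType d) (T' : measurableType d').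
Variables (P : probability T R) (f : T -> T') (mf : measurable_fun setT f).

(** The image measure, with its probability structure, of a function that is only
    known to be measurable by a hypothesis. *)
Definition law : probability T' R :=
  distribution P (HB.pack_for {mfun T >-> T'} f (isMeasurableFun.Build _ _ _ _ f mf)).

Lemma lawE A : law A = P (f @^-1` A).
Proof. by []. Qed.

Lemma integral_law (g : T' -> \bar R) : ge0_measurable g ->
  (\int[law]_y g y = \int[P]_x g (f x))%E.
Proof. by case=> mg g0; rewrite ge0_integral_distribution. Qed.

End law.

Lemma prode_ord_split {R : realType} (F : nat -> \bar R) n m : (n <= m)%N ->
  (\prod_(i < m) F i = \prod_(i < n) F i * \prod_(n <= i < m) F i)%E.
Proof. by move=> nm; rewrite -!(big_mkord xpredT F) (@big_cat_nat _ _ _ n). Qed.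

Section product_prob_integral.
Context {R : realType}.
Implicit Types (mu nu : nat -> probability (measurableTypeR R) R).

Lemma integral_product_prob_eq mu (P : probability (seqspace R) R) (f : seqspace R -> \bar R) :
  is_product_prob mu P -> (\int[product_prob mu]_x f x = \int[P]_x f x)%E.
Proof.
by move=> hP; apply: eq_measure_integral => A mA _; exact: product_prob_unique.
Qed.

Definition scons (p : measurableTypeR R * seqspace R) : seqspace R :=
  fun i => if i is j.+1 then p.2 j else p.1.

Lemma measurable_scons : measurable_fun setT scons.
Proof.
apply: measurable_seqspace => -[|i] /=; first exact: measurable_fst.
by apply: (measurableT_comp (measurable_coord i)); exact: measurable_snd.
Qed.

(** Splitting off the first coordinate reduces integrals over the infinite product
    to Tonelli's theorem for two factors. *)
Lemma product_prob_scons mu :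
  is_product_prob mu
    (law (mu 0%N \x product_prob (fun i => mu i.+1))%E measurable_scons).
Proof.
move=> n U mU; rewrite lawE; case: n => [|n].
  rewrite big_ord0 (_ : [set x | _] = setT) ?probability_setT//.
  by apply/seteqP; split.
rewrite big_ord_recl /= -(@product_probP _ (fun i => mu i.+1) n (fun i => U i.+1) (fun i => mU i.+1)).
rewrite -product_measure1E//; last first.
  by have [] := @rectangle_cylinder _ n (fun i => U i.+1) (fun i => mU i.+1).
congr (_ _); apply/seteqP; split => [[t x] /= Ux|[t x] /= [Ut Ux] [|i]//].
  by split=> [|i ilt]; [exact: (Ux 0%N)|exact: (Ux i.+1)].
exact: Ux.
Qed.

Lemma integral_product_prob_scons mu f : ge0_measurable f ->
  (\int[product_prob mu]_x f x =
   \int[mu 0%N]_t \int[product_prob (fun i => mu i.+1)]_x f (scons (t, x)))%E.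
Proof.
move=> gf; rewrite (integral_product_prob_eq _ (product_prob_scons mu)) integral_law//.
rewrite (@fubini_tonelli1 _ _ _ _ R (mu 0%N) (product_prob (fun i => mu i.+1)) (f \o scons))//.
  by apply: measurableT_comp; [exact: gf.1|exact: measurable_scons].
by move=> p; exact: gf.2.
Qed.

Lemma ge0_measurable_prod (g : nat -> R -> \bar R) n :
  (forall i, ge0_measurable (g i)) ->
  ge0_measurable (fun x : seqspace R => \prod_(i < n) g i (x i))%E.
Proof.
move=> gg; split; last by move=> x; apply: prode_ge0 => i _; exact: (gg i).2.
elim: n => [|n IH].
  by rewrite (_ : (fun _ => _) = cst 1%E) //; apply/funext => x; rewrite big_ord0.
rewrite (_ : (fun _ => _) = fun x : seqspace R => (\prod_(i < n) g i (x i) * g n (x n))%E);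
  last by apply/funext => x; rewrite big_ord_recr.
apply: emeasurable_funM => //.
by apply: (measurableT_comp (gg n).1); exact: measurable_coord.
Qed.

Lemma integral_product_prob mu (g : nat -> R -> \bar R) n :
  (forall i, ge0_measurable (g i)) ->
  (\int[product_prob mu]_x \prod_(i < n) g i (x i) =
   \prod_(i < n) \int[mu i]_t g i t)%E.
Proof.
elim: n mu g => [|n IH] mu g gg.
  rewrite big_ord0; under eq_integral do rewrite big_ord0.
  by rewrite integral_cst// mul1e; exact: probability_setT.
rewrite integral_product_prob_scons; last exact: ge0_measurable_prod.
rewrite big_ord_recl -[X in (_ * X)%E](IH (fun i => mu i.+1) (fun i => g i.+1) (fun i => gg i.+1)).
rewrite -ge0_integralZr//.
- apply: eq_integral => t _; rewrite -ge0_integralZl//.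
  + by apply: eq_integral => x _; rewrite big_ord_recl.
  + exact: (ge0_measurable_prod n (fun i => gg i.+1)).1.
  + by move=> x _; exact: (ge0_measurable_prod n (fun i => gg i.+1)).2.
  + exact: (gg 0%N).2.
- exact: (gg 0%N).1.
- by move=> x _; exact: (gg 0%N).2.
- by apply: integral_ge0 => x _; exact: (ge0_measurable_prod n (fun i => gg i.+1)).2.
Qed.

Lemma measurable_prod_coord (g : nat -> R -> R) n :
  (forall i, measurable_fun setT (g i)) ->
  measurable_fun setT (fun x : seqspace R => \prod_(i < n) g i (x i)).
Proof.
move=> mg; elim: n => [|n IH].
  by rewrite (_ : (fun _ => _) = cst 1) //; apply/funext => x; rewrite big_ord0.
rewrite (_ : (fun _ => _) = fun x : seqspace R => \prod_(i < n) g i (x i) * g n (x n));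
  last by apply/funext => x; rewrite big_ord_recr.
apply: measurable_funM => //.
by apply: (measurableT_comp (mg n)); exact: measurable_coord.
Qed.

(** Both sides define product measures: the second one because the integral of a
    product of functions of single coordinates factorizes. Uniqueness on rectangles
    does the rest. *)
Lemma product_prob_density mu nu (g : nat -> R -> R) n :
  (forall i, measurable_fun setT (g i)) -> (forall i t, 0 <= g i t) ->
  (forall i U, (i < n)%N -> measurable U -> mu i U = \int[nu i]_(t in U) (g i t)%:E)%E ->
  (forall i, (n <= i)%N -> mu i = nu i) ->
  forall A, measurable A ->
  (product_prob mu A = \int[product_prob nu]_(x in A) (\prod_(i < n) g i (x i))%:E)%E.
Proof.
move=> mg g0 mu_nu mu_nu' A mA; pose h (x : seqspace R) := \prod_(i < n) g i (x i).
have mh : measurable_fun setT h by exact: measurable_prod_coord.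
have h0 x : 0 <= h x by exact: prodr_ge0.
suff [P PE hP] : exists2 P : probability (seqspace R) R,
    (forall A, P A = \int[product_prob nu]_(x in A) (h x)%:E)%E & is_product_prob mu P.
  by rewrite (product_prob_unique hP)// PE.
have hprod m (U : nat -> set (measurableTypeR R)) : (forall i, measurable (U i)) -> (n <= m)%N ->
    (\int[product_prob nu]_(x in [set x | forall i, (i < m)%N -> U i (x i)]) (h x)%:E =
    \prod_(i < m) mu i (U i))%E.
  move=> mU nm.
  pose G i t := (if (i < n)%N then (g i t)%:E * (\1_(U i) t)%:E else (\1_(U i) t)%:E)%E.
  have gG i : ge0_measurable (G i).
    have gU : ge0_measurable (fun t => (\1_(U i) t : R)%:E).
      by split => [|x]; [apply/measurable_EFinP; exact: measurable_indic|rewrite lee_fin].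
    rewrite /G; case: (i < n)%N => //; split.
      by apply: emeasurable_funM; [exact/measurable_EFinP|exact: gU.1].
    by move=> t; rewrite mule_ge0 ?lee_fin.
  transitivity (\int[product_prob nu]_x \prod_(i < m) G i (x i))%E.
    rewrite integral_mkcond; apply: eq_integral => x _.
    transitivity ((h x)%:E * ind [set x | forall i, (i < m)%N -> U i (x i)] x)%E.
      by rewrite /= patchE /ind indicE; case: ifP; rewrite ?mule1 ?mule0.
    rewrite ind_rectangle /h (prode_ord_split (fun i => (\1_(U i) (x i))%:E) nm).
    rewrite (prode_ord_split (fun i => G i (x i)) nm) muleA; congr (_ * _)%E.
      rewrite -prodEFin -big_split; apply: eq_bigr => i _ /=.
      by rewrite /G ltn_ord.
    by apply: eq_big_nat => i /andP[ni _]; rewrite /G ltnNge ni.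
  rewrite integral_product_prob//; apply: eq_bigr => i _; rewrite /G.
  have [ilt|ni] := ltnP i n; last by rewrite integral_indic ?setIT// mu_nu'.
  rewrite mu_nu// [RHS]integral_mkcond; apply: eq_integral => t _.
  by rewrite /= patchE indicE; case: ifP; rewrite ?mule1 ?mule0.
have hT : (\int[product_prob nu]_x (h x)%:E = 1)%E.
  have := hprod n (fun=> setT) (fun=> measurableT) (leqnn n).
  rewrite (_ : [set x | _] = setT); last by apply/seteqP; split.
  by rewrite big1// => i _; exact: probability_setT.
have [P PE] := density_probability mh h0 hT; exists P => //.
move=> m U mU; rewrite PE; have [nm|/ltnW mn] := leqP n m; first exact: hprod.
pose V i := if (i < m)%N then U i else setT.
have mV i : measurable (V i) by rewrite /V; case: ifP.
have := hprod n V mV (leqnn n).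
rewrite (_ : [set x | _] = [set x | forall i, (i < m)%N -> U i (x i)]).
  move=> ->; rewrite (prode_ord_split (fun i => mu i (V i)) mn).
  rewrite (_ : \prod_(m <= i < n) _ = 1)%E; last first.
    rewrite big_nat big1// => i /andP[mi _]; rewrite /V ltnNge mi/=.
    exact: probability_setT.
  by rewrite mule1; apply: eq_bigr => i _; rewrite /V ltn_ord.
apply/seteqP; split => [x Vx i im|x Ux i ilt]; rewrite /V.
  by have := Vx i (leq_trans im mn); rewrite /V im.
by case: ifP => // /Ux.
Qed.

End product_prob_integral.

(** * Exponentially tilted Gaussian integrals *)

Section gauss_facts.
Context {R : realType}.
Implicit Types (m v a b t lam : R).

(** Completing the square: a Gaussian density times the exponential of a quadratic
    is a multiple of another Gaussian density as long as the quadratic coefficient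
    stays below that of the Gaussian, that is, [a < 1]. *)
Lemma normal_pdf_tilt m v a b t : 0 < v -> a < 1 ->
  normal_pdf m (Num.sqrt v) t * expR (a * t ^+ 2 / (2 * v) + b * t / v) =
  (Num.sqrt (1 - a))^-1 * expR ((m + b) ^+ 2 / (2 * v * (1 - a)) - m ^+ 2 / (2 * v)) *
  normal_pdf ((m + b) / (1 - a)) (Num.sqrt (v / (1 - a))) t.
Proof.
move=> v0 a1; have a0 : 0 < 1 - a by rewrite subr_gt0.
have va0 : 0 < v / (1 - a) by rewrite divr_gt0.
rewrite !normal_pdfE ?gt_eqF ?sqrtr_gt0// /normal_peak /normal_fun.
rewrite !sqr_sqrtr ?ltW//.
have -> : Num.sqrt (v / (1 - a) * pi *+ 2) = Num.sqrt (v * pi *+ 2) / Num.sqrt (1 - a).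
  rewrite -sqrtrV ?ltW// -sqrtrM ?mulrn_wge0 ?mulr_ge0 ?pi_ge0 ?ltW//.
  by congr Num.sqrt; rewrite mulrnAl [v / _ * _]mulrAC.
have sq0 : Num.sqrt (v * pi *+ 2) != 0.
  by rewrite gt_eqF// sqrtr_gt0 pmulrn_lgt0// mulr_gt0// pi_gt0.
have sa0 : Num.sqrt (1 - a) != 0 by rewrite gt_eqF// sqrtr_gt0.
rewrite -[LHS]mulrA -expRD [RHS]mulrACA -expRD; congr (_ * expR _).
  by field; rewrite sq0 sa0.
by field; rewrite ?gt_eqF.
Qed.

Lemma gaussE m v : v != 0 -> gauss m v = normal_prob m (Num.sqrt v) :> probability _ R.
Proof. by rewrite /gauss => /negPf ->. Qed.

Lemma integral_gauss m v (f : R -> \bar R) : v != 0 -> ge0_measurable f ->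
  (\int[gauss m v]_t f t =
   \int[lebesgue_measure]_t (f t * (normal_pdf m (Num.sqrt v) t)%:E))%E.
Proof.
move=> v0 gf; rewrite gaussE//; apply: integral_density => //.
- exact: measurable_normal_pdf.
- by move=> x; exact: normal_pdf_ge0.
Qed.

Lemma gauss00 (U : set (measurableTypeR R)) : gauss 0 0 U = (\1_U (0 : R))%:E.
Proof. by rewrite /gauss eqxx. Qed.

Lemma integral_dirac_ge0 m (f : R -> \bar R) : ge0_measurable f ->
  (\int[gauss m 0]_t f t = f m)%E.
Proof. by case=> mf f0; rewrite /gauss eqxx/= integral_dirac// diracT mul1e. Qed.

Lemma measurable_tilt a b v :
  measurable_fun setT (fun t : R => expR (a * t ^+ 2 / (2 * v) + b * t / v)).
Proof.
apply: measurableT_comp => //; apply: measurable_funD.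
  by apply: measurable_funM => //; apply: measurable_funM.
by apply: measurable_funM => //; apply: measurable_funM.
Qed.

Lemma ge0_measurableM d (T : measurableType d) (f : T -> \bar R) (h : T -> R) :
  ge0_measurable f -> measurable_fun setT h -> (forall x, 0 <= h x) ->
  ge0_measurable (fun x => f x * (h x)%:E)%E.
Proof.
move=> [mf f0] mh h0; split; last by move=> x; rewrite mule_ge0// lee_fin.
by apply: emeasurable_funM => //; exact/measurable_EFinP.
Qed.

Lemma integral_gauss_tilt m v a b (f : R -> \bar R) : 0 < v -> a < 1 -> ge0_measurable f ->
  (\int[gauss m v]_t (f t * (expR (a * t ^+ 2 / (2 * v) + b * t / v))%:E) =
   ((Num.sqrt (1 - a))^-1 * expR ((m + b) ^+ 2 / (2 * v * (1 - a)) - m ^+ 2 / (2 * v)))%:E *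
   \int[gauss ((m + b) / (1 - a)) (v / (1 - a))]_t f t)%E.
Proof.
move=> v0 a1 gf; have va0 : 0 < v / (1 - a) by rewrite divr_gt0// subr_gt0.
have gtilt : ge0_measurable (fun t => f t * (expR (a * t ^+ 2 / (2 * v) + b * t / v))%:E)%E.
  by apply: ge0_measurableM => //; exact: measurable_tilt.
rewrite [X in _ = (_ * X)%E](integral_gauss _ (lt0r_neq0 va0) gf).
rewrite (integral_gauss m (lt0r_neq0 v0) gtilt).
have [mf f0] := gf.
rewrite -ge0_integralZl ?lee_fin; [|exact: measurableT| | | ]; last first.
- by rewrite mulr_ge0 ?expR_ge0// invr_ge0 sqrtr_ge0.
- by move=> x _; rewrite mule_ge0 ?lee_fin ?normal_pdf_ge0.
- exact: (ge0_measurableM gf (measurable_normal_pdf _ _) (normal_pdf_ge0 _ _)).1.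
- apply: eq_integral => t _; rewrite -muleA -EFinM [(_ * normal_pdf _ _ _)%R]mulrC normal_pdf_tilt//.
  by rewrite EFinM muleCA.
Qed.

Lemma integral_gauss_exp m v a : 0 < v -> a < 1 ->
  (\int[gauss m v]_t (expR (a * t ^+ 2 / (2 * v)))%:E =
   ((Num.sqrt (1 - a))^-1 * expR (a * m ^+ 2 / (2 * v * (1 - a))))%:E)%E.
Proof.
move=> v0 a1; have g1 : ge0_measurable (cst 1%E : R -> \bar R) by split.
have := @integral_gauss_tilt m v a 0 _ v0 a1 g1.
rewrite [X in _ = (_ * X)%E](_ : _ = 1%E); last exact: integral_prob_cst.
rewrite mule1 addr0 => h.
transitivity (\int[gauss m v]_t ((cst 1 t) *
    (expR (a * t ^+ 2 / (2 * v) + 0 * t / v))%:E))%E.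
  by apply: eq_integral => t _; rewrite mul1e !mul0r addr0.
rewrite h; congr (_ * expR _)%:E; field.
by rewrite !gt_eqF// subr_gt0.
Qed.

End gauss_facts.

Opaque gauss.

(** * Gaussian likelihoods *)

Section likelihood.
Context {R : realType}.
Implicit Types (m v a b x lam theta : R).

(** The density of [N(theta, v)] with respect to [N(0, v)]. Densities with respect
    to the pure-noise law, not to Lebesgue measure, survive the passage to
    infinitely many coordinates. *)
Definition lik v theta x : R := expR ((theta * x - theta ^+ 2 / 2) / v).

Lemma lik_ge0 v theta x : 0 <= lik v theta x.
Proof. exact: expR_ge0. Qed.

Lemma measurable_lik2 v d (T : measurableType d) (f g : T -> R) :
  measurable_fun setT f -> measurable_fun setT g ->
  measurable_fun setT (fun t => lik v (f t) (g t)).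
Proof.
move=> mf mg; apply: measurableT_comp => //; apply: measurable_funM => //.
apply: measurable_funB; first exact: measurable_funM.
by apply: measurable_funM => //; exact: measurable_funX.
Qed.

Lemma gauss_density v theta (U : set (measurableTypeR R)) : 0 < v -> measurable U ->
  (gauss theta v U = \int[gauss 0 v]_(x in U) (lik v theta x)%:E)%E.
Proof.
move=> v0 mU; rewrite integral_mkcond.
transitivity (\int[gauss 0 v]_x ((expR (- (theta ^+ 2 / (2 * v))) *
    \1_U x)%:E * (expR (0 * x ^+ 2 / (2 * v) + theta * x / v))%:E))%E.
  rewrite integral_gauss_tilt//; last first.
    split => [|x]; last by rewrite lee_fin mulr_ge0 ?expR_ge0.
    by apply/measurable_EFinP; apply: measurable_funM => //; exact: measurable_indic.
  under eq_integral do rewrite EFinM.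
  rewrite ge0_integralZl ?lee_fin ?expR_ge0//; last first.
    by apply/measurable_EFinP; exact: measurable_indic.
  rewrite integral_indic// setIT subr0 !divr1 sqrtr1 invr1 mul1r muleA -EFinM -expRD.
  by rewrite !add0r expr0n/= mul0r subr0 mulr1 subrr expR0 mul1e.
apply: eq_integral => x _; rewrite /= patchE indicE; case: ifP => _; last by rewrite mulr0 mul0e.
by rewrite mulr1 -EFinM -expRD; congr (expR _)%:E; field; rewrite gt_eqF.
Qed.

Lemma lik_mass v theta : 0 < v -> (\int[gauss 0 v]_x (lik v theta x)%:E = 1)%E.
Proof. by move=> v0; rewrite -gauss_density//; exact: probability_setT. Qed.

(** A bound of the right order avoids computing moments: [(t - m) ^ 2] is at most
    [4 v exp ((t - m) ^ 2 / (4 v))], and the exponential is integrated by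
    [integral_gauss_tilt]. The constant is [12 >= 8 sqrt 2]. The case [v = 0]
    occurs at the coordinates where the prior is a point mass. *)
Lemma gauss_second_moment m v theta : 0 <= v ->
  (\int[gauss m v]_t ((t - theta) ^+ 2)%:E <= (2 * (m - theta) ^+ 2 + 12 * v)%:E)%E.
Proof.
rewrite le_eqVlt => /predU1P[<-|v0].
  rewrite integral_dirac_ge0; first by rewrite lee_fin; have := sqr_ge0 (m - theta); lra.
  split => [|x]; last by rewrite lee_fin sqr_ge0.
  by apply/measurable_EFinP; apply: measurable_funX; exact: measurable_funB.
have g0 : ge0_measurable (cst 1%E : R -> \bar R) by split.
apply: (@le_trans _ _ (\int[gauss m v]_t ((2 * (m - theta) ^+ 2)%:E +
    (8 * v * expR (m ^+ 2 / (4 * v)))%:E *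
    (expR (2^-1 * t ^+ 2 / (2 * v) + (- m / 2) * t / v))%:E)))%E.
  apply: ge0_le_integral => //.
  - by move=> x _; rewrite lee_fin sqr_ge0.
  - by apply/measurable_EFinP; apply: measurable_funX; exact: measurable_funB.
  - apply: emeasurable_funD => //; apply: measurable_funeM.
    by apply/measurable_EFinP; exact: measurable_tilt.
  - move=> t _; rewrite -EFinM -EFinD lee_fin -[8 * v * _ * _]mulrA -expRD.
    have -> : m ^+ 2 / (4 * v) + (2^-1 * t ^+ 2 / (2 * v) + - m / 2 * t / v) = (t - m) ^+ 2 / (4 * v).
      by field; rewrite gt_eqF.
    have := expR_ge1Dx ((t - m) ^+ 2 / (4 * v)); set E := expR _ => h.
    have h2 : (t - m) ^+ 2 <= 4 * v * E.
      rewrite mulrC -ler_pdivrMr ?mulr_gt0//; apply: le_trans h.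
      by rewrite lerDr.
    have := sqr_ge0 (t - m - (m - theta)).
    rewrite [_ ^+ 2 in X in X -> _]expr2 !expr2 in h2 *; nra.
rewrite ge0_integralD; [|exact: measurableT| | | |]; last first.
- by apply: measurable_funeM; apply/measurable_EFinP; exact: measurable_tilt.
- by move=> t _; rewrite mule_ge0 ?lee_fin ?mulr_ge0 ?expR_ge0// ltW.
- exact: measurable_cst.
- by move=> t _; rewrite lee_fin mulr_ge0 ?sqr_ge0.
rewrite (integral_prob_cst (gauss m v)) ge0_integralZl; [|exact: measurableT| | |]; last first.
- by rewrite lee_fin ?mulr_ge0 ?expR_ge0// ltW.
- by move=> t _; rewrite lee_fin expR_ge0.
- by apply/measurable_EFinP; exact: measurable_tilt.
rewrite (_ : (\int[gauss m v]_t _)%E = (\int[gauss m v]_t (cst 1 t *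
   (expR (2^-1 * t ^+ 2 / (2 * v) + (- m / 2) * t / v))%:E))%E); last first.
  by apply: eq_integral => t _; rewrite mul1e.
rewrite integral_gauss_tilt//; last by lra.
rewrite (integral_prob_cst (gauss _ _) 1%E) mule1.
rewrite -EFinM -EFinD lee_fin lerD2l.
have -> : 8 * v * expR (m ^+ 2 / (4 * v)) * ((Num.sqrt (1 - 2^-1))^-1 *
    expR ((m + - m / 2) ^+ 2 / (2 * v * (1 - 2^-1)) - m ^+ 2 / (2 * v))) =
    8 * v * (Num.sqrt (1 - 2^-1))^-1 * (expR (m ^+ 2 / (4 * v)) *
     expR ((m + - m / 2) ^+ 2 / (2 * v * (1 - 2^-1)) - m ^+ 2 / (2 * v))) by ring.
rewrite -expRD.
have -> : m ^+ 2 / (4 * v) + ((m + - m / 2) ^+ 2 / (2 * v * (1 - 2^-1)) - m ^+ 2 / (2 * v)) = 0.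
  by field; rewrite gt_eqF.
rewrite expR0 mulr1.
have -> : 1 - 2^-1 = 2^-1 :> R by lra.
have s0 : 0 < Num.sqrt (2^-1 : R) by rewrite sqrtr_gt0; lra.
have s2 : Num.sqrt (2^-1 : R) ^+ 2 = 2^-1 by rewrite sqr_sqrtr//; lra.
have r23 : 2 / 3 <= Num.sqrt (2^-1 : R) by rewrite expr2 in s2; nra.
have : (Num.sqrt (2^-1 : R))^-1 <= (2 / 3)^-1.
  by rewrite lef_pV2 ?posrE//; lra.
rewrite (_ : (2 / 3)^-1 = 3 / 2); last by field.
move: (Num.sqrt _)^-1 => r; nra.
Qed.

(** The evidence of one coordinate relative to pure noise, for a prior variance
    [v lam] with [s = 1 / (1 + lam)]. *)
Definition mlik v s x : R := Num.sqrt s * expR ((1 - s) * x ^+ 2 / (2 * v)).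

(** Conjugacy in one coordinate: the posterior is [N((1 - s) x, v (1 - s))]. For
    [lam = 0] both sides reduce to evaluation at the point mass. *)
Lemma gauss_posterior v lam x (f : R -> \bar R) : 0 < v -> 0 <= lam -> ge0_measurable f ->
  let s := (1 + lam)^-1 in
  (\int[gauss 0 (v * lam)]_t (f t * (lik v t x)%:E) =
   (mlik v s x)%:E * \int[gauss ((1 - s) * x) (v * (1 - s))]_t f t)%E.
Proof.
move=> v0; rewrite le_eqVlt => /predU1P[<-|l0] gf /=.
  rewrite addr0 invr1 subrr mulr0 mul0r !integral_dirac_ge0//; last first.
    apply: ge0_measurableM => // [|t]; last exact: lik_ge0.
    by apply: measurable_lik2 => //; exact: measurable_cst.
  by rewrite /lik /mlik sqrtr1 expr0n/= !mul0r subr0 subrr !mul0r expR0 mulr1 mule1 mul1e.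
have l1 : 1 + lam != 0 by rewrite gt_eqF// addr_gt0.
have lam1 : - lam < 1 by lra.
transitivity (\int[gauss 0 (v * lam)]_t (f t *
    (expR (- lam * t ^+ 2 / (2 * (v * lam)) + lam * x * t / (v * lam)))%:E))%E.
  apply: eq_integral => t _; rewrite /lik; congr (_ * (expR _)%:E)%E.
  by field; rewrite !gt_eqF.
have tilt := integral_gauss_tilt 0 (lam * x) (mulr_gt0 v0 l0) lam1 gf.
apply: (etrans tilt) => {tilt}.
rewrite add0r.
rewrite opprK.
have -> : lam * x / (1 + lam) = (1 - (1 + lam)^-1) * x by field.
have -> : v * lam / (1 + lam) = v * (1 - (1 + lam)^-1) by field.
congr (_%:E * _)%E; rewrite /mlik -sqrtrV ?addr_ge0 ?(ltW l0)//; congr (_ * expR _).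
by field; rewrite l1 !gt_eqF.
Qed.

End likelihood.

(** * Absolute continuity of the sequence model *)

Section truncation.
Context {R : realType}.
Implicit Types mu nu : nat -> probability (measurableTypeR R) R.

Definition trunc n (x : seqspace R) : seqspace R := fun i => if (i < n)%N then x i else 0.

Lemma measurable_trunc n : measurable_fun setT (trunc n).
Proof.
apply: measurable_seqspace => i; rewrite /trunc.
by case: (i < n)%N; [exact: measurable_coord|exact: measurable_cst].
Qed.

Definition trunc_seq n mu i : probability (measurableTypeR R) R :=
  if (i < n)%N then mu i else gauss 0 0.

Lemma product_prob_trunc n mu :
  is_product_prob (trunc_seq n mu) (law (product_prob mu) (measurable_trunc n)).
Proof.
move=> m U mU; rewrite lawE.
pose V i := if (i < n)%N then U i else if (0 : R) \in U i then setT else set0.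
have mV i : measurable (V i) by rewrite /V; case: ifP => // _; case: ifP.
transitivity (\prod_(i < m) mu i (V i))%E.
  rewrite -product_probP//; congr (product_prob mu _).
  apply/seteqP; split => x Ux i im; have := Ux i im; rewrite /V /trunc/=;
    case: (i < n)%N => //; first by move=> /mem_set ->.
  by have [/set_mem|] := boolP (0 \in U i).
apply: eq_bigr => i _; rewrite /V /trunc_seq; case: ifP => // _.
rewrite gauss00 indicE; case: ifP => _; [exact: probability_setT|exact: measure0].
Qed.

(** Truncation turns two products that agree below [n] into the same measure, and a
    set that depends on the first [n] coordinates does not see the truncation. *)
Lemma product_prob_depends n mu nu A : (forall i, (i < n)%N -> mu i = nu i) ->
  measurable A -> depends n (ind A) -> product_prob mu A = product_prob nu A.
Proof.
move=> mu_nu mA /depends_indP dA.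
have truncA mu' : product_prob mu' A = product_prob (trunc_seq n mu') A.
  transitivity (product_prob mu' (trunc n @^-1` A)); last first.
    exact/esym/(product_prob_unique (product_prob_trunc n mu')).
  congr (product_prob mu' _); apply/seteqP; split => x /= Ax.
    by apply: dA Ax => i ilt; rewrite /trunc ilt.
  by apply: dA Ax => i ilt; rewrite /trunc ilt.
rewrite truncA [RHS]truncA; congr (product_prob _ _); apply/funext => i.
by rewrite /trunc_seq; case: ifP => // /mu_nu.
Qed.

(** If the factors from [n] on are point masses at zero, a point equals its
    truncation almost surely; the proof avoids null sets by comparing image
    measures. *)
Lemma integral_product_prob_trunc n mu (f : seqspace R -> \bar R) :
  (forall i, (n <= i)%N -> mu i = gauss 0 0) -> ge0_measurable f ->
  (\int[product_prob mu]_x f x = \int[product_prob mu]_x f (trunc n x))%E.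
Proof.
move=> mu0 gf; rewrite -(integral_law _ (measurable_trunc n))//.
apply: integral_product_prob_eq.
have e : trunc_seq n mu = mu.
  by apply/funext => i; rewrite /trunc_seq; case: ltnP => // /mu0.
by have := product_prob_trunc n mu; rewrite e.
Qed.

End truncation.

Opaque product_prob.

Section model_facts.
Context {R : realType}.
Variable eps : R.
Hypothesis eps0 : 0 < eps.
Let v := eps ^+ 2.
Let v0 : 0 < v. Proof. by rewrite /v exprn_gt0. Qed.

Lemma measurable_gauss (U : set (measurableTypeR R)) : measurable U ->
  measurable_fun setT (fun t : R => gauss t v U).
Proof.
move=> mU; pose F (p : R * measurableTypeR R) : \bar R := ((lik v p.1 p.2) * \1_U p.2)%:E.
have mF : measurable_fun setT F.
  apply/measurable_EFinP; apply: measurable_funM.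
    by apply: measurable_lik2; [exact: measurable_fst|exact: measurable_snd].
  by apply: measurableT_comp; [exact: measurable_indic|exact: measurable_snd].
have F0 p : (0 <= F p)%E by rewrite lee_fin mulr_ge0// lik_ge0.
have := @measurable_fun_fubini_tonelli_F _ _ _ _ R (gauss 0 v) F mF F0.
apply: eq_measurable_fun => t _; rewrite gauss_density// [RHS]integral_mkcond.
apply: eq_integral => x _; rewrite /F /= patchE indicE.
by case: ifP => _; rewrite ?mulr1 ?mulr0.
Qed.

(** A Dynkin class argument starting from the rectangles, whose probability is a
    finite product of one-dimensional probabilities, each measurable in the mean. *)
Lemma measurable_model A : measurable A ->
  measurable_fun setT (fun theta : seqspace R => model eps theta A).
Proof.
move=> mA; pose P (A : set (seqspace R)) :=
  measurable_fun setT (fun theta : seqspace R => model eps theta A).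
apply: (@dynkin_induction _ (seqspace R) rectangles P).
- exact: measurable_rectangles.
- exact: rectangles_setI.
- rewrite /P (_ : (fun _ => _) = cst 1%E); first exact: measurable_cst.
  by apply/funext => theta; exact: probability_setT.
- move=> _ [n [U [mU ->]]]; rewrite /P.
  rewrite (_ : (fun _ => _) = fun theta : seqspace R =>
    (\prod_(i < n) gauss (theta i) v (U i))%E); last first.
    by apply/funext => theta; exact: product_probP.
  suff gg i : ge0_measurable (fun t : R => gauss t v (U i)).
    exact: (@ge0_measurable_prod R (fun i t => gauss t v (U i)) n gg).1.
  by split => [|t]; [exact: measurable_gauss|exact: measure_ge0].
- move=> S mS PS; rewrite /P.
  rewrite (_ : (fun _ => _) = fun theta => (1 - model eps theta S)%E); last first.
    by apply/funext => theta; exact: probability_setC.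
  by apply: emeasurable_funB.
- move=> F mF tF PF; rewrite /P.
  rewrite (_ : (fun _ => _) = fun theta => (\sum_(0 <= i <oo) model eps theta (F i))%E); last first.
    apply/funext => theta; rewrite measure_semi_bigcup//.
    exact: bigcup_measurable.
  by apply: ge0_emeasurable_sum => [i t _ _|i _]; [exact: measure_ge0|exact: PF].
- by rewrite -measurable_rectangles.
Qed.

Lemma ge0_measurable_integral_model (g : seqspace R -> \bar R) : ge0_measurable g ->
  ge0_measurable (fun theta : seqspace R => \int[model eps theta]_x g x)%E.
Proof.
case=> mg g0; split; last by move=> theta; exact: integral_ge0.
by apply: measurable_fun_integral_kernel => // U; exact: measurable_model.
Qed.

Definition Lik n (theta x : seqspace R) : R := \prod_(i < n) lik v (theta i) (x i).

(** The law of pure noise, the common reference measure. *)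
Definition base : probability (seqspace R) R := model eps (fun=> 0).

Lemma Lik_ge0 n theta x : 0 <= Lik n theta x.
Proof. by apply: prodr_ge0 => i _; exact: lik_ge0. Qed.

Lemma measurable_Lik n d (T : measurableType d) (f g : T -> seqspace R) :
  measurable_fun setT f -> measurable_fun setT g ->
  measurable_fun setT (fun t => Lik n (f t) (g t)).
Proof.
move=> mf mg; apply: measurable_prod => i _; apply: measurable_lik2.
  by apply: (measurableT_comp (measurable_coord i)).
by apply: (measurableT_comp (measurable_coord i)).
Qed.

Lemma model_density n (theta : seqspace R) A : (forall i, (n <= i)%N -> theta i = 0) ->
  measurable A -> (model eps theta A = \int[base]_(x in A) (Lik n theta x)%:E)%E.
Proof.
move=> theta0 mA.
apply: (@product_prob_density R (fun i => gauss (theta i) v) (fun i => gauss 0 v)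
  (fun i => lik v (theta i)) n) => //.
- by move=> i; apply: measurable_lik2 => //; exact: measurable_cst.
- by move=> i t; exact: lik_ge0.
- by move=> i U _ mU; exact: gauss_density.
- by move=> i /theta0 ->.
Qed.

Lemma modelE (theta : seqspace R) :
  model eps theta = product_prob (fun i => gauss (theta i) v).
Proof. by []. Qed.

Lemma baseE : base = product_prob (fun=> gauss 0 v).
Proof. by []. Qed.

Opaque model base.

Lemma integral_model n (theta : seqspace R) (g : seqspace R -> \bar R) :
  (forall i, (n <= i)%N -> theta i = 0) -> ge0_measurable g ->
  (\int[model eps theta]_x g x = \int[base]_x (g x * (Lik n theta x)%:E))%E.
Proof.
move=> theta0 gg; apply: integral_density => //.
- exact: (@measurable_Lik n _ (seqspace R) (cst theta) id).
- by move=> x; exact: Lik_ge0.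
- by move=> A mA; exact: model_density.
Qed.

Lemma Lik_sqr n theta x :
  Lik n theta x ^+ 2 = Lik n (fun i => 2 * theta i) x * expR ((\sum_(i < n) theta i ^+ 2) / v).
Proof.
rewrite /Lik -prodrXl mulr_suml expR_sum -big_split; apply: eq_bigr => i _ /=.
by rewrite /lik -expRM_natl -expRD; congr expR; field; rewrite gt_eqF.
Qed.

(** The likelihood ratio [L] on the first [n] coordinates satisfies
    [L <= c + L ^ 2 / c], and its second moment [exp (|theta| ^ 2 / v)] stays
    bounded as [n] grows. *)
Lemma model_cylinder_le (theta : seqspace R) A (c K : R) : 0 < c -> cylinder A ->
  (forall n, \sum_(i < n) theta i ^+ 2 <= K) ->
  (model eps theta A <= c%:E * base A + (expR (K / v) / c)%:E)%E.
Proof.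
move=> c0 [mA [n dA]] thetaK.
have trunc0 (t : seqspace R) i : (n <= i)%N -> trunc n t i = 0.
  by rewrite leqNgt /trunc => /negbTE ->.
rewrite [X in (X <= _)%E](_ : _ = model eps (trunc n theta) A); last first.
  rewrite !modelE; apply: product_prob_depends mA dA => i ilt.
  by rewrite /trunc ilt.
rewrite [X in (X <= _)%E](model_density (trunc0 theta) mA).
have mL t : measurable_fun setT (Lik n t).
  exact: (@measurable_Lik n _ (seqspace R) (cst t) id).
pose theta2 := trunc n (fun i => 2 * theta i).
have mass : (\int[base]_x (Lik n theta2 x)%:E = 1)%E.
  by rewrite -(model_density (trunc0 _) measurableT); exact: probability_setT.
have LE x : Lik n (trunc n theta) x ^+ 2 <= Lik n theta2 x * expR (K / v).
  rewrite Lik_sqr (_ : Lik n _ x = Lik n theta2 x).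
    apply: ler_wpM2l; first exact: Lik_ge0.
    rewrite ler_expR ler_pM2r ?invr_gt0//; apply: le_trans (thetaK n).
    by rewrite le_eqVlt; apply/orP; left; apply/eqP/eq_bigr => i _; rewrite /trunc ltn_ord.
  by apply: eq_bigr => i _; rewrite /theta2 /trunc ltn_ord.
rewrite integral_mkcond.
apply: (@le_trans _ _ (\int[base]_x (c%:E * (\1_A x)%:E +
    (expR (K / v) / c)%:E * (Lik n theta2 x)%:E)))%E.
  apply: ge0_le_integral => //.
  - by move=> x _; rewrite patchE; case: ifP => // _; rewrite lee_fin Lik_ge0.
  - apply/(measurable_restrictT _ mA); apply: measurable_funTS.
    exact/measurable_EFinP.
  - apply: emeasurable_funD; apply: measurable_funeM; apply/measurable_EFinP.
      exact: measurable_indic.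
    exact: mL.
  - move=> x _; rewrite patchE indicE; have := LE x.
    set L := Lik n _ x; set M := Lik n _ x * _ => LM.
    have L0 : 0 <= L by exact: Lik_ge0.
    have M0 : 0 <= M by exact: le_trans (sqr_ge0 L) LM.
    rewrite -!EFinM -EFinD (_ : _ / c * _ = M / c); last first.
      by rewrite /M mulrAC [_ * expR _]mulrC.
    case: ifP => _; last first.
      by change (0%:E <= (c * 0 + M / c)%:E)%E; rewrite lee_fin mulr0 add0r divr_ge0// ltW.
    rewrite lee_fin mulr1 -lerBlDl ler_pdivlMr//.
    by rewrite expr2 in LM; nra.
rewrite ge0_integralD; [|exact: measurableT| | | |]; last first.
- by apply: measurable_funeM; apply/measurable_EFinP; exact: mL.
- by move=> x _; rewrite mule_ge0 ?lee_fin ?Lik_ge0// divr_ge0 ?expR_ge0// ltW.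
- by apply: measurable_funeM; apply/measurable_EFinP; exact: measurable_indic.
- by move=> x _; rewrite mule_ge0 ?lee_fin// ltW.
rewrite ge0_integralZl; [|exact: measurableT| | |]; last first.
- by rewrite lee_fin ltW.
- by move=> x _; rewrite lee_fin.
- by apply/measurable_EFinP; exact: measurable_indic.
rewrite ge0_integralZl; [|exact: measurableT| | |]; last first.
- by rewrite lee_fin divr_ge0 ?expR_ge0// ltW.
- by move=> x _; rewrite lee_fin Lik_ge0.
- by apply/measurable_EFinP; exact: mL.
by rewrite mass mule1 integral_indic ?setIT.
Qed.

(** Absolute continuity for square-summable means. A null set of [base] is covered
    by cylinders of small total [base]-probability; their finite unions are
    cylinders, for which [model_cylinder_le] applies with a constant that does not
    depend on their level. Letting [c] be large first and the cover fine afterwards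
    makes both terms small. *)
Lemma model_dominated (theta : seqspace R) A : l2 theta -> measurable A ->
  base A = 0%E -> model eps theta A = 0%E.
Proof.
move=> l2theta mA A0.
have K0 : sqnorm theta \is a fin_num.
  by rewrite ge0_fin_numE// nneseries_ge0// => i _ _; rewrite lee_fin sqr_ge0.
pose K := fine (sqnorm theta).
have thetaK n : \sum_(i < n) theta i ^+ 2 <= K.
  rewrite -lee_fin fineK// -sumEFin -(big_mkord xpredT (fun i => (theta i ^+ 2)%:E)).
  by apply: nneseries_lim_ge => i _ _; rewrite lee_fin sqr_ge0.
apply/eqP; rewrite eq_le measure_ge0 andbT; apply/lee_addgt0Pr => delta delta0.
rewrite add0e; pose E := expR (K / v).
have E0 : 0 < E by exact: expR_gt0.
pose c := 2 * E / delta.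
have c0 : 0 < c by rewrite divr_gt0// mulr_gt0.
have [F [cF AF sumF]] : exists F : (set (seqspace R))^nat, [/\ forall i, cylinder (F i),
    A `<=` \bigcup_i F i & (\sum_(0 <= i <oo) base (F i) < (delta / (2 * c))%:E)%E].
  rewrite baseE; apply: product_prob_cover => //.
  by rewrite -baseE [X in (X < _)%E]A0 lte_fin divr_gt0// mulr_gt0.
have mF i : measurable (F i) by have [] := cF i.
have cG m : cylinder (\big[setU/set0]_(i < m) F i).
  exact: cylinder_bigsetU.
have mG m : measurable (\big[setU/set0]_(i < m) F i) by have [] := cG m.
apply: (@le_trans _ _ (model eps theta (\bigcup_i F i))).
  by apply: le_measure => //; rewrite inE//; exact: bigcup_measurable.
rewrite -bigcup_bigsetU_bigcup.
have cvgG : model eps theta (\big[setU/set0]_(i < m.+1) F i) @[m --> \oo] -->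
    model eps theta (\bigcup_m \big[setU/set0]_(i < m.+1) F i).
  apply: nondecreasing_cvg_mu => [m||m n mn]; first exact: mG.
    by apply: bigcup_measurable => m _; exact: mG.
  by apply/subsetPset; apply: subset_bigsetU; rewrite ltnS.
rewrite -(cvg_lim _ cvgG)//; apply: lime_le; first by apply/cvg_ex; eexists; exact: cvgG.
apply: nearW => m; apply: le_trans (model_cylinder_le c0 (cG m.+1) thetaK) _.
have -> : delta = c * (delta / (2 * c)) + E / c.
  by rewrite /c; field; rewrite !gt_eqF.
rewrite EFinD leeD2r// [leRHS]EFinM.
apply: lee_wpmul2l; first by rewrite lee_fin ltW.
apply: le_trans (ltW sumF); apply: le_trans (Boole_inequality _ (fun i _ => mF i)) _.
rewrite -(big_mkord xpredT (fun i => base (F i))).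
by apply: nneseries_lim_ge => i _ _; exact: measure_ge0.
Qed.

End model_facts.

(** * Posteriors and almost sure comparison *)

Opaque gauss product_prob model base.

Section ae_comparison.
Context {R : realType} d (T : measurableType d) (P : probability T R).

(** Where [g2 < g1] two rationals [p < q] fit between them, [g2 <= p] and
    [q <= g1]; integrating over the set of such points shows that it is null. *)
Lemma ae_le_of_integral_le (g1 g2 : T -> \bar R) :
  ge0_measurable g1 -> ge0_measurable g2 ->
  (forall A, measurable A -> \int[P]_x (g1 x * (\1_A x)%:E) <= \int[P]_x (g2 x * (\1_A x)%:E))%E ->
  {ae P, forall x, (g1 x <= g2 x)%E}.
Proof.
move=> [mg1 g10] [mg2 g20] g12.
pose N (pq : rat * rat) := [set x | (g2 x <= (ratr pq.1)%:E)%E] `&` [set x | ((ratr pq.2)%:E <= g1 x)%E].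
have mN pq : measurable (N pq).
  apply: measurableI.
    by rewrite -[X in measurable X]setTI; apply: emeasurable_fun_infty_c.
  by rewrite -[X in measurable X]setTI; apply: emeasurable_fun_c_infty.
have N0 pq : (0 <= pq.1) -> (pq.1 < pq.2) -> P (N pq) = 0%E.
  case: pq => p q /= p0 pq.
  have pq' : (ratr p : R) < ratr q by rewrite ltr_rat.
  have p0' : 0 <= (ratr p : R) by rewrite ler0q.
  have q0' : 0 <= (ratr q : R) by rewrite (le_trans p0')// ltW.
  have PN : P (N (p, q)) = (\int[P]_x (\1_(N (p, q)) x : R)%:E)%E.
    by rewrite integral_indic// setIT.
  have h1 : ((ratr q)%:E * P (N (p, q)) <= \int[P]_x (g1 x * (\1_(N (p, q)) x)%:E))%E.
    rewrite PN -ge0_integralZl//; last first.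
      by apply/measurable_EFinP; exact: measurable_indic.
    apply: ge0_le_integral => //.
    - by move=> x _; rewrite mule_ge0 ?lee_fin.
    - by apply: measurable_funeM; apply/measurable_EFinP; exact: measurable_indic.
    - by apply: emeasurable_funM => //; apply/measurable_EFinP; exact: measurable_indic.
    - move=> x _; rewrite indicE; have [/set_mem[_ /= qg]|_] := boolP (x \in _).
        by rewrite !mule1.
      by rewrite !mule0.
  have h2 : (\int[P]_x (g2 x * (\1_(N (p, q)) x)%:E) <= (ratr p)%:E * P (N (p, q)))%E.
    rewrite PN -ge0_integralZl//; last first.
      by apply/measurable_EFinP; exact: measurable_indic.
    apply: ge0_le_integral => //.
    - by move=> x _; rewrite mule_ge0 ?lee_fin.
    - by apply: emeasurable_funM => //; apply/measurable_EFinP; exact: measurable_indic.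
    - by apply: measurable_funeM; apply/measurable_EFinP; exact: measurable_indic.
    - move=> x _; rewrite indicE; have [/set_mem[/= qg _]|_] := boolP (x \in _).
        by rewrite !mule1.
      by rewrite !mule0.
  have := le_trans h1 (le_trans (g12 _ (mN (p, q))) h2).
  have fP : P (N (p, q)) \is a fin_num.
    by rewrite fin_num_measure.
  have P0 : (0 <= P (N (p, q)))%E by exact: measure_ge0.
  rewrite -(fineK fP) -!EFinM lee_fin => h; congr EFin.
  have : 0 <= fine (P (N (p, q))) by exact: fine_ge0.
  by move=> f0; nra.
(* An enumeration of the pairs of rationals. *)
pose e (n : nat) : rat * rat := odflt (0, 0) (unpickle n).
pose D n := if (0 <= (e n).1) && ((e n).1 < (e n).2) then N (e n) else set0.
exists (\bigcup_n D n); split.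
- by apply: bigcup_measurable => n _; rewrite /D; case: ifP.
- apply/eqP; rewrite eq_le measure_ge0 andbT.
  apply: le_trans (measure_sigma_subadditive _ _ _ (@subset_refl _ _)) _.
  + by move=> n; rewrite /D; case: ifP.
  + by apply: bigcup_measurable => n _; rewrite /D; case: ifP.
  rewrite eseries0// => n _ _; rewrite /D; case: ifPn => [/andP[h1 h2]|_]; last exact: measure0.
  exact: N0.
- move=> x /= /negP; rewrite -ltNge => g21.
  have g2fin : g2 x \is a fin_num by rewrite ge0_fin_numE// (lt_le_trans g21)// leey.
  have [p [q [pq g2p qg1]]] : exists p q : rat, [/\ p < q, (g2 x <= (ratr p)%:E)%E & ((ratr q)%:E <= g1 x)%E].
    have [s g2s sg1] : exists2 s : R, fine (g2 x) < s & (s%:E <= g1 x)%E.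
      move: g21 (g10 x); case: (g1 x) => [r||]// g21 _.
        by exists r => //; rewrite -lte_fin fineK.
      by exists (fine (g2 x) + 1); rewrite ?leey// ltrDl.
    have [p] := rat_in_itvoo g2s; rewrite in_itv/= => /andP[g2p ps].
    have [q] := rat_in_itvoo ps; rewrite in_itv/= => /andP[pq qs].
    exists p, q; split; first by rewrite -(ltr_rat R).
      by rewrite -(fineK g2fin) lee_fin ltW.
    by apply: le_trans sg1; rewrite lee_fin ltW.
  have p0 : 0 <= p.
    by rewrite -(ler0q R) -lee_fin; apply: le_trans g2p.
  have epq : e (pickle (p, q)) = (p, q) by rewrite /e pickleK.
  by exists (pickle (p, q)); [exact: I|rewrite /D epq/= p0 pq].
Qed.

End ae_comparison.

Section posterior_integral.
Context {R : realType}.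
Variables (eps : R) (eps0 : 0 < eps) (Pi : {measure set (seqspace R) -> \bar R}).
Variable post : R.-pker (seqspace R) ~> (seqspace R).

Lemma ge0_measurable_integral_post f : ge0_measurable f ->
  ge0_measurable (fun x => \int[post x]_t f t)%E.
Proof.
case=> mf f0; split; last by move=> x; exact: integral_ge0.
by apply: measurable_fun_integral_kernel => // U; exact: measurable_kernel.
Qed.

(** Extends the defining identity from indicators of parameter events to
    nonnegative functions of the parameter. *)
Lemma is_posterior_integral A f : is_posterior eps Pi post -> measurable A ->
  ge0_measurable f ->
  (\int[Pi]_theta \int[model eps theta]_x (\int[post x]_t f t * (\1_A x)%:E) =
   \int[Pi]_theta (f theta * model eps theta A))%E.
Proof.
move=> hpost mA; move: f.
have gA f : ge0_measurable f -> ge0_measurable (fun x : seqspace R => \int[post x]_t f t * (\1_A x)%:E)%E.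
  move=> gf; apply: ge0_measurableM; [exact: ge0_measurable_integral_post| |by []].
  exact: measurable_indic.
have gM f : ge0_measurable f -> ge0_measurable
   (fun theta : seqspace R => \int[model eps theta]_x (\int[post x]_t f t * (\1_A x)%:E))%E.
  by move=> gf; apply: ge0_measurable_integral_model => //; exact: gA.
have gR (f : seqspace R -> \bar R) : ge0_measurable f -> ge0_measurable (fun theta : seqspace R => f theta * model eps theta A)%E.
  move=> [mf f0]; split; last by move=> t; rewrite mule_ge0.
  by apply: emeasurable_funM => //; exact: measurable_model.
apply: ge0_measurable_induction.
- move=> D mD; have := hpost A D mA mD.
  rewrite integral_mkcond => h; transitivity (\int[Pi]_(theta in D) model eps theta A)%E; last first.
    rewrite integral_mkcond; apply: eq_integral => t _; rewrite patchE indicE.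
    by case: ifP; rewrite ?mul1e ?mul0e.
  rewrite -h -integral_mkcond; apply: eq_integral => t _.
  rewrite [RHS]integral_mkcond; apply: eq_integral => x _.
  rewrite integral_indic// setIT patchE indicE.
  by case: ifP; rewrite ?mule1 ?mule0.
- move=> k f k0 gf IH.
  transitivity (\int[Pi]_theta (k%:E * \int[model eps theta]_x (\int[post x]_t f t * (\1_A x)%:E)))%E.
    apply: eq_integral => t _; rewrite -ge0_integralZl//; last 2 first.
    + exact: (gA _ gf).1.
    + by move=> x _; exact: (gA _ gf).2.
    apply: eq_integral => x _; rewrite ge0_integralZl ?muleA//; first exact: gf.1.
    by move=> y _; exact: gf.2.
  rewrite ge0_integralZl ?IH//; last 2 first.
  + exact: (gM _ gf).1.
  + by move=> t _; exact: (gM _ gf).2.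
  rewrite -ge0_integralZl//; last 2 first.
  + exact: (gR _ gf).1.
  + by move=> t _; exact: (gR _ gf).2.
  by apply: eq_integral => t _; rewrite muleA.
- move=> f g gf gg IHf IHg.
  transitivity (\int[Pi]_theta (\int[model eps theta]_x (\int[post x]_t f t * (\1_A x)%:E) +
      \int[model eps theta]_x (\int[post x]_t g t * (\1_A x)%:E)))%E.
    apply: eq_integral => t _; rewrite -ge0_integralD//; last 4 first.
    + by move=> x _; exact: (gA _ gf).2.
    + exact: (gA _ gf).1.
    + by move=> x _; exact: (gA _ gg).2.
    + exact: (gA _ gg).1.
    apply: eq_integral => x _; rewrite ge0_integralD//; last 4 first.
    + by move=> y _; exact: gf.2.
    + exact: gf.1.
    + by move=> y _; exact: gg.2.
    + exact: gg.1.
    rewrite ge0_muleDl//; [exact: (ge0_measurable_integral_post gf).2|].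
    exact: (ge0_measurable_integral_post gg).2.
  rewrite ge0_integralD// ?IHf ?IHg; last 4 first.
  + by move=> t _; exact: (gM _ gf).2.
  + exact: (gM _ gf).1.
  + by move=> t _; exact: (gM _ gg).2.
  + exact: (gM _ gg).1.
  rewrite -ge0_integralD//; last 4 first.
  + by move=> t _; exact: (gR _ gf).2.
  + exact: (gR _ gf).1.
  + by move=> t _; exact: (gR _ gg).2.
  + exact: (gR _ gg).1.
  by apply: eq_integral => t _; rewrite ge0_muleDl//; [exact: gf.2|exact: gg.2].
- move=> f gf ndf IH.
  have mono_post x : {homo (fun n => \int[post x]_t f n t)%E : m n / (m <= n)%N >-> (m <= n)%E}.
    move=> m n mn; apply: ge0_le_integral => //.
    + by move=> t _; exact: (gf m).2.
    + exact: (gf m).1.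
    + exact: (gf n).1.
    + by move=> t _; exact: ndf.
  have lim_mul (u : (\bar R)^nat) (r : R) : nondecreasing_seq u ->
      (limn u * r%:E = limn (fun n => u n * r%:E))%E.
    move=> ndu; apply/esym/cvg_lim => //.
    by apply: cvgeZr => //; exact: ereal_nondecreasing_is_cvgn.
  have post_lim x : (\int[post x]_t limn (f ^~ t) = limn (fun n => \int[post x]_t f n t))%E.
    apply: monotone_convergence => //.
    + by move=> n; exact: (gf n).1.
    + by move=> n t _; exact: (gf n).2.
  have mono_A x : {homo (fun n => \int[post x]_t f n t * (\1_A x)%:E)%E : m n / (m <= n)%N >-> (m <= n)%E}.
    by move=> m n mn; rewrite lee_wpmul2r ?lee_fin//; exact: mono_post.
  have mono_model t : {homo (fun n => \int[model eps t]_x (\int[post x]_t f n t * (\1_A x)%:E))%E :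
      m n / (m <= n)%N >-> (m <= n)%E}.
    move=> m n mn; apply: ge0_le_integral => //.
    + by move=> x _; exact: (gA _ (gf m)).2.
    + exact: (gA _ (gf m)).1.
    + exact: (gA _ (gf n)).1.
    + by move=> x _; exact: mono_A.
  transitivity (\int[Pi]_theta limn (fun n =>
      \int[model eps theta]_x (\int[post x]_t f n t * (\1_A x)%:E)))%E.
    apply: eq_integral => t _.
    transitivity (\int[model eps t]_x limn (fun n => \int[post x]_t f n t * (\1_A x)%:E))%E.
      by apply: eq_integral => x _; rewrite post_lim; apply: lim_mul; exact: mono_post.
    apply: monotone_convergence => //.
    + by move=> n; exact: (gA _ (gf n)).1.
    + by move=> n x _; exact: (gA _ (gf n)).2.
  transitivity (limn (fun n => \int[Pi]_theta \int[model eps theta]_x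
      (\int[post x]_t f n t * (\1_A x)%:E)))%E.
    apply: monotone_convergence => //.
    + by move=> n; exact: (gM _ (gf n)).1.
    + by move=> n x _; exact: (gM _ (gf n)).2.
  under eq_fun do rewrite IH.
  apply/esym; transitivity (\int[Pi]_theta limn (fun n => f n theta * model eps theta A))%E.
    apply: eq_integral => t _.
    have -> : model eps t A = (fine (model eps t A))%:E by rewrite fineK// fin_num_measure.
    by apply: lim_mul; exact: ndf.
  apply: monotone_convergence => //.
  + by move=> n; exact: (gR _ (gf n)).1.
  + by move=> n x _; exact: (gR _ (gf n)).2.
  + by move=> x _ m n mn; rewrite lee_wpmul2r//; exact: ndf.
Qed.

End posterior_integral.

(** * Mixtures over the components of the prior *)

Section exp_mixture_integral.
Context {R : realType}.

Lemma integral_exp_mixture (c : R) (mu : nat -> {measure set seqspace R -> \bar R}) F :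
  ge0_measurable F ->
  (\int[exp_mixture c mu]_x F x =
   \sum_(k <oo) (exp_weight c k.+1)%:E * \int[mu k.+1]_x F x)%E.
Proof.
move=> [mF F0]; pose m k := mscale (NngNum (exp_weight_ge0 c k.+1)) (mu k.+1).
transitivity (\int[mseries m 0]_x F x)%E.
  apply: eq_measure_integral => A mA _.
  pose f k := mscale (NngNum (exp_weight_ge0 c k)) (mu k) A.
  have f0 k : (0 <= f k)%E by exact: measure_ge0.
  change (\sum_(1 <= k <oo) f k = \sum_(0 <= k <oo) m k A)%E.
  by rewrite -nneseries_addn//; apply: eq_eseriesr => k _; rewrite addn1.
rewrite ge0_integral_measure_series//.
by apply: eq_eseriesr => k _; rewrite /m ge0_integral_mscale.
Qed.

End exp_mixture_integral.

Lemma nneseriesZl_ge0 {R : realType} (c : \bar R) (a : (\bar R)^nat) : (0 <= c)%E ->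
  (forall k, 0 <= a k)%E -> (\sum_(k <oo) c * a k = c * \sum_(k <oo) a k)%E.
Proof.
move=> c0 a0; rewrite -!ge0_integral_count//; last by move=> k; rewrite mule_ge0.
by rewrite ge0_integralZl.
Qed.

Section mix.
Context {R : realType}.
Variables eta gamma : R.

(** The double sum against the prior weights of [k] and [d]. Integrals against the
    prior, evidences and posterior averages all have this form, so the rest of the
    argument takes place inside [mix]. *)
Definition mix (F : nat -> nat -> \bar R) : \bar R :=
  (\sum_(k <oo) (exp_weight gamma k.+1)%:E *
    \sum_(d <oo) (exp_weight eta d.+1)%:E * F d.+1 k.+1)%E.

Let we0 d : (0 <= (exp_weight eta d)%:E)%E. Proof. by rewrite lee_fin exp_weight_ge0. Qed.
Let wg0 d : (0 <= (exp_weight gamma d)%:E)%E. Proof. by rewrite lee_fin exp_weight_ge0. Qed.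

Lemma mix_ge0 F : (forall d k, 0 <= F d k)%E -> (0 <= mix F)%E.
Proof.
move=> F0; apply: nneseries_ge0 => k _ _; rewrite mule_ge0//.
by apply: nneseries_ge0 => d _ _; rewrite mule_ge0.
Qed.

Lemma le_mix F G : (forall d k, 0 <= F d k)%E ->
  (forall d k, (0 < d)%N -> (0 < k)%N -> F d k <= G d k)%E ->
  (mix F <= mix G)%E.
Proof.
move=> F0 FG; apply: lee_nneseries => [k _ _|k _].
  by rewrite mule_ge0// nneseries_ge0// => d _ _; rewrite mule_ge0.
rewrite lee_wpmul2l//; apply: lee_nneseries => [d _ _|d _].
  by rewrite mule_ge0.
by rewrite lee_wpmul2l// FG.
Qed.

Lemma eq_mix F G : (forall d k, (0 < d)%N -> (0 < k)%N -> F d k = G d k) -> mix F = mix G.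
Proof.
move=> FG; apply: eq_eseriesr => k _; congr (_ * _)%E.
by apply: eq_eseriesr => d _; rewrite FG.
Qed.

Lemma mixZ (c : \bar R) F : (0 <= c)%E -> (forall d k, 0 <= F d k)%E ->
  mix (fun d k => c * F d k)%E = (c * mix F)%E.
Proof.
move=> c0 F0; rewrite /mix -nneseriesZl_ge0//; last first.
  by move=> k; rewrite mule_ge0// nneseries_ge0// => d _ _; rewrite mule_ge0.
apply: eq_eseriesr => k _; rewrite [RHS]muleCA; congr (_ * _)%E.
rewrite -nneseriesZl_ge0//; last by move=> d; rewrite mule_ge0.
by apply: eq_eseriesr => d _; rewrite muleCA.
Qed.

Lemma mixD F G : (forall d k, 0 <= F d k)%E -> (forall d k, 0 <= G d k)%E ->
  mix (fun d k => F d k + G d k)%E = (mix F + mix G)%E.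
Proof.
move=> F0 G0; rewrite /mix -nneseriesD.
- apply: eq_eseriesr => k _; rewrite -ge0_muleDr.
  + rewrite -nneseriesD; last 2 first.
      by move=> d _ _; rewrite mule_ge0.
      by move=> d _ _; rewrite mule_ge0.
    by congr (_ * _)%E; apply: eq_eseriesr => d _; rewrite ge0_muleDr.
  + by apply: nneseries_ge0 => d _ _; rewrite mule_ge0.
  + by apply: nneseries_ge0 => d _ _; rewrite mule_ge0.
- by move=> k _ _; rewrite mule_ge0// nneseries_ge0// => d _ _; rewrite mule_ge0.
- by move=> k _ _; rewrite mule_ge0// nneseries_ge0// => d _ _; rewrite mule_ge0.
Qed.

Section measurable.
Context d (T : measurableType d) (F : T -> nat -> nat -> \bar R).
Hypothesis gF : forall d k, ge0_measurable (fun t => F t d k).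

Let g1 k : ge0_measurable (fun t => \sum_(d <oo) (exp_weight eta d.+1)%:E * F t d.+1 k)%E.
Proof.
split; last first.
  by move=> t; apply: nneseries_ge0 => e _ _; rewrite mule_ge0//; exact: (gF _ _).2.
apply: ge0_emeasurable_sum => [e t _ _|e _].
  by rewrite mule_ge0//; exact: (gF _ _).2.
by apply: measurable_funeM; exact: (gF _ _).1.
Qed.

Lemma ge0_measurable_mix : ge0_measurable (fun t => mix (F t)).
Proof.
split; last by move=> t; apply: mix_ge0 => e k; exact: (gF e k).2.
apply: ge0_emeasurable_sum => [e t _ _|e _].
  by rewrite mule_ge0//; exact: (g1 _).2.
by apply: measurable_funeM; exact: (g1 _).1.
Qed.

Lemma integral_mix (P : {measure set T -> \bar R}) :
  (\int[P]_t mix (F t) = mix (fun d k => \int[P]_t F t d k))%E.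
Proof.
rewrite /mix integral_nneseries//; last 2 first.
- by move=> k; apply: measurable_funeM; exact: (g1 _).1.
- by move=> k t _; rewrite mule_ge0//; exact: (g1 _).2.
apply: eq_eseriesr => k _; rewrite ge0_integralZl//; last 2 first.
- exact: (g1 _).1.
- by move=> t _; exact: (g1 _).2.
congr (_ * _)%E; rewrite integral_nneseries//; last 2 first.
- by move=> e; apply: measurable_funeM; exact: (gF _ _).1.
- by move=> e t _; rewrite mule_ge0//; exact: (gF _ _).2.
apply: eq_eseriesr => e _; rewrite ge0_integralZl//; first exact: (gF _ _).1.
by move=> t _; exact: (gF _ _).2.
Qed.

End measurable.

Lemma integral_mixZ d (T : measurableType d) (P : {measure set T -> \bar R})
    (h : T -> \bar R) (F : T -> nat -> nat -> \bar R) :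
  ge0_measurable h -> (forall d k, ge0_measurable (fun t => F t d k)) ->
  (\int[P]_t (h t * mix (F t)) = mix (fun d k => \int[P]_t (h t * F t d k)))%E.
Proof.
move=> gh gF.
have ghF e k : ge0_measurable (fun t => h t * F t e k)%E by exact: ge0_measurable_mul.
apply: etrans (integral_mix ghF P); apply: eq_integral => t _.
apply/esym/mixZ; first exact: gh.2.
by move=> e k; exact: (gF e k).2.
Qed.

Lemma integral_prior (eps : R) F : ge0_measurable F ->
  (\int[prior eps eta gamma]_x F x = mix (fun d k => \int[sieve_prior eps d k%:R]_x F x))%E.
Proof.
move=> gF; rewrite /prior integral_exp_mixture//; apply: eq_eseriesr => k _.
by rewrite /sieve_mixture integral_exp_mixture.
Qed.

End mix.

Lemma prode_ord_if {R : realType} (F : nat -> R) d n : (d <= n)%N ->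
  (\prod_(i < n) (if (i < d)%N then F i else 1)%:E = (\prod_(i < d) F i)%:E)%E.
Proof.
move=> dn; rewrite (prode_ord_split (fun i => (if (i < d)%N then F i else 1)%:E) dn).
rewrite (_ : \prod_(d <= i < n) _ = 1)%E; last first.
  by rewrite big_nat big1// => i /andP[di _]; rewrite ltnNge di.
by rewrite mule1 -prodEFin; apply: eq_bigr => i _; rewrite ltn_ord.
Qed.

Section component.
Context {R : realType}.
Variable eps : R.
Hypothesis eps0 : 0 < eps.
Let v := eps ^+ 2.
Let v0 : 0 < v. Proof. by rewrite /v exprn_gt0. Qed.

(** Tonelli's theorem after the change of measure to [base eps], which is
    legitimate because almost every parameter under the component has finitely many
    nonzero coordinates. *)
Lemma component_swap n mu (f G : seqspace R -> \bar R) :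
  (forall i, (n <= i)%N -> mu i = gauss 0 0) -> ge0_measurable f -> ge0_measurable G ->
  (\int[product_prob mu]_t (f t * \int[model eps t]_x G x) =
   \int[base eps]_x (G x * \int[product_prob mu]_t (f t * (Lik eps n t x)%:E)))%E.
Proof.
move=> mu0 gf gG; have [mf f0] := gf; have [mG G0] := gG.
have trunc0 (t : seqspace R) i : (n <= i)%N -> trunc n t i = 0.
  by rewrite leqNgt /trunc => /negbTE ->.
have gL d (T : measurableType d) (a b : T -> seqspace R) : measurable_fun setT a ->
    measurable_fun setT b -> ge0_measurable (fun t => (Lik eps n (a t) (b t))%:E).
  move=> ma mb; split; last by move=> t; rewrite lee_fin Lik_ge0.
  by apply/measurable_EFinP; exact: measurable_Lik.
rewrite (integral_product_prob_trunc mu0); last first.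
  have gm := ge0_measurable_integral_model eps0 gG.
  split; first by apply: emeasurable_funM => //; exact: gm.1.
  by move=> t; rewrite mule_ge0//; exact: gm.2.
pose H (p : seqspace R * seqspace R) :=
  (f (trunc n p.1) * (G p.2 * (Lik eps n (trunc n p.1) p.2)%:E))%E.
have mt1 : measurable_fun setT (fun p : seqspace R * seqspace R => trunc n p.1).
  by apply: measurableT_comp; [exact: measurable_trunc|exact: measurable_fst].
have mH : measurable_fun setT H.
  apply: emeasurable_funM; first exact: measurableT_comp.
  apply: emeasurable_funM; first by apply: measurableT_comp => //; exact: measurable_snd.
  exact: (gL _ _ _ _ mt1 measurable_snd).1.
have H0 p : (0 <= H p)%E by rewrite !mule_ge0// lee_fin Lik_ge0.
transitivity (\int[product_prob mu]_t \int[base eps]_x H (t, x))%E.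
  apply: eq_integral => t _.
  rewrite [X in (_ * X = _)%E](integral_model eps0 (trunc0 t) gG).
  rewrite /H/=; apply: esym; apply: ge0_integralZl; [exact: measurableT| | |exact: f0].
  - apply: emeasurable_funM; first exact: mG.
    by apply/measurable_EFinP; exact: (@measurable_Lik _ _ n _ (seqspace R) (cst (trunc n t)) id).
  - by move=> x _; rewrite mule_ge0// lee_fin Lik_ge0.
rewrite (@fubini_tonelli _ _ _ _ R (product_prob mu) (base eps) H)//.
apply: eq_integral => x _.
have gfL : ge0_measurable (fun t : seqspace R => f t * (Lik eps n t x)%:E)%E.
  have g : ge0_measurable (fun t : seqspace R => (Lik eps n t x)%:E).
    exact: (gL _ (seqspace R) id (cst x)).
  split; first by apply: emeasurable_funM => //; exact: g.1.
  by move=> t; rewrite mule_ge0//; exact: g.2.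
rewrite [X in (_ * X)%E](integral_product_prob_trunc mu0)// -ge0_integralZl//.
- by apply: eq_integral => t _; rewrite /H muleCA.
- by apply: (measurableT_comp gfL.1); exact: measurable_trunc.
- by move=> t _; exact: gfL.2.
Qed.

Variables (d : nat) (lam : nat -> R).
Hypothesis lam0 : forall i, 0 <= lam i.
Hypothesis lam_tail : forall i, (d <= i)%N -> lam i = 0.
Let S := product_prob (fun i => gauss 0 (v * lam i)).
Let s i := (1 + lam i)^-1.

(** The evidence of a component relative to pure noise; the factors from [d] on are
    one. *)
Definition marginal (s : nat -> R) (x : seqspace R) : R :=
  \prod_(i < d) mlik v (s i) (x i).

(** Conjugacy in every coordinate at once, tested against products of functions of
    single coordinates. *)
Lemma component_posterior n (g : nat -> R -> \bar R) (x : seqspace R) : (d <= n)%N ->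
  (forall i, ge0_measurable (g i)) ->
  (\int[S]_t (\prod_(i < n) g i (t i) * (Lik eps d t x)%:E) =
   (marginal s x)%:E * \prod_(i < n) \int[gauss ((1 - s i) * x i) (v * (1 - s i))]_t g i t)%E.
Proof.
move=> dn gg.
pose h i (t : R) := (g i t * (if (i < d)%N then lik v t (x i) else 1)%:E)%E.
have gh i : ge0_measurable (h i).
  apply: ge0_measurableM => // [|t].
    case: (i < d)%N; last exact: measurable_cst.
    by apply: measurable_lik2 => //; exact: measurable_cst.
  by case: ifP => // _; exact: lik_ge0.
transitivity (\int[S]_t \prod_(i < n) h i (t i))%E.
  apply: eq_integral => t _; rewrite big_split/=; congr (_ * _)%E.
  by rewrite (prode_ord_if (fun i => lik v (t i) (x i)) dn).
rewrite integral_product_prob//.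
transitivity (\prod_(i < n) ((if (i < d)%N then mlik v (s i) (x i) else 1)%:E *
    \int[gauss ((1 - s i) * x i) (v * (1 - s i))]_t g i t))%E.
  apply: eq_bigr => i _; rewrite /h; have [id|di] := ltnP i d.
    exact: gauss_posterior.
  rewrite /s lam_tail// addr0 invr1 subrr mulr0 mul0r mul1e.
  by apply: eq_integral => t _; rewrite mule1.
rewrite big_split/=; congr (_ * _)%E.
exact: (prode_ord_if (fun i => mlik v (s i) (x i)) dn).
Qed.

Lemma component_mass (x : seqspace R) :
  (\int[S]_t (Lik eps d t x)%:E = (marginal s x)%:E)%E.
Proof.
have g1 : ge0_measurable (cst 1%E : R -> \bar R) by split.
have := component_posterior x (leqnn d) (fun=> g1).
rewrite [X in _ = (_ * X)%E]big1 ?mule1; last first.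
  by move=> i _; exact: integral_prob_cst.
by move=> <-; apply: eq_integral => t _; rewrite big1 ?mul1e.
Qed.

Lemma component_second_moment (x : seqspace R) i (theta : R) :
  (\int[S]_t (((t i - theta) ^+ 2)%:E * (Lik eps d t x)%:E) <=
   (marginal s x * (2 * ((1 - s i) * x i - theta) ^+ 2 + 12 * (v * (1 - s i))))%:E)%E.
Proof.
pose n := maxn d i.+1.
pose g j (t : R) : \bar R := if j == i then ((t - theta) ^+ 2)%:E else 1%E.
have gg j : ge0_measurable (g j).
  rewrite /g; case: (j == i); last by split.
  split => [|t]; last by rewrite lee_fin sqr_ge0.
  by apply/measurable_EFinP; apply: measurable_funX; exact: measurable_funB.
have ilt : (i < n)%N by rewrite leq_max leqnn orbT.
have := component_posterior x (leq_maxl d i.+1) gg.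
rewrite -/n (bigD1 (Ordinal ilt))//= [X in (_ * (_ * X))%E]big1; last first.
  move=> j; rewrite -val_eqE => /negbTE ji.
  rewrite (_ : g j = cst 1%E); first exact: integral_prob_cst.
  by apply/funext => t; rewrite /g ji.
rewrite mule1 /g eqxx => h.
rewrite (_ : (\int[S]_t _)%E = (marginal s x)%:E *
    \int[gauss ((1 - s i) * x i) (v * (1 - s i))]_t ((t - theta) ^+ 2)%:E)%E; last first.
  rewrite -h; apply: eq_integral => t _; congr (_ * _)%E.
  rewrite (bigD1 (Ordinal ilt))//= eqxx big1 ?mule1// => j.
  by rewrite -val_eqE => /negbTE ->.
rewrite EFinM lee_wpmul2l//.
  by rewrite lee_fin prodr_ge0// => j _; rewrite mulr_ge0 ?sqrtr_ge0 ?expR_ge0.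
apply: gauss_second_moment; rewrite mulr_ge0 ?(ltW v0)// subr_ge0 invf_le1 ?lerDl ?lam0//.
by rewrite ltr_wpDr ?lam0.
Qed.

End component.

(** * Bayes formula for the hierarchical prior *)

Section exp_weight_facts.
Context {R : realType}.
Variable c : R.
Hypothesis c0 : 0 < c.

Lemma exp_series_fin : (\sum_(j <oo) (expR (- (c * j.+1%:R)))%:E < +oo)%E.
Proof.
pose z := expR (- c); have z0 : 0 < z by exact: expR_gt0.
have z1 : z < 1 by rewrite /z expR_lt1 oppr_lt0.
apply: (@le_lt_trans _ _ (z / (1 - z))%:E); last exact: ltry.
apply: lime_le; first by apply: is_cvg_nneseries => j _ _; rewrite lee_fin expR_ge0.
apply: nearW => n; rewrite sumEFin lee_fin.
have -> : \sum_(0 <= j < n) expR (- (c * j.+1%:R)) = series (geometric z z) n.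
  apply: eq_bigr => j _; rewrite /geometric/= -exprS /z -expRM_natl.
  by congr expR; rewrite mulrN mulrC.
rewrite geometric_seriesE ?lt_eqF// ler_pM2r ?invr_gt0 ?subr_gt0//.
by rewrite ler_piMr ?(ltW z0)// lerBlDr lerDl exprn_ge0 ?ltW.
Qed.

Definition exp_mass : R := fine (\sum_(1 <= j <oo) (expR (- (c * j%:R)))%:E)%E.

Lemma exp_massE : (\sum_(1 <= j <oo) (expR (- (c * j%:R)))%:E)%E =
  (\sum_(j <oo) (expR (- (c * j.+1%:R)))%:E)%E.
Proof.
rewrite -(@nneseries_addn _ (fun j => (expR (- (c * j%:R)))%:E))//.
by apply: eq_eseriesr => j _; rewrite addn1.
Qed.

Lemma exp_mass_gt0 : 0 < exp_mass.
Proof.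
rewrite /exp_mass exp_massE fine_gt0// exp_series_fin andbT.
apply: (@lt_le_trans _ _ (expR (- (c * 1)))%:E); first by rewrite lte_fin expR_gt0.
by apply: (@nneseries_term_le _ (fun j => (expR (- (c * j.+1%:R)))%:E) 0 0) => // i; rewrite lee_fin expR_ge0.
Qed.

Lemma exp_weight_gt0 k : 0 < exp_weight c k.
Proof. by rewrite divr_gt0 ?expR_gt0// exp_mass_gt0. Qed.

Lemma exp_weight_sum_fin : (\sum_(j <oo) (exp_weight c j.+1)%:E < +oo)%E.
Proof.
rewrite (_ : (\sum_(_ <= _ <oo) _)%E = (exp_mass^-1)%:E * \sum_(j <oo) (expR (- (c * j.+1%:R)))%:E)%E.
  rewrite lte_mul_pinfty// ?exp_series_fin ?lee_fin ?invr_ge0 ?(ltW exp_mass_gt0)//.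
rewrite -nneseriesZl; last by move=> j _; rewrite lee_fin expR_ge0.
by apply: eq_eseriesr => j _; rewrite -EFinM mulrC.
Qed.

End exp_weight_facts.

Section prior_posterior.
Context {R : realType}.
Variables (eps eta gamma : R).
Hypotheses (eps0 : 0 < eps) (eta0 : 0 < eta) (gamma0 : 0 < gamma).
Let v := eps ^+ 2.
Let v0 : 0 < v. Proof. by rewrite /v exprn_gt0. Qed.

(** The prior variance of the [i]th coordinate in units of the noise variance. *)
Definition snr d k i : R :=
  if (i < d)%N then d%:R `^ (2 * k%:R + 1) * i.+1%:R `^ (- (2 * k%:R + 1)) else 0.

Lemma snr_ge0 d k i : 0 <= snr d k i.
Proof. by rewrite /snr; case: ifP => // _; rewrite mulr_ge0 ?powR_ge0. Qed.

Lemma snr_tail d k i : (d <= i)%N -> snr d k i = 0.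
Proof. by rewrite leqNgt /snr => /negbTE ->. Qed.

(** The fraction by which the posterior mean of a component shrinks the [i]th
    observation. *)
Definition shrink d k i : R := (1 + snr d k i)^-1.

Definition marg d k (x : seqspace R) : R := marginal eps d (shrink d k) x.

Lemma sieve_priorE d k :
  sieve_prior eps d k%:R = product_prob (fun i => gauss 0 (v * snr d k i)).
Proof.
rewrite /sieve_prior.
have e i : v * snr d k i = if (i < d)%N
    then eps ^+ 2 * d%:R `^ (2 * k%:R + 1) * i.+1%:R `^ (- (2 * k%:R + 1)) else 0.
  by rewrite /snr; case: ifP => _; rewrite ?mulr0// mulrA.
exact: (congr1 (fun F : nat -> R => product_prob (fun i => gauss 0 (F i))) (esym (funext e))).
Qed.

Lemma sieve_mass d k x :
  (\int[sieve_prior eps d k%:R]_t (Lik eps d t x)%:E = (marg d k x)%:E)%E.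
Proof.
rewrite sieve_priorE.
exact: (component_mass eps0 (snr_ge0 d k) (@snr_tail d k) x).
Qed.

Lemma sieve_swap d k (f G : seqspace R -> \bar R) : ge0_measurable f -> ge0_measurable G ->
  (\int[sieve_prior eps d k%:R]_t (f t * \int[model eps t]_x G x) =
   \int[base eps]_x (G x * \int[sieve_prior eps d k%:R]_t (f t * (Lik eps d t x)%:E)))%E.
Proof.
move=> gf gG; rewrite sieve_priorE.
have gauss_tail i : (d <= i)%N -> gauss 0 (v * snr d k i) = gauss 0 0 :> probability _ R.
  by move=> di; rewrite (snr_tail k di) mulr0.
exact: (component_swap eps0 gauss_tail gf gG).
Qed.

Lemma ge0_measurable_sieve d k (f : seqspace R -> \bar R) : ge0_measurable f ->
  ge0_measurable (fun x : seqspace R => \int[sieve_prior eps d k%:R]_t (f t * (Lik eps d t x)%:E))%E.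
Proof.
move=> [mf f0]; split; last first.
  by move=> x; apply: integral_ge0 => t _; rewrite mule_ge0// lee_fin Lik_ge0.
apply: (@measurable_fun_fubini_tonelli_F _ _ _ _ R (sieve_prior eps d k%:R)
  (fun p : seqspace R * seqspace R => f p.2 * (Lik eps d p.2 p.1)%:E)%E) => [|p].
  apply: emeasurable_funM; first by apply: measurableT_comp => //; exact: measurable_snd.
  by apply/measurable_EFinP; apply: measurable_Lik; [exact: measurable_snd|exact: measurable_fst].
by rewrite mule_ge0// lee_fin Lik_ge0.
Qed.

Lemma ge0_measurable_marg d k : ge0_measurable (fun x => (marg d k x)%:E).
Proof.
have g1 : ge0_measurable (cst 1%E : seqspace R -> \bar R) by split.
have := ge0_measurable_sieve d k g1.
rewrite (_ : (fun _ => _) = fun x => (marg d k x)%:E)//.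
by apply/funext => x; rewrite -sieve_mass; apply: eq_integral => t _; rewrite mul1e.
Qed.

(** Bayes' formula, as an inequality between unnormalized averages. Integrated
    over a data event, both sides become integrals against the prior, after
    exchanging the data and the parameter in each component, and there they agree by
    the definition of a posterior. *)
Lemma posterior_ae (post : R.-pker (seqspace R) ~> (seqspace R)) f :
  is_posterior eps (prior eps eta gamma) post -> ge0_measurable f ->
  {ae base eps, forall x, (\int[post x]_t f t * mix eta gamma (fun d k => (marg d k x)%:E) <=
    mix eta gamma (fun d k => \int[sieve_prior eps d k%:R]_t (f t * (Lik eps d t x)%:E)))%E}.
Proof.
move=> hpost gf.
have gp := ge0_measurable_integral_post post gf.
have gmm : ge0_measurable (fun x => mix eta gamma (fun d k => (marg d k x)%:E)).
  by apply: ge0_measurable_mix => d k; exact: ge0_measurable_marg.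
apply: ae_le_of_integral_le.
- exact: ge0_measurable_mul gp gmm.
- by apply: ge0_measurable_mix => d k; exact: ge0_measurable_sieve.
move=> A mA.
have gA : ge0_measurable (fun x : seqspace R => (\1_A x)%:E : \bar R).
  by split => [|x]; [apply/measurable_EFinP; exact: measurable_indic|rewrite lee_fin].
have gpA : ge0_measurable (fun x => \int[post x]_t f t * (\1_A x)%:E)%E.
  exact: ge0_measurable_mul gp gA.
have g1 : ge0_measurable (cst 1%E : seqspace R -> \bar R) by split.
have modelA t : (model eps t A = \int[model eps t]_x (\1_A x)%:E)%E.
  by rewrite integral_indic// setIT.
have lhs : (\int[base eps]_x (\int[post x]_t f t * mix eta gamma (fun d k => (marg d k x)%:E) *
    (\1_A x)%:E) = mix eta gamma (fun d k =>
    \int[base eps]_x (\int[post x]_t f t * (\1_A x)%:E * (marg d k x)%:E)))%E.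
  apply: etrans (integral_mixZ eta gamma _ gpA ge0_measurable_marg).
  by apply: eq_integral => x _; rewrite muleAC.
have rhs : (\int[base eps]_x (mix eta gamma (fun d k =>
      \int[sieve_prior eps d k%:R]_t (f t * (Lik eps d t x)%:E)) * (\1_A x)%:E) =
    mix eta gamma (fun d k => \int[base eps]_x ((\1_A x)%:E *
      \int[sieve_prior eps d k%:R]_t (f t * (Lik eps d t x)%:E))))%E.
  apply: etrans (integral_mixZ eta gamma _ gA (fun d k => ge0_measurable_sieve d k gf)).
  by apply: eq_integral => x _; rewrite muleC.
rewrite [X in (X <= _)%E]lhs [X in (_ <= X)%E]rhs.
have e1 : mix eta gamma (fun d k =>
    \int[base eps]_x (\int[post x]_t f t * (\1_A x)%:E * (marg d k x)%:E))%E =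
  (\int[prior eps eta gamma]_t \int[model eps t]_x (\int[post x]_t f t * (\1_A x)%:E))%E.
  rewrite integral_prior; last exact: ge0_measurable_integral_model.
  apply: eq_mix => d k _ _; have := sieve_swap d k g1 gpA => sw.
  transitivity (\int[sieve_prior eps d k%:R]_t (cst 1 t *
      \int[model eps t]_x (\int[post x]_t f t * (\1_A x)%:E)))%E; last first.
    by apply: eq_integral => t _; exact: mul1e.
  apply: etrans (esym sw); apply: eq_integral => x _; rewrite -sieve_mass.
  by congr (_ * _)%E; apply: eq_integral => t _; rewrite mul1e.
have e2 : mix eta gamma (fun d k => \int[base eps]_x ((\1_A x)%:E *
      \int[sieve_prior eps d k%:R]_t (f t * (Lik eps d t x)%:E)))%E =
  (\int[prior eps eta gamma]_t (f t * model eps t A))%E.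
  rewrite integral_prior; last first.
    apply: ge0_measurable_mul => //.
    by split => [|t]; [exact: measurable_model|exact: measure_ge0].
  apply: eq_mix => d k _ _; apply: etrans (esym (sieve_swap d k gf gA)) _.
  by apply: eq_integral => t _; rewrite modelA.
by rewrite [X in (X <= _)%E]e1 [X in (_ <= X)%E]e2 (is_posterior_integral eps0 hpost mA gf).
Qed.

(** The total evidence is a density of the marginal law of the data, a probability
    measure, with respect to [base eps]. *)
Lemma marg_fin_ae :
  {ae base eps, forall x, mix eta gamma (fun d k => (marg d k x)%:E) \is a fin_num}.
Proof.
have g d k := ge0_measurable_marg d k.
have gm : ge0_measurable (fun x => mix eta gamma (fun d k => (marg d k x)%:E)).
  exact: ge0_measurable_mix.
suff : (base eps).-integrable setT (fun x => mix eta gamma (fun d k => (marg d k x)%:E)).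
  move=> /(integrable_ae measurableT) [N [mN N0 h]]; exists N; split => //.
  by move=> x /= nx; apply: h => /= /(_ I).
apply/integrableP; split; first exact: gm.1.
under eq_integral do rewrite gee0_abs ?gm.2//.
rewrite integral_mix//.
have g1 : ge0_measurable (cst 1%E : seqspace R -> \bar R) by split.
rewrite (@eq_mix _ _ _ _ (fun _ _ => 1%E)); last first.
  move=> d k _ _; transitivity (\int[sieve_prior eps d k%:R]_t (cst 1 t * \int[model eps t]_x cst 1 x))%E.
    apply/esym; apply: etrans (sieve_swap d k g1 g1) _; apply: eq_integral => x _.
    apply: etrans (mul1e _) _; rewrite -sieve_mass.
    by apply: eq_integral => t _; exact: mul1e.
  transitivity (\int[sieve_prior eps d k%:R]_t cst 1 t)%E; last exact: integral_prob_cst.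
  by apply: eq_integral => t _; apply: etrans (mul1e _) _; exact: integral_prob_cst.
rewrite /mix; set sd := (\sum_(d <oo) (exp_weight eta d.+1)%:E * 1)%E.
have sd1 : sd = (\sum_(d <oo) (exp_weight eta d.+1)%:E)%E.
  by apply: eq_eseriesr => d _; rewrite /= mule1.
have sd0 : (0 <= sd)%E.
  by rewrite sd1; apply: nneseries_ge0 => d _ _; rewrite lee_fin exp_weight_ge0.
have sdE : sd = (fine sd)%:E.
  by rewrite fineK// ge0_fin_numE// sd1 exp_weight_sum_fin.
under eq_eseriesr do rewrite sdE muleC.
rewrite nneseriesZl; last by move=> k _; rewrite lee_fin exp_weight_ge0.
by rewrite lte_mul_pinfty ?exp_weight_sum_fin// -sdE.
Qed.

End prior_posterior.

(** * Jensen's inequality for the posterior mean *)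

(** Jensen's inequality for the square. If the right-hand side is infinite there is
    nothing to prove, otherwise [g] is integrable and the tangent of the square at
    the mean [m], with slope [2 (m - a)], is integrated. *)
Lemma sqr_mean_le {R : realType} d (T : measurableType d) (P : {measure set T -> \bar R}) (g : T -> R) (a : R) :
  P setT = 1%E -> measurable_fun setT g ->
  (((Rintegral P setT g - a) ^+ 2)%:E <= \int[P]_x ((g x - a) ^+ 2)%:E)%E.
Proof.
move=> P1 mg.
have mga : measurable_fun setT (fun x => (g x - a) ^+ 2).
  by apply: measurable_funX; exact: measurable_funB.
have I0 : (0 <= \int[P]_x ((g x - a) ^+ 2)%:E)%E.
  by apply: integral_ge0 => x _; rewrite lee_fin sqr_ge0.
have [Ioo|Ifin] := eqVneq (\int[P]_x ((g x - a) ^+ 2)%:E)%E +oo%E.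
  by rewrite Ioo leey.
have isq : P.-integrable setT (fun x => ((g x - a) ^+ 2)%:E).
  apply/integrableP; split; first exact/measurable_EFinP.
  under eq_integral do rewrite gee0_abs ?lee_fin ?sqr_ge0//.
  by rewrite ltey.
have icst c : P.-integrable setT (fun=> c%:E).
  apply/integrableP; split; first exact: measurable_cst.
  by rewrite integral_cst// P1 mule1 ltry.
have ig : P.-integrable setT (EFin \o g).
  apply: (@le_integrable _ _ _ P setT measurableT _ (fun x => ((`|a| + 1)%:E + ((g x - a) ^+ 2)%:E)%E)).
  - exact/measurable_EFinP.
  - move=> x _; rewrite /= lee_fin [leRHS]ger0_norm ?addr_ge0 ?sqr_ge0//.
    apply: (@le_trans _ _ (`|a| + `|g x - a|)); first by rewrite -{1}(subrK a (g x)) addrC ler_normD.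
    rewrite -addrA lerD2l -real_normK ?num_real//.
    by have := sqr_ge0 (`|g x - a| - 1); have := normr_ge0 (g x - a); set y := `|_|; nra.
  - by apply: integrableD => //; exact: icst.
set m := Rintegral P setT g.
have mE : (\int[P]_x (g x)%:E = m%:E)%E.
  by rewrite /m /Rintegral fineK//; exact: integrable_fin_num.
have iZ : P.-integrable setT (fun x => (2 * (m - a))%:E * (g x)%:E)%E.
  exact: (integrableZl measurableT (2 * (m - a)) ig).
apply: (@le_trans _ _ (\int[P]_x ((2 * (m - a))%:E * (g x)%:E + (- (2 * (m - a) * a + (m - a) ^+ 2))%:E)))%E.
  rewrite integralD//.
  rewrite integralZl// mE integral_cst// P1 mule1 -EFinM -EFinD lee_fin.
  by rewrite le_eqVlt; apply/orP; left; apply/eqP; ring.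
apply: le_integral => //.
  exact: integrableD.
move=> x _; rewrite -EFinM -EFinD lee_fin.
by have := sqr_ge0 (g x - m); rewrite !expr2; nra.
Qed.

Section posterior_mean_risk.
Context {R : realType}.
Implicit Types theta x : seqspace R.

Lemma ge0_measurable_sqnorm theta :
  ge0_measurable (fun t : seqspace R => sqnorm (fun i => t i - theta i)).
Proof.
split; last by move=> t; apply: nneseries_ge0 => i _ _; rewrite lee_fin sqr_ge0.
apply: ge0_emeasurable_sum => [i t _ _|i _]; first by rewrite lee_fin sqr_ge0.
apply/measurable_EFinP; apply: measurable_funX; apply: measurable_funB => //.
exact: measurable_coord.
Qed.

Lemma ge0_measurable_sqr_coord i (a : R) :
  ge0_measurable (fun t : seqspace R => ((t i - a) ^+ 2)%:E).
Proof.
split => [|t]; last by rewrite lee_fin sqr_ge0.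
apply/measurable_EFinP; apply: measurable_funX; apply: measurable_funB => //.
exact: measurable_coord.
Qed.

Lemma posterior_mean_le (post : R.-pker (seqspace R) ~> (seqspace R)) theta x :
  (sqnorm (fun i => posterior_mean post x i - theta i)%R <=
   \int[post x]_t sqnorm (fun i => t i - theta i)%R)%E.
Proof.
rewrite [leRHS](_ : _ = \sum_(i <oo) \int[post x]_t ((t i - theta i) ^+ 2)%:E)%E.
  apply: lee_nneseries => [i _ _|i _]; first by rewrite lee_fin sqr_ge0.
  exact: (sqr_mean_le _ (prob_kernel x) (measurable_coord i)).
rewrite integral_nneseries// => [i|i t _].
  exact: (ge0_measurable_sqr_coord i (theta i)).1.
exact: (ge0_measurable_sqr_coord i (theta i)).2.
Qed.

Lemma measurable_posterior_mean (post : R.-pker (seqspace R) ~> (seqspace R)) :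
  measurable_fun setT (posterior_mean post).
Proof.
apply: measurable_seqspace => i; rewrite /posterior_mean /Rintegral.
apply: (measurableT_comp (@fine_measurable R setT measurableT)).
rewrite (_ : (fun _ => _) = fun x => (\int[post x]_t ((fun t : seqspace R => (t i)%:E)^\+ t) -
  \int[post x]_t ((fun t : seqspace R => (t i)%:E)^\- t))%E); last first.
  by apply/funext => x; rewrite integralE.
have mi : measurable_fun setT (fun t : seqspace R => (t i)%:E).
  by apply/measurable_EFinP; exact: measurable_coord.
apply: emeasurable_funB.
  by apply: (ge0_measurable_integral_post post _).1; split => //; exact: measurable_funepos.
by apply: (ge0_measurable_integral_post post _).1; split => //; exact: measurable_funeneg.
Qed.

End posterior_mean_risk.

(** * Shrinkage factors *)

Lemma sumr_ord_split {R : realType} (F : nat -> R) n m : (n <= m)%N ->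
  \sum_(i < m) F i = \sum_(i < n) F i + \sum_(n <= i < m) F i.
Proof. by move=> nm; rewrite -!(big_mkord xpredT F) (@big_cat_nat _ _ _ n). Qed.

Lemma prodr_ord_split {R : realType} (F : nat -> R) n m : (n <= m)%N ->
  \prod_(i < m) F i = \prod_(i < n) F i * \prod_(n <= i < m) F i.
Proof. by move=> nm; rewrite -!(big_mkord xpredT F) (@big_cat_nat _ _ _ n). Qed.

Lemma sqrt_expR {R : realType} (x : R) : Num.sqrt (expR x) = expR (x / 2).
Proof.
rewrite -[LHS]ger0_norm ?sqrtr_ge0// -[RHS]ger0_norm ?expR_ge0//.
apply/eqP; rewrite -(eqrXn2 (ltn0Sn 1)) ?normr_ge0// !real_normK ?num_real//.
by rewrite sqr_sqrtr ?expR_ge0// -expRM_natl; apply/eqP; congr expR; field.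
Qed.

Lemma sqrt_prod {R : realType} n (F : nat -> R) : (forall i, 0 <= F i) ->
  Num.sqrt (\prod_(i < n) F i) = \prod_(i < n) Num.sqrt (F i).
Proof.
move=> F0; elim: n => [|n IH]; first by rewrite !big_ord0 sqrtr1.
by rewrite !big_ord_recr/= sqrtrM ?IH// prodr_ge0.
Qed.

Section shrinkage.
Context {R : realType}.

Lemma shrink_gt0 d k i : 0 < shrink d k i :> R.
Proof. by rewrite invr_gt0 ltr_wpDr ?snr_ge0. Qed.

Lemma shrink_le1 d k i : shrink d k i <= 1 :> R.
Proof. by rewrite invf_le1 ?lerDl ?snr_ge0// ltr_wpDr ?snr_ge0. Qed.

Lemma shrink_tail d k i : (d <= i)%N -> shrink d k i = 1 :> R.
Proof. by move=> di; rewrite /shrink snr_tail// addr0 invr1. Qed.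

Lemma snrE d k i : (i < d)%N -> snr d k i = (d%:R / i.+1%:R) ^+ (2 * k + 1) :> R.
Proof.
move=> id; rewrite /snr id powRN -[2 * k%:R + 1](_ : (2 * k + 1)%:R = _); last first.
  by rewrite natrD natrM.
by rewrite !powR_mulrn// expr_div_n.
Qed.

Lemma snr_ge1 d k i : (i < d)%N -> 1 <= snr d k i :> R.
Proof.
move=> id; rewrite snrE// exprn_ege1//.
by rewrite ler_pdivlMr ?ltr0n// mul1r ler_nat.
Qed.

Lemma shrink_le_half d k i : (i < d)%N -> shrink d k i <= 2^-1 :> R.
Proof.
move=> id; rewrite /shrink lef_pV2 ?posrE//; last by rewrite ltr_wpDr ?snr_ge0.
by have := snr_ge1 k id; lra.
Qed.

Lemma shrink_le_power d k i : (i < d)%N ->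
  shrink d k i <= (i.+1%:R / d%:R) ^+ (2 * k + 1) :> R.
Proof.
move=> id; have d0 : (0 : R) < d%:R by rewrite ltr0n (leq_ltn_trans _ id).
have q0 : (0 : R) < d%:R / i.+1%:R by rewrite divr_gt0// ltr0n.
rewrite -[i.+1%:R / _]invf_div exprVn -snrE// /shrink lef_pV2 ?posrE.
- by rewrite lerDr.
- by rewrite ltr_wpDr ?snr_ge0.
- by rewrite snrE// exprn_gt0.
Qed.

(** Stirling's lower bound in the form [n ^ n <= e ^ n n!]. It is what keeps the
    evidence of the comparison component at least exponential in its dimension. *)
Lemma prod_ratio_le n : (\prod_(i < n) (n%:R / i.+1%:R) : R) <= expR n%:R.
Proof.
suff : (n%:R ^+ n : R) <= expR n%:R * \prod_(i < n) i.+1%:R.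
  move=> h; rewrite prodf_div prodr_const card_ord ler_pdivrMr//.
  by apply: prodr_gt0 => i _; rewrite ltr0n.
elim: n => [|n IH]; first by rewrite big_ord0 expr0 mulr1 expR0.
rewrite big_ord_recr/= mulrA exprSr ler_pM2r ?ltr0n//.
have [->|n0] := posnP n; first by rewrite expr0 big_ord0 mulr1 -expR0 ler_expR.
have n0' : (0 : R) < n%:R by rewrite ltr0n.
apply: (@le_trans _ _ (n%:R ^+ n * expR 1)).
  rewrite (_ : n.+1%:R = n%:R * (1 + n%:R^-1) :> R); last first.
    by rewrite mulrDr mulr1 divff ?gt_eqF// natr1.
  rewrite exprMn ler_pM2l ?exprn_gt0//.
  apply: (@le_trans _ _ (expR n%:R^-1 ^+ n)).
    by rewrite lerXn2r ?nnegrE ?expR_ge0 ?addr_ge0 ?invr_ge0 ?ler0n// expR_ge1Dx.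
  by rewrite -expRM_natl ler_expR divff// gt_eqF.
by rewrite -natr1 expRD mulrAC ler_pM2r ?expR_gt0.
Qed.

Lemma prod_shrink_inv_le n k :
  (\prod_(i < n) (shrink n k i)^-1 : R) <= expR ((2 * k%:R + 2) * n%:R).
Proof.
apply: (@le_trans _ _ (\prod_(i < n) (expR 1 * (n%:R / i.+1%:R) ^+ (2 * k + 1)))).
  apply: ler_prod => i _; rewrite invr_ge0 (ltW (shrink_gt0 _ _ _))/= /shrink invrK.
  have := snr_ge1 k (ltn_ord i); rewrite -snrE// => h.
  apply: (@le_trans _ _ (2 * snr n k i)); first by lra.
  rewrite ler_pM2r; last by lra.
  by have := @expR_ge1Dx R 1; lra.
rewrite big_split/= prodr_const card_ord prodrXl.
have := prod_ratio_le n; set p := \prod_(i < n) _ => hp.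
have p0 : 0 <= p by apply: prodr_ge0 => i _; rewrite divr_ge0.
apply: (@le_trans _ _ (expR 1 ^+ n * expR n%:R ^+ (2 * k + 1))).
  by rewrite ler_pM2l ?exprn_gt0 ?expR_gt0// lerXn2r ?nnegrE ?expR_ge0.
rewrite -!expRM_natl -expRD ler_expR natrD natrM.
by rewrite le_eqVlt; apply/orP; left; apply/eqP; ring.
Qed.

End shrinkage.

(** * Losses and evidence ratios of single components *)

Lemma sqrB_le {R : realType} (a b : R) : 2 * (a - b) ^+ 2 <= 4 * a ^+ 2 + 4 * b ^+ 2.
Proof. by have := sqr_ge0 (a + b); rewrite !expr2; nra. Qed.

Lemma sqrt_le_of_le_sqr {R : realType} (a b : R) : 0 <= b -> a <= b ^+ 2 -> Num.sqrt a <= b.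
Proof.
move=> b0 ab; apply: le_trans (_ : Num.sqrt (b ^+ 2) <= _); first exact: ler_wsqrtr.
by rewrite sqrtr_sqr ger0_norm.
Qed.

Lemma le_sqrt_of_sqr_le {R : realType} (a b : R) : 0 <= a -> a ^+ 2 <= b -> a <= Num.sqrt b.
Proof.
move=> a0 ab; apply: le_trans (_ : _ <= Num.sqrt (a ^+ 2)) _; last exact: ler_wsqrtr.
by rewrite sqrtr_sqr ger0_norm.
Qed.

Section weights.
Context {R : realType}.
Variables (eps : R) (N k0 : nat).
Hypothesis eps0 : 0 < eps.
Local Notation v := (eps ^+ 2).
Let v0 : 0 < v. Proof. by rewrite exprn_gt0. Qed.

(** A bound, in units of [1200 v], for the part of the loss that depends on the
    component. The factor [1 / 100] is small enough for [exp] of the excess to be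
    absorbed by the decay of the square root of the evidence ratio. *)
Definition excess d k i (t : R) : R :=
  if (i < N)%N then shrink d k i * t ^+ 2 / (100 * v)
  else if (i < d)%N then t ^+ 2 / (100 * v) + 100^-1 else 0.

Definition excess_sum d k (x : seqspace R) : R :=
  \sum_(i < maxn N d) excess d k i (x i).

(** Below [N] the loss is the noise plus the bias [s x]; above [N] an active
    coordinate ([i < d]) may be as far off as its observation, while an inactive
    one is estimated by zero. *)
Lemma coord_loss_le d k i (x theta : R) :
  2 * ((1 - shrink d k i) * x - theta) ^+ 2 + 12 * (v * (1 - shrink d k i)) <=
  (if (i < N)%N then 4 * (x - theta) ^+ 2 + 12 * v else 4 * theta ^+ 2) +
  1200 * v * excess d k i x.
Proof.
have s0 : 0 < shrink d k i :> R := shrink_gt0 d k i.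
have s1 : shrink d k i <= 1 :> R := shrink_le1 d k i.
rewrite /excess; have [iN|Ni] := ltnP i N.
  move: (shrink d k i) s0 s1 => s s0 s1.
  have -> : 1200 * v * (s * x ^+ 2 / (100 * v)) = 12 * (s * x ^+ 2).
    by field; rewrite gt_eqF.
  have h1 : 2 * ((1 - s) * x - theta) ^+ 2 <= 4 * (x - theta) ^+ 2 + 4 * (s * x) ^+ 2.
    have -> : (1 - s) * x - theta = (x - theta) - s * x by ring.
    exact: sqrB_le.
  have h2 : (s * x) ^+ 2 <= s * x ^+ 2.
    by rewrite exprMn ler_wpM2r ?sqr_ge0// expr2 ler_piMr// ltW.
  have h3 : 0 <= v * s by rewrite mulr_ge0// ltW.
  have h4 : 0 <= s * x ^+ 2 by rewrite mulr_ge0 ?sqr_ge0// ltW.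
  lra.
have [id|di] := ltnP i d.
  move: (shrink d k i) s0 s1 => s s0 s1.
  have -> : 1200 * v * (x ^+ 2 / (100 * v) + 100^-1) = 12 * x ^+ 2 + 12 * v.
    by field; rewrite gt_eqF.
  have h1 : 2 * ((1 - s) * x - theta) ^+ 2 <= 4 * ((1 - s) * x) ^+ 2 + 4 * theta ^+ 2.
    exact: sqrB_le.
  have h2 : ((1 - s) * x) ^+ 2 <= x ^+ 2.
    by rewrite exprMn ler_piMl ?sqr_ge0// expr_le1//; lra.
  have h3 : 0 <= v * s by rewrite mulr_ge0// ltW.
  have h4 := sqr_ge0 x.
  lra.
rewrite shrink_tail// subrr mul0r sub0r sqrrN !mulr0 !addr0.
by have := sqr_ge0 theta; lra.
Qed.

(** The loss that even the projection onto the first [N] coordinates incurs, up to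
    constants. *)
Definition budget (theta x : seqspace R) : R :=
  \sum_(i < N) (4 * (x i - theta i) ^+ 2 + 12 * v) + 4 * (v * N%:R).

Lemma budget_ge0 theta x : 0 <= budget theta x.
Proof.
rewrite /budget addr_ge0//; last by rewrite !mulr_ge0// ltW.
by apply: sumr_ge0 => i _; rewrite addr_ge0// mulr_ge0 ?sqr_ge0// ltW.
Qed.

Lemma loss_le d k (theta x : seqspace R) :
  (forall n, \sum_(N <= i < n) theta i ^+ 2 <= v * N%:R) ->
  (\sum_(i <oo) (2 * ((1 - shrink d k i) * x i - theta i) ^+ 2 +
     12 * (v * (1 - shrink d k i)))%:E <=
   (budget theta x + 1200 * v * excess_sum d k x)%:E)%E.
Proof.
move=> tail; set a := fun i => 2 * ((1 - shrink d k i) * x i - theta i) ^+ 2 +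
     12 * (v * (1 - shrink d k i)).
have a0 i : 0 <= a i.
  rewrite /a addr_ge0// mulr_ge0// ?sqr_ge0// mulr_ge0 ?(ltW v0)//.
  by rewrite subr_ge0 shrink_le1.
apply: lime_le; first by apply: is_cvg_nneseries => i _ _; rewrite lee_fin; exact: (a0 i).
apply: nearW => n; rewrite sumEFin lee_fin big_mkord.
pose m := maxn N d; have Nm : (N <= m + n)%N by exact: leq_trans (leq_maxl N d) (leq_addr n m).
apply: (@le_trans _ _ (\sum_(i < m + n) a i)).
  rewrite (sumr_ord_split a (leq_addl m n)) lerDl.
  by apply: sumr_ge0 => i _.
apply: (@le_trans _ _ (\sum_(i < m + n) ((if (i < N)%N then 4 * (x i - theta i) ^+ 2 + 12 * v
    else 4 * theta i ^+ 2) + 1200 * v * excess d k i (x i)))).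
  by apply: ler_sum => i _; exact: coord_loss_le.
rewrite big_split/= -mulr_sumr; apply: lerD.
  rewrite (sumr_ord_split (fun i => if (i < N)%N then 4 * (x i - theta i) ^+ 2 + 12 * v
    else 4 * theta i ^+ 2) Nm).
  apply: lerD; first by apply: ler_sum => i _; rewrite ltn_ord.
  rewrite (_ : \sum_(N <= i < m + n) _ = 4 * \sum_(N <= i < m + n) theta i ^+ 2).
    by rewrite ler_pM2l.
  by rewrite mulr_sumr; apply: eq_big_nat => i /andP[Ni _]; rewrite ltnNge Ni.
have C0 : 0 <= 1200 * v by have := v0; lra.
move: (1200 * v) C0 => C C0; apply: ler_wpM2l => //.
rewrite (sumr_ord_split (fun i => excess d k i (x i)) (leq_addr n m)).
suff -> : \sum_(m <= i < m + n) excess d k i (x i) = 0 by rewrite addr0.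
rewrite big_nat big1// => i /andP[]; rewrite geq_max => /andP[Ni di] _.
by rewrite /excess !ltnNge Ni di.
Qed.

(** One coordinate of [sqrt (evidence ratio) * exp (excess)]. *)
Definition ratio d k i (t : R) : R :=
  Num.sqrt (mlik v (shrink d k i) t / mlik v (shrink N k0 i) t) * expR (excess d k i t).

Definition ratio_prod d k (x : seqspace R) : R :=
  \prod_(i < maxn N d) ratio d k i (x i).

Lemma mlik_gt0 s t : 0 < s -> 0 < mlik v s t.
Proof. by move=> s0; rewrite mulr_gt0 ?expR_gt0// sqrtr_gt0. Qed.

Lemma mlik1 t : mlik v 1 t = 1.
Proof. by rewrite /mlik sqrtr1 subrr !mul0r expR0 mulr1. Qed.

Lemma marg_gt0 d k x : 0 < marg eps d k x.
Proof. by apply: prodr_gt0 => i _; apply: mlik_gt0; exact: shrink_gt0. Qed.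

Lemma margE n d k x : (d <= n)%N ->
  marg eps d k x = \prod_(i < n) mlik v (shrink d k i) (x i).
Proof.
move=> dn; rewrite (prodr_ord_split (fun i => mlik v (shrink d k i) (x i)) dn).
rewrite [X in _ * X](_ : _ = 1) ?mulr1//.
by rewrite big_nat big1// => i /andP[di _]; rewrite shrink_tail// mlik1.
Qed.

Lemma ratio_prodE d k x : ratio_prod d k x =
  Num.sqrt (marg eps d k x / marg eps N k0 x) * expR (excess_sum d k x).
Proof.
rewrite (margE k x (leq_maxr N d)) (margE k0 x (leq_maxl N d)) -prodf_div.
rewrite (@sqrt_prod _ _ (fun i => mlik v (shrink d k i) (x i) / mlik v (shrink N k0 i) (x i))).
  by rewrite expR_sum -big_split.
by move=> i; rewrite divr_ge0// ltW// mlik_gt0// shrink_gt0.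
Qed.

Lemma ratio_ge0 d k i t : 0 <= ratio d k i t.
Proof. by rewrite mulr_ge0 ?sqrtr_ge0 ?expR_ge0. Qed.

Lemma ratioE d k i t : ratio d k i t =
  Num.sqrt (Num.sqrt (shrink d k i) / Num.sqrt (shrink N k0 i)) *
  expR ((shrink N k0 i - shrink d k i) * t ^+ 2 / (4 * v) + excess d k i t).
Proof.
have s0 := @shrink_gt0 R d k i; have s00 := @shrink_gt0 R N k0 i.
rewrite /ratio /mlik [RHS](_ : _ = Num.sqrt (Num.sqrt (shrink d k i) / Num.sqrt (shrink N k0 i)) *
  expR ((shrink N k0 i - shrink d k i) * t ^+ 2 / (4 * v)) * expR (excess d k i t)); last first.
  by rewrite expRD [LHS]mulrA.
congr (_ * _).
move: (shrink d k i) (shrink N k0 i) s0 s00 => s s' s0 s00.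
set E1 := expR ((1 - s) * _ / _); set E2 := expR ((1 - s') * _ / _).
have -> : Num.sqrt s * E1 / (Num.sqrt s' * E2) = Num.sqrt s / Num.sqrt s' * (E1 / E2).
  by rewrite invfM mulrACA.
rewrite sqrtrM ?divr_ge0 ?sqrtr_ge0//; congr (_ * _).
rewrite /E1 /E2 -expRN -expRD sqrt_expR; congr expR.
by field; rewrite gt_eqF.
Qed.

Lemma measurable_ratio d k i : measurable_fun setT (ratio d k i).
Proof.
rewrite (_ : ratio d k i = fun t => Num.sqrt (Num.sqrt (shrink d k i) / Num.sqrt (shrink N k0 i)) *
  expR ((shrink N k0 i - shrink d k i) * t ^+ 2 / (4 * v) + excess d k i t)); last first.
  by apply/funext => t; exact: ratioE.
apply: measurable_funM => //; apply: measurableT_comp => //.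
apply: measurable_funD; first by apply: measurable_funM => //; apply: measurable_funM.
rewrite /excess; case: (i < N)%N; first by apply: measurable_funM => //; apply: measurable_funM.
case: (i < d)%N => //; apply: measurable_funD => //.
by apply: measurable_funM.
Qed.

(** Below the cut-off the evidence of [(d, k)] can exceed that of [(N, k0)] by a
    Gaussian exponential with rate at most that of [s' = shrink N k0 i], whatever
    [d] and [k] are: the negative term in [shrink d k i] outweighs the excess. The
    cost is thus governed by the comparison component. *)
Lemma integral_ratio_head d k i theta : (i < N)%N ->
  (\int[gauss theta v]_t (ratio d k i t)%:E <=
   (2 * (shrink N k0 i)^-1 * expR (shrink N k0 i * theta ^+ 2 / v))%:E)%E.
Proof.
move=> iN; have s0 := @shrink_gt0 R d k i; have s00 := @shrink_gt0 R N k0 i.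
have s1 := @shrink_le1 R d k i; have s01 := @shrink_le1 R N k0 i.
have sh := @shrink_le_half R N k0 i iN.
set s := shrink d k i in s0 s1; set s' := shrink N k0 i in s00 s01 sh *.
(* The rate [(s' - s) / 4 + s / 100] of the exponent is at most [s' / 4]. *)
pose a := s' / 2; have a1 : a < 1 by rewrite /a; lra.
apply: (@le_trans _ _ (\int[gauss theta v]_t ((s'^-1)%:E * (expR (a * t ^+ 2 / (2 * v)))%:E)))%E.
  apply: ge0_le_integral => //.
  - by move=> t _; rewrite lee_fin ratio_ge0.
  - by apply/measurable_EFinP; exact: measurable_ratio.
  - apply: measurable_funeM; apply/measurable_EFinP.
    have := @measurable_tilt R a 0 v; apply: eq_measurable_fun => t _.
    by rewrite !mul0r addr0.
  - move=> t _; rewrite -EFinM lee_fin ratioE -/s -/s' /excess iN -/s.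
    apply: ler_pM; rewrite ?sqrtr_ge0 ?expR_ge0//.
      have sq' : s' <= Num.sqrt s'.
        by apply: le_sqrt_of_sqr_le; [exact: ltW|rewrite expr2 ler_piMr// ltW].
      have sq1 : Num.sqrt s <= 1 by rewrite -sqrtr1 ler_sqrt.
      have q1 : Num.sqrt s / Num.sqrt s' <= s'^-1.
        rewrite -[leRHS]mul1r ler_pM ?sqrtr_ge0 ?invr_ge0 ?sqrtr_ge0// lef_pV2// posrE ?sqrtr_gt0//.
      apply: le_trans (_ : Num.sqrt (s'^-1) <= _); first by rewrite ler_sqrt// invr_ge0 ltW.
      have i1 : 1 <= s'^-1 by rewrite invf_ge1.
      apply: sqrt_le_of_le_sqr; first by rewrite invr_ge0 ltW.
      by rewrite expr2 ler_peMr// invr_ge0 ltW.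
    rewrite ler_expR.
    have -> : (s' - s) * t ^+ 2 / (4 * v) + s * t ^+ 2 / (100 * v) =
       a * t ^+ 2 / (2 * v) - (24 / 100) * (s * (t ^+ 2 / v)).
      by rewrite /a; field; rewrite gt_eqF.
    by rewrite lerBlDr lerDl mulr_ge0// mulr_ge0 ?(ltW s0)// divr_ge0 ?sqr_ge0 ?(ltW v0).
rewrite ge0_integralZl; [|exact: measurableT| | |]; last first.
- by rewrite lee_fin invr_ge0 ltW.
- by move=> t _; rewrite lee_fin expR_ge0.
- apply/measurable_EFinP.
  have := @measurable_tilt R a 0 v; apply: eq_measurable_fun => t _.
  by rewrite !mul0r addr0.
rewrite [X in (_ * X <= _)%E](integral_gauss_exp theta v0 a1) -EFinM lee_fin.
have i0 : 0 < s'^-1 by rewrite invr_gt0.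
rewrite [leLHS]mulrA; apply: ler_pM; rewrite ?expR_ge0//.
  by rewrite divr_ge0 ?sqrtr_ge0// ltW.
  rewrite [leLHS]mulrC ler_pM2r//.
  rewrite -[leRHS]invrK lef_pV2 ?posrE ?sqrtr_gt0 ?invr_gt0//; last by rewrite subr_gt0.
  apply: le_sqrt_of_sqr_le; first by rewrite invr_ge0.
  by rewrite expr2 /a; lra.
rewrite ler_expR.
have v2 : 0 <= theta ^+ 2 / v by rewrite divr_ge0 ?sqr_ge0 ?(ltW v0).
have -> : a * theta ^+ 2 / (2 * v * (1 - a)) = (a / (2 * (1 - a))) * (theta ^+ 2 / v).
  by field; rewrite ?gt_eqF// subr_gt0.
rewrite -[leRHS]mulrA; apply: ler_wpM2r => //; rewrite ler_pdivrMr; last by rewrite mulr_gt0// subr_gt0.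
by rewrite /a; nra.
Qed.

(** Above the cut-off the comparison component expects pure noise, and the
    integral of the square root of a density ratio is below one by a margin,
    because [s <= 1 / 2]; the margin absorbs the excess. Hence no price is paid for
    the number [d - N] of superfluous coordinates. *)
Lemma integral_ratio_tail d k i theta : (N <= i)%N -> (i < d)%N ->
  (\int[gauss theta v]_t (ratio d k i t)%:E <= (expR (theta ^+ 2 / v))%:E)%E.
Proof.
move=> Ni id; have s0 := @shrink_gt0 R d k i.
have sh := @shrink_le_half R d k i id.
set s := shrink d k i in s0 sh.
pose a := (1 - s) / 2 + 50^-1; have a1 : a < 1 by rewrite /a; lra.
rewrite (_ : (\int[gauss theta v]_t _)%E = (\int[gauss theta v]_t
   ((Num.sqrt (Num.sqrt s) * expR (100^-1))%:E * (expR (a * t ^+ 2 / (2 * v)))%:E))%E); last first.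
  apply: eq_integral => t _; rewrite -EFinM ratioE (shrink_tail k0 Ni) -/s /excess id ltnNge Ni/=.
  congr EFin; rewrite sqrtr1 divr1 -[RHS]mulrA -expRD; congr (_ * expR _).
  by rewrite /a; field; rewrite gt_eqF.
rewrite ge0_integralZl; [|exact: measurableT| | |]; last first.
- by rewrite lee_fin mulr_ge0 ?sqrtr_ge0 ?expR_ge0.
- by move=> t _; rewrite lee_fin expR_ge0.
- apply/measurable_EFinP.
  have := @measurable_tilt R a 0 v; apply: eq_measurable_fun => t _.
  by rewrite !mul0r addr0.
rewrite [X in (_ * X <= _)%E](integral_gauss_exp theta v0 a1) -EFinM lee_fin.
rewrite [leLHS]mulrA -[leRHS]mul1r; apply: ler_pM; rewrite ?expR_ge0 ?mulr_ge0 ?invr_ge0 ?sqrtr_ge0 ?expR_ge0//.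
  rewrite ler_pdivrMr ?mul1r ?sqrtr_gt0 ?subr_gt0//.
  (* Raise both sides to the fourth power: the claim is [s exp (1 / 25) <= (1 - a) ^ 2]. *)
  have e100 : expR 100^-1 = Num.sqrt (Num.sqrt (expR (25^-1 : R))).
    by rewrite !sqrt_expR; congr expR; lra.
  rewrite e100 -sqrtrM ?sqrtr_ge0// -sqrtrM ?(ltW s0)// ler_sqrt ?subr_ge0 ?(ltW a1)//.
  have e25 : expR (25^-1 : R) <= 25 / 24.
    have := @expR_ge1Dx R (- 25^-1); rewrite expRN => h.
    rewrite -[leLHS]invrK -[leRHS]invrK lef_pV2 ?posrE ?invr_gt0 ?expR_gt0 ?divr_gt0//.
    by apply: le_trans h; rewrite invf_div; lra.
  apply: sqrt_le_of_le_sqr; first by rewrite subr_ge0 ltW.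
  apply: (@le_trans _ _ (s * (25 / 24))); first by rewrite ler_pM2l.
  by rewrite expr2 /a; nra.
rewrite ler_expR.
have v2 : 0 <= theta ^+ 2 / v by rewrite divr_ge0 ?sqr_ge0 ?(ltW v0).
have -> : a * theta ^+ 2 / (2 * v * (1 - a)) = (a / (2 * (1 - a))) * (theta ^+ 2 / v).
  by field; rewrite ?gt_eqF// subr_gt0.
rewrite ler_piMl// ler_pdivrMr; last by rewrite mulr_gt0// subr_gt0.
by rewrite /a; lra.
Qed.

(** The four factors of the bound come from the constants [2] below [N], from
    [prod_shrink_inv_le], and from the signal below and above [N]. *)
Lemma integral_ratio_prod d k (theta : seqspace R) :
  (\sum_(i < N) shrink N k0 i * theta i ^+ 2 <= v * N%:R) ->
  (forall n, \sum_(N <= i < n) theta i ^+ 2 <= v * N%:R) ->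
  (\int[model eps theta]_x (ratio_prod d k x)%:E <= (expR ((2 * k0%:R + 5) * N%:R))%:E)%E.
Proof.
move=> head tail; pose n := maxn N d; have Nn : (N <= n)%N by rewrite leq_maxl.
pose bd i := if (i < N)%N then 2 * (shrink N k0 i)^-1 * expR (shrink N k0 i * theta i ^+ 2 / v)
  else expR (theta i ^+ 2 / v).
have bd0 i : 0 <= bd i.
  rewrite /bd; case: ifP => _; rewrite ?expR_ge0// !mulr_ge0 ?expR_ge0// invr_ge0.
  by rewrite ltW// shrink_gt0.
have gr i : ge0_measurable (fun t : R => (ratio d k i t)%:E).
  split => [|t]; last by rewrite lee_fin ratio_ge0.
  by apply/measurable_EFinP; exact: measurable_ratio.
rewrite (modelE eps) (_ : (\int[_]_x _)%E =
    (\int[product_prob (fun i => gauss (theta i) v)]_x \prod_(i < n) (ratio d k i (x i))%:E)%E); last first.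
  by apply: eq_integral => x _; rewrite prodEFin.
rewrite (@integral_product_prob _ _ (fun i t => (ratio d k i t)%:E) n gr).
apply: (@le_trans _ _ (\prod_(i < n) (bd i)%:E)%E).
  have le_prod (F G : nat -> \bar R) m : (forall i, 0 <= F i)%E -> (forall i, (i < m)%N -> F i <= G i)%E ->
      (\prod_(i < m) F i <= \prod_(i < m) G i)%E.
    move=> F0; elim: m => [|m IH] FG; first by rewrite !big_ord0.
    rewrite !big_ord_recr/=; apply: lee_pmul => //.
    - by apply: prode_ge0 => i _.
    - by apply: IH => i im; apply: FG; exact: ltnW.
    - exact: FG.
  apply: (le_prod (fun i => \int[gauss (theta i) v]_t (ratio d k i t)%:E)%E (fun i => (bd i)%:E)) => [i|i ilt].
    by apply: integral_ge0 => t _; rewrite lee_fin ratio_ge0.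
  rewrite /bd; have [iN|Ni] := ltnP i N; first exact: integral_ratio_head.
  apply: integral_ratio_tail => //; move: ilt; rewrite /n leq_max => /orP[|//].
  by rewrite ltnNge Ni.
rewrite prodEFin lee_fin (prodr_ord_split bd Nn).
have -> : \prod_(i < N) bd i = 2 ^+ N * \prod_(i < N) (shrink N k0 i)^-1 *
    expR ((\sum_(i < N) shrink N k0 i * theta i ^+ 2) / v).
  rewrite mulr_suml expR_sum -[N in 2 ^+ N]card_ord -prodr_const -!big_split/=.
  by apply: eq_bigr => i _; rewrite /bd ltn_ord.
have -> : \prod_(N <= i < n) bd i = expR ((\sum_(N <= i < n) theta i ^+ 2) / v).
  rewrite mulr_suml expR_sum; apply: eq_big_nat => i /andP[Ni _].
  by rewrite /bd ltnNge Ni.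
apply: (@le_trans _ _ (expR N%:R * expR ((2 * k0%:R + 2) * N%:R) * expR N%:R * expR N%:R)).
  have quot (u : R) : u <= v * N%:R -> expR (u / v) <= expR N%:R.
    by move=> uN; rewrite ler_expR ler_pdivrMr// mulrC.
  apply: ler_pM; rewrite ?expR_ge0 ?mulr_ge0 ?expR_ge0 ?exprn_ge0//; last by apply: quot.
    by apply: prodr_ge0 => i _; rewrite invr_ge0 ltW// shrink_gt0.
  apply: ler_pM; rewrite ?expR_ge0 ?mulr_ge0 ?exprn_ge0//; last by apply: quot.
    by apply: prodr_ge0 => i _; rewrite invr_ge0 ltW// shrink_gt0.
  apply: ler_pM; rewrite ?exprn_ge0//; last exact: prod_shrink_inv_le.
    by apply: prodr_ge0 => i _; rewrite invr_ge0 ltW// shrink_gt0.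
  rewrite -[N%:R]mulr1 expRM_natl lerXn2r ?nnegrE ?expR_ge0//.
  by have := @expR_ge1Dx R 1; lra.
rewrite -!expRD ler_expR.
by rewrite le_eqVlt; apply/orP; left; apply/eqP; ring.
Qed.

End weights.

(** * Posterior averages over the components *)

Section posterior_risk.
Context {R : realType}.
Variables (eps eta gamma : R) (N k0 : nat) (theta : seqspace R).
Hypotheses (eps0 : 0 < eps) (eta0 : 0 < eta) (gamma0 : 0 < gamma).
Hypotheses (N0 : (0 < N)%N) (k00 : (0 < k0)%N).
Local Notation v := (eps ^+ 2).
Let v0 : 0 < v. Proof. by rewrite exprn_gt0. Qed.
Hypothesis head : \sum_(i < N) shrink N k0 i * theta i ^+ 2 <= v * N%:R.
Hypothesis tail : forall n, \sum_(N <= i < n) theta i ^+ 2 <= v * N%:R.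

(** The posterior loss of a component is a sum over the coordinates of variances and
    squared biases, to which [loss_le] applies. *)
Lemma sieve_loss_le d k (x : seqspace R) :
  (\int[sieve_prior eps d k%:R]_t (sqnorm (fun i => t i - theta i)%R * (Lik eps d t x)%:E) <=
   (marg eps d k x * (budget eps N theta x + 1200 * v * excess_sum eps N d k x))%:E)%E.
Proof.
have gsq i : ge0_measurable (fun t : seqspace R => ((t i - theta i) ^+ 2)%:E * (Lik eps d t x)%:E)%E.
  apply: ge0_measurableM; [exact: ge0_measurable_sqr_coord| |by move=> t; exact: Lik_ge0].
  exact: (@measurable_Lik _ _ d _ (seqspace R) id (cst x)).
rewrite (_ : (\int[_]_t _)%E = (\sum_(i <oo) \int[sieve_prior eps d k%:R]_t
    (((t i - theta i) ^+ 2)%:E * (Lik eps d t x)%:E))%E); last first.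
  rewrite -integral_nneseries//; last 2 first.
  - by move=> i; exact: (gsq i).1.
  - by move=> i t _; exact: (gsq i).2.
  apply: eq_integral => t _; rewrite muleC -nneseriesZl_ge0 ?lee_fin ?Lik_ge0//; last first.
    by move=> i; rewrite lee_fin sqr_ge0.
  by apply: eq_eseriesr => i _; rewrite muleC.
apply: (@le_trans _ _ (\sum_(i <oo) (marg eps d k x)%:E *
  (2 * ((1 - shrink d k i) * x i - theta i) ^+ 2 + 12 * (v * (1 - shrink d k i)))%:E)%E).
  apply: lee_nneseries => [i _ _|i _].
    by apply: integral_ge0 => t _; exact: (gsq i).2.
  rewrite -EFinM sieve_priorE.
  exact: (component_second_moment eps0 (snr_ge0 d k) (@snr_tail _ d k)).
rewrite nneseriesZl; last first.
  move=> i _; rewrite lee_fin addr_ge0// mulr_ge0 ?sqr_ge0// mulr_ge0 ?(ltW v0)//.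
  by rewrite subr_ge0 shrink_le1.
rewrite EFinM; apply: lee_wpmul2l; first by rewrite lee_fin ltW// marg_gt0.
exact: loss_le.
Qed.

(** Linearising the excess by [h <= A + exp (h - A)] trades a posterior average
    of [h], which would need the posterior weights to be small, for one of an
    exponential, which only needs a moment bound. *)
Lemma mix_loss_le A x : (0 <= A) ->
  (mix eta gamma (fun d k => \int[sieve_prior eps d k%:R]_t
      (sqnorm (fun i => t i - theta i)%R * (Lik eps d t x)%:E)) <=
   (budget eps N theta x + 1200 * v * A)%:E * mix eta gamma (fun d k => (marg eps d k x)%:E) +
   (1200 * v * expR (- A))%:E *
     mix eta gamma (fun d k => (marg eps d k x * expR (excess_sum eps N d k x))%:E))%E.
Proof.
move=> A0.
have C0 : 0 <= 1200 * v by have := v0; lra.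
have SL d k := sieve_loss_le d k x; move: (1200 * v) C0 SL => C C0 SL.
have b0 : 0 <= budget eps N theta x by exact: budget_ge0.
have g0 d k : 0 <= marg eps d k x by rewrite ltW// marg_gt0.
rewrite -mixZ; last 2 first.
- by rewrite lee_fin addr_ge0// mulr_ge0.
- by move=> d k; rewrite lee_fin.
rewrite -mixZ; last 2 first.
- by rewrite lee_fin mulr_ge0 ?expR_ge0.
- by move=> d k; rewrite lee_fin mulr_ge0 ?expR_ge0.
rewrite -mixD; last 2 first.
- by move=> d k; rewrite mule_ge0 ?lee_fin// addr_ge0// mulr_ge0.
- by move=> d k; rewrite mule_ge0 ?lee_fin ?mulr_ge0 ?expR_ge0.
apply: le_mix => [d k|d k _ _].
  apply: integral_ge0 => t _; rewrite mule_ge0 ?lee_fin ?Lik_ge0//.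
  exact: (ge0_measurable_sqnorm theta).2.
apply: le_trans (SL d k) _.
rewrite -!EFinM -EFinD lee_fin.
have := expR_ge1Dx (excess_sum eps N d k x - A).
move: (excess_sum eps N d k x) (marg eps d k x) (g0 d k) (budget _ _ _ _) b0.
move=> h m m0 b b0' hexp.
have he : h <= A + expR (- A) * expR h.
  by rewrite -expRD [- A + h]addrC; lra.
have hC : C * h <= C * (A + expR (- A) * expR h) by rewrite ler_wpM2l.
have -> : (b + C * A) * m + C * expR (- A) * (m * expR h) =
  m * (b + C * (A + expR (- A) * expR h)) by ring.
by apply: ler_wpM2l => //; rewrite lerD2l.
Qed.

(** The square root of the ratio of the prior weights of [(d, k)] and [(N, k0)]. *)
Definition weight_ratio d k : R :=
  expR (- ((eta * (d%:R - N%:R) + gamma * (k%:R - k0%:R)) / 2)).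

Definition mixed_ratio x : \bar R :=
  (\sum_(k <oo) \sum_(d <oo) (weight_ratio d.+1 k.+1 * ratio_prod eps N k0 d.+1 k.+1 x)%:E)%E.

Lemma mix_term_le (F : nat -> nat -> \bar R) d k : (forall d k, 0 <= F d k)%E ->
  (0 < d)%N -> (0 < k)%N ->
  ((exp_weight gamma k)%:E * ((exp_weight eta d)%:E * F d k) <= mix eta gamma F)%E.
Proof.
move=> F0; case: d => // d _; case: k => // k _.
have in0 k' : (0 <= \sum_(d <oo) (exp_weight eta d.+1)%:E * F d.+1 k')%E.
  by apply: nneseries_ge0 => d' _ _; rewrite mule_ge0// lee_fin exp_weight_ge0.
apply: le_trans (_ : (exp_weight gamma k.+1)%:E *
    (\sum_(d <oo) (exp_weight eta d.+1)%:E * F d.+1 k.+1) <= _)%E.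
  apply: lee_wpmul2l; first by rewrite lee_fin exp_weight_ge0.
  apply: (@nneseries_term_le _ (fun d => (exp_weight eta d.+1)%:E * F d.+1 k.+1)%E 0 d) => // d'.
  by rewrite mule_ge0// lee_fin exp_weight_ge0.
apply: (@nneseries_term_le _ (fun k => (exp_weight gamma k.+1)%:E *
    \sum_(d <oo) (exp_weight eta d.+1)%:E * F d.+1 k.+1)%E 0 k) => // k'.
by rewrite mule_ge0// lee_fin exp_weight_ge0.
Qed.

(** With [m] the total evidence, the weights [w = y d k / m] and
    [w0 = y N k0 / m] are at most one, so [w w0 <= 1] and [w <= sqrt (w / w0)]. The
    right-hand side does not contain [m]. *)
Lemma mix_excess_le x :
  mix eta gamma (fun d k => (marg eps d k x)%:E) \is a fin_num ->
  (mix eta gamma (fun d k => (marg eps d k x * expR (excess_sum eps N d k x))%:E) <=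
   mix eta gamma (fun d k => (marg eps d k x)%:E) * mixed_ratio x)%E.
Proof.
set M := mix eta gamma (fun d k => (marg eps d k x)%:E) => Mfin.
have g0 d k : 0 < marg eps d k x by exact: marg_gt0.
pose m := fine M; have ME : M = m%:E by rewrite fineK.
pose y d k := exp_weight gamma k * (exp_weight eta d * marg eps d k x).
have y0 d k : 0 < y d k.
  apply: mulr_gt0; first exact: exp_weight_gt0.
  by apply: mulr_gt0 => //; exact: exp_weight_gt0.
have ym d k : (0 < d)%N -> (0 < k)%N -> y d k <= m.
  move=> d0 k1; rewrite -lee_fin -ME !EFinM; apply: mix_term_le => // d' k'.
  by rewrite lee_fin ltW.
have m0 : 0 < m by exact: lt_le_trans (y0 N k0) (ym _ _ N0 k00).
have r0 d k : 0 <= ratio_prod eps N k0 d k x by apply: prodr_ge0 => i _; exact: ratio_ge0.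
have wr0 d k : 0 <= weight_ratio d k by exact: expR_ge0.
have key d k : (0 < d)%N -> (0 < k)%N ->
    exp_weight gamma k * (exp_weight eta d * (marg eps d k x * expR (excess_sum eps N d k x))) <=
    m * (weight_ratio d k * ratio_prod eps N k0 d k x).
  move=> d0 k1; rewrite ratio_prodE//; set e := expR _.
  have -> : exp_weight gamma k * (exp_weight eta d * (marg eps d k x * e)) = y d k * e.
    by rewrite /y [exp_weight eta d * (_ * e)]mulrA [LHS]mulrA.
  have -> : m * (weight_ratio d k * (Num.sqrt (marg eps d k x / marg eps N k0 x) * e)) =
      m * Num.sqrt (y d k / y N k0) * e.
    rewrite [weight_ratio d k * (_ * e)]mulrA [LHS]mulrA; congr (_ * _ * e).
    have -> : y d k / y N k0 = expR (- (eta * (d%:R - N%:R) + gamma * (k%:R - k0%:R))) *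
        (marg eps d k x / marg eps N k0 x).
      rewrite /y /exp_weight -!/(exp_mass _).
      have -> : - (eta * (d%:R - N%:R) + gamma * (k%:R - k0%:R)) =
          - (gamma * k%:R) - (eta * d%:R) - - (gamma * k0%:R) - - (eta * N%:R) by ring.
      rewrite expRB expRB expRD; field.
      by rewrite !gt_eqF ?exp_mass_gt0 ?expR_gt0.
    rewrite [RHS]sqrtrM ?expR_ge0// sqrt_expR; congr (expR _ * _).
    by rewrite mulNr.
  rewrite ler_pM2r ?expR_gt0//.
  rewrite sqrtrM ?(ltW (y0 _ _))// sqrtrV ?(ltW (y0 _ _))//.
  set a := Num.sqrt (y d k); set c := Num.sqrt (y N k0).
  have a0 : 0 <= a by exact: sqrtr_ge0.
  have c0 : 0 < c by rewrite sqrtr_gt0.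
  have aE : a ^+ 2 = y d k by rewrite sqr_sqrtr// ltW.
  have cE : c ^+ 2 = y N k0 by rewrite sqr_sqrtr// ltW.
  have am : a ^+ 2 <= m by rewrite aE ym.
  have cm : c ^+ 2 <= m by rewrite cE ym.
  have acm : a * c <= m by rewrite !expr2 in am cm; nra.
  rewrite -aE mulrA ler_pdivlMr// expr2 -mulrA [leRHS]mulrC.
  exact: ler_wpM2l.
rewrite ME /mixed_ratio -nneseriesZl; last first.
  by move=> k _; apply: nneseries_ge0 => d _ _; rewrite lee_fin mulr_ge0.
apply: lee_nneseries => [k _ _|k _].
  rewrite mule_ge0 ?lee_fin ?exp_weight_ge0// nneseries_ge0// => d _ _.
  by rewrite mule_ge0 ?lee_fin ?exp_weight_ge0// mulr_ge0 ?expR_ge0// ltW.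
rewrite -!nneseriesZl; last 2 first.
- by move=> d _; rewrite lee_fin mulr_ge0.
- by move=> d _; rewrite mule_ge0 ?lee_fin ?exp_weight_ge0// mulr_ge0 ?expR_ge0// ltW.
apply: lee_nneseries => [d _ _|d _].
  by rewrite !mule_ge0 ?lee_fin ?exp_weight_ge0// mulr_ge0 ?expR_ge0// ltW.
by rewrite -!EFinM lee_fin; exact: key.
Qed.

End posterior_risk.

(** * Risk of the posterior mean *)

Lemma integral_product_prob_coord {R : realType} (mu : nat -> probability (measurableTypeR R) R)
    (g : R -> \bar R) i : ge0_measurable g ->
  (\int[product_prob mu]_x g (x i) = \int[mu i]_t g t)%E.
Proof.
move=> gg; pose G j : R -> \bar R := if j == i then g else cst 1%E.
have gG j : ge0_measurable (G j) by rewrite /G; case: (j == i) => //; split.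
have Gi : G i = g by rewrite /G eqxx.
have Gj (j : 'I_i) : G j = cst 1%E by rewrite /G ltn_eqF.
transitivity (\int[product_prob mu]_x \prod_(j < i.+1) G j (x j))%E.
  apply: eq_integral => x _; rewrite big_ord_recr/= Gi big1 ?mul1e// => j _.
  by rewrite Gj.
rewrite (integral_product_prob mu i.+1 gG) big_ord_recr/= Gi.
rewrite (_ : \prod_(j < i) _ = 1)%E ?mul1e//.
by apply: big1 => j _; rewrite Gj; exact: integral_prob_cst.
Qed.

Section posterior_mean_bound.
Context {R : realType}.
Variables (eps eta gamma : R) (N k0 : nat) (theta : seqspace R).
Hypotheses (eps0 : 0 < eps) (eta0 : 0 < eta) (gamma0 : 0 < gamma).
Hypotheses (N0 : (0 < N)%N) (k00 : (0 < k0)%N).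
Local Notation v := (eps ^+ 2).
Let v0 : 0 < v. Proof. by rewrite exprn_gt0. Qed.
Hypothesis l2theta : l2 theta.
Hypothesis head : \sum_(i < N) shrink N k0 i * theta i ^+ 2 <= v * N%:R.
Hypothesis tail : forall n, \sum_(N <= i < n) theta i ^+ 2 <= v * N%:R.

Lemma ae_model (P : set (seqspace R)) :
  {ae base eps, forall x, P x} -> {ae model eps theta, forall x, P x}.
Proof.
move=> [A [mA A0 PA]]; exists A; split; [exact: mA| |exact: PA].
exact: (model_dominated eps0 l2theta mA A0).
Qed.

(** Each of the [N] coordinates costs at most [4 * 12 v + 12 v], and the remainder
    [4 v N] is deterministic. *)
Lemma integral_budget :
  (\int[model eps theta]_x (budget eps N theta x)%:E <= (64 * (v * N%:R))%:E)%E.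
Proof.
have gi i : ge0_measurable (fun x : seqspace R => (4 * (x i - theta i) ^+ 2 + 12 * v)%:E).
  split => [|x]; last by rewrite lee_fin addr_ge0// mulr_ge0 ?sqr_ge0// ltW.
  apply/measurable_EFinP; apply: measurable_funD => //; apply: measurable_funM => //.
  by apply: measurable_funX; apply: measurable_funB => //; exact: measurable_coord.
under eq_integral do rewrite /budget EFinD -sumEFin.
rewrite ge0_integralD; [|exact: measurableT| | | |]; last first.
- exact: measurable_cst.
- by move=> x _; rewrite lee_fin mulr_ge0// mulr_ge0// ltW.
- by apply: emeasurable_sum => i; exact: (gi i).1.
- by move=> x _; apply: sume_ge0 => i _; exact: (gi i).2.
rewrite (integral_prob_cst (model eps theta)) ge0_integral_sum; [|exact: measurableT| |]; last first.
- by move=> i x _; exact: (gi i).2.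
- by move=> i; exact: (gi i).1.
have coord i : (\int[model eps theta]_x (4 * (x i - theta i) ^+ 2 + 12 * v)%:E <= (60 * v)%:E)%E.
  rewrite (modelE eps).
  have gt : ge0_measurable (fun t : R => ((t - theta i) ^+ 2)%:E).
    split => [|t]; last by rewrite lee_fin sqr_ge0.
    by apply/measurable_EFinP; apply: measurable_funX; exact: measurable_funB.
  rewrite (_ : (\int[_]_x _)%E = (\int[gauss (theta i) v]_t (4%:E * ((t - theta i) ^+ 2)%:E + (12 * v)%:E))%E); last first.
    rewrite -(@integral_product_prob_coord _ (fun i => gauss (theta i) v) (fun t => 4%:E * ((t - theta i) ^+ 2)%:E + (12 * v)%:E)%E i).
      by [].
    split; first by apply: emeasurable_funD => //; apply: measurable_funeM; exact: gt.1.
    by move=> t; rewrite adde_ge0// ?mule_ge0 ?lee_fin ?sqr_ge0// mulr_ge0// ltW.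
  rewrite ge0_integralD; [|exact: measurableT| | | |]; last first.
  - exact: measurable_cst.
  - by move=> x _; rewrite lee_fin mulr_ge0// ltW.
  - by apply: measurable_funeM; exact: gt.1.
  - by move=> x _; rewrite mule_ge0 ?lee_fin ?sqr_ge0.
  rewrite (integral_prob_cst (gauss (theta i) v)) ge0_integralZl; [|exact: measurableT| | |]; last first.
  - by rewrite lee_fin.
  - by move=> x _; exact: gt.2.
  - exact: gt.1.
  have := gauss_second_moment (theta i) (theta i) (ltW v0).
  rewrite subrr expr0n/= mulr0 add0r => h.
  apply: le_trans (_ : 4%:E * (12 * v)%:E + (12 * v)%:E <= _)%E; last first.
    by rewrite -EFinM -EFinD lee_fin; lra.
  by rewrite leeD2r//; apply: lee_wpmul2l.
apply: le_trans (_ : \sum_(i < N) (60 * v)%:E + (4 * (v * N%:R))%:E <= _)%E.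
  by rewrite leeD2r//; apply: lee_sum => i _; exact: coord.
rewrite sumEFin -EFinD lee_fin sumr_const card_ord -mulr_natr.
by rewrite le_eqVlt; apply/orP; left; apply/eqP; ring.
Qed.

(** The sum of the square roots of the unnormalized prior weights. *)
Definition half_mass (c : R) : R := fine (\sum_(j <oo) (expR (- (c / 2 * j.+1%:R)))%:E)%E.

Lemma half_massE c : 0 < c ->
  (\sum_(j <oo) (expR (- (c / 2 * j.+1%:R)))%:E = (half_mass c)%:E)%E.
Proof.
move=> c0; rewrite fineK// ge0_fin_numE; first by apply: exp_series_fin; rewrite divr_gt0.
by apply: nneseries_ge0 => j _ _; rewrite lee_fin expR_ge0.
Qed.

Lemma half_mass_ge0 c : 0 <= half_mass c.
Proof. by apply: fine_ge0; apply: nneseries_ge0 => j _ _; rewrite lee_fin expR_ge0. Qed.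

Lemma ge0_measurable_ratio_prod d k :
  ge0_measurable (fun x : seqspace R => (ratio_prod eps N k0 d k x)%:E).
Proof.
split => [|x]; last by rewrite lee_fin prodr_ge0// => i _; exact: ratio_ge0.
apply/measurable_EFinP; apply: (@measurable_prod_coord _ (ratio eps N k0 d k)).
by move=> i; exact: measurable_ratio.
Qed.

Lemma ge0_measurable_weighted d k : ge0_measurable (fun x : seqspace R =>
  (weight_ratio eta gamma N k0 d k * ratio_prod eps N k0 d k x)%:E).
Proof.
have [m1 m2] := ge0_measurable_ratio_prod d k.
split => [|x]; last by rewrite lee_fin mulr_ge0 ?expR_ge0// -lee_fin.
by apply/measurable_EFinP; apply: measurable_funM => //; exact/measurable_EFinP.
Qed.

Lemma ge0_measurable_mixed_ratio : ge0_measurable (mixed_ratio eps eta gamma N k0).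
Proof.
have g k : ge0_measurable (fun x : seqspace R => \sum_(d <oo)
    (weight_ratio eta gamma N k0 d.+1 k * ratio_prod eps N k0 d.+1 k x)%:E)%E.
  split; last by move=> x; apply: nneseries_ge0 => d _ _; exact: (ge0_measurable_weighted _ _).2.
  apply: ge0_emeasurable_sum => [d x _ _|d _]; first exact: (ge0_measurable_weighted _ _).2.
  exact: (ge0_measurable_weighted _ _).1.
split; last by move=> x; apply: nneseries_ge0 => k _ _; exact: (g _).2.
by apply: ge0_emeasurable_sum => [k x _ _|k _]; [exact: (g _).2|exact: (g _).1].
Qed.

Lemma integral_mixed_ratio :
  (\int[model eps theta]_x mixed_ratio eps eta gamma N k0 x <=
   (expR ((2 * k0%:R + 5 + eta / 2) * N%:R) *
    (expR (gamma * k0%:R / 2) * (half_mass gamma * half_mass eta)))%:E)%E.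
Proof.
have g k : ge0_measurable (fun x : seqspace R => \sum_(d <oo)
    (weight_ratio eta gamma N k0 d.+1 k * ratio_prod eps N k0 d.+1 k x)%:E)%E.
  split; last by move=> x; apply: nneseries_ge0 => d _ _; exact: (ge0_measurable_weighted _ _).2.
  apply: ge0_emeasurable_sum => [d x _ _|d _]; first exact: (ge0_measurable_weighted _ _).2.
  exact: (ge0_measurable_weighted _ _).1.
rewrite /mixed_ratio integral_nneseries//; last 2 first.
- by move=> k; exact: (g _).1.
- by move=> k x _; exact: (g _).2.
pose E : R := expR ((2 * k0%:R + 5) * N%:R).
pose D := expR (eta * N%:R / 2) * expR (gamma * k0%:R / 2) * E.
apply: (@le_trans _ _ (\sum_(k <oo) ((D * half_mass eta)%:E * (expR (- (gamma / 2 * k.+1%:R)))%:E))%E).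
  apply: lee_nneseries => [k _ _|k _]; first by apply: integral_ge0 => x _; exact: (g _).2.
  rewrite integral_nneseries//; last 2 first.
  - by move=> d; exact: (ge0_measurable_weighted _ _).1.
  - by move=> d x _; exact: (ge0_measurable_weighted _ _).2.
  apply: (@le_trans _ _ (\sum_(d <oo) ((D * expR (- (gamma / 2 * k.+1%:R)))%:E *
      (expR (- (eta / 2 * d.+1%:R)))%:E))%E).
    apply: lee_nneseries => [d _ _|d _].
      by apply: integral_ge0 => x _; exact: (ge0_measurable_weighted _ _).2.
    under eq_integral do rewrite EFinM.
    rewrite ge0_integralZl; [|exact: measurableT| | |]; last first.
    - by rewrite lee_fin expR_ge0.
    - by move=> x _; exact: (ge0_measurable_ratio_prod _ _).2.
    - exact: (ge0_measurable_ratio_prod _ _).1.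
    apply: le_trans (_ : (weight_ratio eta gamma N k0 d.+1 k.+1)%:E * E%:E <= _)%E.
      apply: lee_wpmul2l; first by rewrite lee_fin expR_ge0.
      exact: integral_ratio_prod.
    rewrite -!EFinM lee_fin /D /weight_ratio /E -!expRD.
    rewrite le_eqVlt; apply/orP; left; apply/eqP; congr expR; by field.
  rewrite nneseriesZl; last by move=> d _; rewrite lee_fin expR_ge0.
  rewrite half_massE// -!EFinM lee_fin.
  by rewrite le_eqVlt; apply/orP; left; apply/eqP; ring.
rewrite nneseriesZl; last by move=> k _; rewrite lee_fin expR_ge0.
rewrite half_massE// -!EFinM lee_fin /D /E.
rewrite (_ : (2 * k0%:R + 5 + eta / 2) * N%:R = eta * N%:R / 2 + (2 * k0%:R + 5) * N%:R); last by field.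
rewrite expRD le_eqVlt; apply/orP; left; apply/eqP; ring.
Qed.

Definition upper_constant : R :=
  64 + 1200 * (2 * k0%:R + 5 + eta / 2 +
    expR (gamma * k0%:R / 2) * (half_mass gamma * half_mass eta)).

(** Bayes' formula bounds the posterior average of the loss by the average over the
    components; dividing by the total evidence leaves the budget, a deterministic
    [C A] and [C exp (- A)] times the posterior average of [exp h]. The choice of
    [A] makes the expectation of the last term bounded by a constant times [v]. *)
Lemma posterior_risk_le (post : R.-pker (seqspace R) ~> (seqspace R)) :
  is_posterior eps (prior eps eta gamma) post ->
  (\int[model eps theta]_x sqnorm (fun i => posterior_mean post x i - theta i)%R <=
   (upper_constant * (v * N%:R))%:E)%E.
Proof.
move=> hpost; pose A := (2 * k0%:R + 5 + eta / 2) * N%:R.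
have A0 : 0 <= A by rewrite mulr_ge0// addr_ge0 ?addr_ge0 ?mulr_ge0// ltW.
have [C CE] : exists C, C = 1200 * v by exists (1200 * v).
have C0 : 0 <= C by rewrite CE; have := v0; lra.
have gf := ge0_measurable_sqnorm theta.
have hae : {ae model eps theta, forall x, (\int[post x]_t sqnorm (fun i => t i - theta i)%R <=
    (budget eps N theta x + C * A)%:E +
    (C * expR (- A))%:E * mixed_ratio eps eta gamma N k0 x)%E}.
  apply: ae_model; have h1 := posterior_ae eps0 hpost gf.
  have h2 := marg_fin_ae eps0 eta0 gamma0.
  apply: filterS2 h1 h2 => x h1 h2.
  set M := mix eta gamma (fun d k => (marg eps d k x)%:E) in h1 h2.
  have M0 : (0 < M)%E.
    apply: lt_le_trans (mix_term_le eta gamma _ (ltn0Sn 0) (ltn0Sn 0)); last first.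
      by move=> d k; rewrite lee_fin ltW// marg_gt0.
    rewrite -!EFinM lte_fin; apply: mulr_gt0; first exact: exp_weight_gt0.
    by apply: mulr_gt0; [exact: exp_weight_gt0|exact: marg_gt0].
  rewrite -(lee_pmul2r h2 M0); apply: le_trans h1 _.
  apply: le_trans (mix_loss_le eta gamma eps0 tail x A0) _.
  rewrite -CE -/M.
  have Q0 : (0 <= mixed_ratio eps eta gamma N k0 x)%E := ge0_measurable_mixed_ratio.2 x.
  have b0 : 0 <= budget eps N theta x by exact: budget_ge0.
  rewrite ge0_muleDl; last 2 first.
  - by rewrite lee_fin addr_ge0// mulr_ge0.
  - by rewrite mule_ge0// lee_fin mulr_ge0 ?expR_ge0.
  rewrite leeD2l// -muleA; apply: lee_wpmul2l; first by rewrite lee_fin mulr_ge0 ?expR_ge0.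
  rewrite [X in (_ <= X)%E]muleC; exact: mix_excess_le.
have gQ := ge0_measurable_mixed_ratio.
have mb : measurable_fun setT (fun x : seqspace R => budget eps N theta x + C * A).
  apply: measurable_funD => //; apply: measurable_funD => //.
  apply: measurable_sum => i; apply: measurable_funD => //; apply: measurable_funM => //.
  by apply: measurable_funX; apply: measurable_funB => //; exact: measurable_coord.
have b0 x : 0 <= budget eps N theta x by exact: budget_ge0.
have gpost := ge0_measurable_integral_post post gf.
apply: (@le_trans _ _ (\int[model eps theta]_x \int[post x]_t sqnorm (fun i => t i - theta i)%R)%E).
  apply: ge0_le_integral => //.
  - by move=> x _; apply: nneseries_ge0 => i _ _; rewrite lee_fin sqr_ge0.
  - by apply: (measurableT_comp gf.1 (measurable_posterior_mean post)).
  - exact: gpost.1.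
  - by move=> x _; exact: posterior_mean_le.
apply: (@le_trans _ _ (\int[model eps theta]_x ((budget eps N theta x + C * A)%:E +
    (C * expR (- A))%:E * mixed_ratio eps eta gamma N k0 x))%E).
  apply: ae_ge0_le_integral => //.
  - by move=> x _; exact: gpost.2.
  - exact: gpost.1.
  - move=> x _; apply: adde_ge0; first by rewrite lee_fin addr_ge0// mulr_ge0.
    by apply: mule_ge0 (gQ.2 x); rewrite lee_fin mulr_ge0 ?expR_ge0.
  - apply: emeasurable_funD; first exact/measurable_EFinP.
    by apply: measurable_funeM; exact: gQ.1.
  - by apply: filterS hae => x h _.
rewrite ge0_integralD; [|exact: measurableT| | | |]; last first.
- by apply: measurable_funeM; exact: gQ.1.
- by move=> x _; apply: mule_ge0 (gQ.2 x); rewrite lee_fin mulr_ge0 ?expR_ge0.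
- exact/measurable_EFinP.
- by move=> x _; rewrite lee_fin addr_ge0// mulr_ge0.
rewrite ge0_integralZl; [|exact: measurableT| | |]; last first.
- by rewrite lee_fin mulr_ge0 ?expR_ge0.
- by move=> x _; exact: gQ.2.
- exact: gQ.1.
under eq_integral do rewrite EFinD.
rewrite ge0_integralD; [|exact: measurableT| | | |]; last first.
- exact: measurable_cst.
- by move=> x _; rewrite lee_fin mulr_ge0.
- apply/measurable_EFinP; apply: measurable_funD => //.
  apply: measurable_sum => i; apply: measurable_funD => //; apply: measurable_funM => //.
  by apply: measurable_funX; apply: measurable_funB => //; exact: measurable_coord.
- by move=> x _; rewrite lee_fin.
rewrite (integral_prob_cst (model eps theta)).
set K := expR (gamma * k0%:R / 2) * (half_mass gamma * half_mass eta).
have K0 : 0 <= K by rewrite !mulr_ge0 ?expR_ge0 ?half_mass_ge0.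
apply: (@le_trans _ _ ((64 * (v * N%:R))%:E + (C * A)%:E + (C * expR (- A))%:E * (expR A * K)%:E)%E).
  apply: leeD; first by rewrite leeD2r//; exact: integral_budget.
  apply: lee_wpmul2l; first by rewrite lee_fin mulr_ge0 ?expR_ge0.
  exact: integral_mixed_ratio.
rewrite -EFinM -!EFinD lee_fin.
have -> : C * expR (- A) * (expR A * K) = C * K.
  by rewrite mulrA -[C * _ * _]mulrA -expRD addNr expR0 mulr1.
have N1 : (1 : R) <= N%:R by rewrite ler1n.
rewrite /upper_constant -/K CE /A.
have vK : 0 <= v * K by rewrite mulr_ge0// ltW.
have : v * K <= v * K * N%:R by rewrite ler_peMr.
move: (v) (N%:R) => w n h.
have -> : (64 + 1200 * (2 * k0%:R + 5 + eta / 2 + K)) * (w * n) =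
  64 * (w * n) + 1200 * w * ((2 * k0%:R + 5 + eta / 2) * n) + 1200 * (w * K * n) by ring.
rewrite lerD2l -[1200 * w * K]mulrA; apply: ler_wpM2l h; exact: ler0n.
Qed.

End posterior_mean_bound.

(** * Lower bound over a hypercube *)

Section hypercube.
Context {R : realType}.
Variables (eps : R) (D : nat).
Hypothesis eps0 : 0 < eps.
Local Notation v := (eps ^+ 2).
Let v0 : 0 < v. Proof. by rewrite exprn_gt0. Qed.
Implicit Types (s : {ffun 'I_D -> bool}) (i : 'I_D) (x : seqspace R).

(** The vertices are indexed by the set of negative coordinates. *)
Definition vertex s : seqspace R :=
  fun j => if insub j is Some i then (-1) ^+ s i * eps else 0.

Definition flip i s : {ffun 'I_D -> bool} := [ffun j => s j (+) (j == i)].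

Lemma flipK i : involutive (flip i).
Proof. by move=> s; apply/ffunP => j; rewrite !ffunE addbK. Qed.

Lemma vertexE s i : vertex s i = (-1) ^+ s i * eps.
Proof. by rewrite /vertex insubT//= => ilt; congr (_ ^+ s _ * _); exact: val_inj. Qed.

Lemma vertex_tail s j : (D <= j)%N -> vertex s j = 0.
Proof. by move=> Dj; rewrite /vertex insubF// ltnNge Dj. Qed.

Lemma sqr_vertex s i : vertex s i ^+ 2 = v.
Proof. by rewrite vertexE exprMn sqrr_sign mul1r. Qed.

Lemma vertex_flip s i : vertex (flip i s) i = - vertex s i.
Proof. by rewrite !vertexE ffunE eqxx addbT; case: (s i); rewrite /= ?expr0 ?expr1 ?mulN1r ?mul1r ?opprK. Qed.

Lemma vertex_flip_neq s i j : j != i -> vertex (flip i s) j = vertex s j.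
Proof. by move=> /negbTE ji; rewrite !vertexE ffunE ji addbF. Qed.

(** A minorant of the likelihood at both signs: [(t + eps) ^ 2] and
    [(t - eps) ^ 2] are nonnegative. Its integral is the overlap of the two laws
    that the lower bound retains. *)
Definition envelope (t : R) : R := expR (-1) * expR (-1 * t ^+ 2 / (2 * v)).

Lemma envelope_ge0 t : 0 <= envelope t.
Proof. by rewrite mulr_ge0 ?expR_ge0. Qed.

Lemma measurable_envelope : measurable_fun setT envelope.
Proof.
apply: measurable_funM => //; apply: measurableT_comp => //.
by apply: measurable_funM => //; apply: measurable_funM.
Qed.

Lemma envelope_le_lik s i t : envelope t <= lik v (vertex s i) t.
Proof.
rewrite /envelope /lik -expRD ler_expR sqr_vertex; have := sqr_vertex s i.
move: (vertex s i) => w wv; rewrite -subr_ge0.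
suff -> : (w * t - v / 2) / v - (-1 + -1 * t ^+ 2 / (2 * v)) = (t + w) ^+ 2 / (2 * v).
  by rewrite divr_ge0 ?sqr_ge0// mulr_ge0// ltW.
have e : (t + w) ^+ 2 = t ^+ 2 + 2 * w * t + v by rewrite -wv; ring.
by rewrite e; field; rewrite gt_eqF.
Qed.

Definition hypercube_constant : R := expR (-1) / Num.sqrt (1 - -1).

Lemma integral_envelope :
  (\int[gauss 0 v]_t (envelope t)%:E = hypercube_constant%:E)%E.
Proof.
under eq_integral do rewrite EFinM.
rewrite ge0_integralZl; [|exact: measurableT| | |]; last first.
- by rewrite lee_fin expR_ge0.
- by move=> t _; rewrite lee_fin expR_ge0.
- apply/measurable_EFinP; apply: measurableT_comp => //.
  by apply: measurable_funM => //; apply: measurable_funM.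
have lt1 : -1 < 1 :> R by lra.
rewrite (integral_gauss_exp 0 v0 lt1) -EFinM expr0n/= mulr0 mul0r expR0 mulr1.
by [].
Qed.

(** A minorant of the likelihood that does not see the sign of the [i]th
    coordinate, so that it serves both ends of an edge of the cube in direction
    [i]. *)
Definition blind s i x : R :=
  \prod_(j < D) if j == i then envelope (x j) else lik v (vertex s j) (x j).

Lemma blind_ge0 s i x : 0 <= blind s i x.
Proof.
by apply: prodr_ge0 => j _; case: (j == i); [exact: envelope_ge0|exact: lik_ge0].
Qed.

Lemma blind_le_Lik s i x : blind s i x <= Lik eps D (vertex s) x.
Proof.
apply: ler_prod => j _; case: eqP => [->|_]; last by rewrite lik_ge0/=.
by rewrite envelope_ge0/= envelope_le_lik.
Qed.

Lemma blind_flip s i x : blind (flip i s) i x = blind s i x.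
Proof.
apply: eq_bigr => j _; have [//|ji] := eqVneq j i.
by rewrite vertex_flip_neq.
Qed.

Let blind_factor s i (j : nat) (t : R) : R :=
  if j == i then envelope t else lik v (vertex s j) t.

Let measurable_blind_factor s i j : measurable_fun setT (blind_factor s i j).
Proof.
rewrite /blind_factor; case: (j == i); first exact: measurable_envelope.
by apply: measurable_lik2 => //; exact: measurable_cst.
Qed.

Lemma measurable_blind s i : measurable_fun setT (blind s i).
Proof. exact: (measurable_prod_coord D (measurable_blind_factor s i)). Qed.

Lemma integral_blind s i :
  (\int[base eps]_x (blind s i x)%:E = hypercube_constant%:E)%E.
Proof.
rewrite baseE.
have g j : ge0_measurable (fun t => (blind_factor s i j t)%:E).
  split => [|t]; first by apply/measurable_EFinP; exact: measurable_blind_factor.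
  by rewrite lee_fin /blind_factor; case: (j == i :> nat); [exact: envelope_ge0|exact: lik_ge0].
transitivity (\int[product_prob (fun=> gauss 0 v)]_x \prod_(j < D) (blind_factor s i j (x j))%:E)%E.
  by apply: eq_integral => x _; rewrite prodEFin.
apply: (etrans (integral_product_prob (fun=> gauss 0 v) D g)).
rewrite (bigD1 i)//= big1 => [|j ji].
  rewrite mule1 -integral_envelope; apply: eq_integral => t _.
  by rewrite /blind_factor eqxx.
rewrite -[RHS](lik_mass (vertex s j) v0); apply: eq_integral => t _.
by rewrite /blind_factor (negbTE ji : (j == i :> nat) = false).
Qed.

(** Pairing each vertex with its neighbour across the [i]th direction, no value
    [a i] can be close to both signs. *)
Lemma sum_loss_ge (a : 'I_D -> R) x :
  v * \sum_s \sum_i blind s i x <=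
  \sum_s (\sum_i (a i - vertex s i) ^+ 2) * Lik eps D (vertex s) x.
Proof.
apply: (@le_trans _ _ (\sum_i \sum_s (a i - vertex s i) ^+ 2 * blind s i x)); last first.
  rewrite exchange_big; apply: ler_sum => s _; rewrite mulr_suml; apply: ler_sum => i _.
  by rewrite ler_wpM2l ?sqr_ge0// blind_le_Lik.
rewrite exchange_big mulr_sumr; apply: ler_sum => i _.
pose F s := (a i - vertex s i) ^+ 2 * blind s i x.
have eF : \sum_s F s = \sum_s F (flip i s).
  by rewrite (reindex_inj (inv_inj (flipK i))).
have : \sum_s 2 * v * blind s i x <= \sum_s F s + \sum_s F (flip i s).
  rewrite -big_split; apply: ler_sum => s _ /=.
  rewrite /F blind_flip vertex_flip -mulrDl ler_wpM2r ?blind_ge0// -(sqr_vertex s i).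
  rewrite opprK; move: (a i) (vertex s i) => b w; have := sqr_ge0 b.
  have -> : (b - w) ^+ 2 + (b + w) ^+ 2 = 2 * b ^+ 2 + 2 * w ^+ 2 by ring.
  lra.
rewrite -eF -[X in _ -> _ <= X]/(\sum_s F s) mulr_sumr.
rewrite [X in X <= _ -> _](eq_bigr (fun s => 2 * (v * blind s i x))) => [|s _]; last by rewrite mulrA.
rewrite -[X in X <= _]mulr_sumr; lra.
Qed.

(** The largest of the [2 ^ D] risks is at least their average, and the average is
    bounded below under the integral sign by [sum_loss_ge]. *)
Lemma hypercube_lower_bound (est : seqspace R -> seqspace R) (S : \bar R) :
  measurable_fun setT est ->
  (forall s, \int[model eps (vertex s)]_x sqnorm (fun j => est x j - vertex s j)%R <= S)%E ->
  ((hypercube_constant * (v * D%:R))%:E <= S)%E.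
Proof.
move=> mest.
case: S => [r riskle| |]; last 2 first.
- by rewrite leey.
- move=> /(_ [ffun=> true]); rewrite leeNy_eq => /eqP h; exfalso.
  have : (0 <= -oo :> \bar R)%E; last by [].
  rewrite -h; apply: integral_ge0 => x _; apply: nneseries_ge0 => j _ _.
  by rewrite lee_fin sqr_ge0.
rewrite lee_fin.
have mc i s : measurable_fun setT (fun x : seqspace R => (est x i - vertex s i) ^+ 2).
  apply: measurable_funX; apply: measurable_funB => //.
  by apply: (measurableT_comp (measurable_coord i)).
have gs s : ge0_measurable (fun x => (\sum_(i < D) (est x i - vertex s i) ^+ 2)%:E).
  split => [|x]; last by rewrite lee_fin sumr_ge0// => i _; exact: sqr_ge0.
  by apply/measurable_EFinP; apply: measurable_sum => i; exact: mc.
have gL s := ge0_measurableM (gs s)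
  (@measurable_Lik _ eps D _ (seqspace R) (cst (vertex s)) id
    (measurable_cst _) (@measurable_id _ _ _)) (fun x => Lik_ge0 eps D (vertex s) x).
have lower s : (\int[base eps]_x ((\sum_(i < D) (est x i - vertex s i) ^+ 2)%:E *
    (Lik eps D (vertex s) x)%:E) <= r%:E)%E.
  apply: le_trans (riskle s).
  rewrite -[X in (X <= _)%E](integral_model eps0 (@vertex_tail s) (gs s)).
  apply: ge0_le_integral.
  - exact: measurableT.
  - by move=> x _; exact: (gs s).2.
  - exact: (gs s).1.
  - by apply: (measurableT_comp (ge0_measurable_sqnorm (vertex s)).1 mest).
  - move=> x _; rewrite -sumEFin -(big_mkord xpredT (fun i : nat => ((est x i - vertex s i) ^+ 2)%:E)).
    by apply: nneseries_lim_ge => i _ _; rewrite lee_fin sqr_ge0.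
have gb s i : ge0_measurable (fun x => (blind s i x)%:E).
  by split => [|x]; [apply/measurable_EFinP; exact: measurable_blind|rewrite lee_fin blind_ge0].
have gbs s : ge0_measurable (fun x => \sum_i (blind s i x)%:E)%E.
  split; last by move=> x; apply: sume_ge0 => i _; exact: (gb _ _).2.
  by apply: emeasurable_sum => i; exact: (gb _ _).1.
have upper : (\int[base eps]_x (v%:E * (\sum_s \sum_i (blind s i x)%:E)) <=
    \sum_(s : {ffun 'I_D -> bool}) r%:E)%E.
  apply: (@le_trans _ _ (\int[base eps]_x \sum_s ((\sum_(i < D) (est x i - vertex s i) ^+ 2)%:E *
    (Lik eps D (vertex s) x)%:E))%E).
    apply: ge0_le_integral.
    - exact: measurableT.
    - move=> x _; apply: mule_ge0; first by rewrite lee_fin ltW.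
      by apply: sume_ge0 => s _; exact: (gbs s).2.
    - by apply: measurable_funeM; apply: emeasurable_sum => s; exact: (gbs s).1.
    - by apply: emeasurable_sum => s; exact: (gL s).1.
    - move=> x _; have := sum_loss_ge (fun i => est x i) x.
      rewrite -lee_fin EFinM -sumEFin => h.
      under eq_bigr do rewrite sumEFin.
      by apply: le_trans h _; rewrite -sumEFin; apply: lee_sum => s _; rewrite EFinM.
  rewrite ge0_integral_sum; [|exact: measurableT| |]; last first.
  - by move=> s x _; exact: (gL s).2.
  - by move=> s; exact: (gL s).1.
  by apply: lee_sum => s _; exact: lower.
move: upper; rewrite ge0_integralZl; [|exact: measurableT| | |]; last first.
- by rewrite lee_fin ltW.
- by move=> x _; apply: sume_ge0 => s _; exact: (gbs s).2.
- by apply: emeasurable_sum => s; exact: (gbs s).1.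
rewrite ge0_integral_sum; [|exact: measurableT| |]; last first.
- by move=> s x _; exact: (gbs s).2.
- by move=> s; exact: (gbs s).1.
rewrite (eq_bigr (fun s : {ffun 'I_D -> bool} => (\sum_(i < D) hypercube_constant)%:E)) => [|s _]; last first.
  rewrite ge0_integral_sum; [|exact: measurableT| |]; last first.
  - by move=> i x _; exact: (gb s i).2.
  - by move=> i; exact: (gb s i).1.
  by rewrite -sumEFin; apply: eq_bigr => i _; exact: integral_blind.
rewrite !sumEFin -EFinM lee_fin !sumr_const.
rewrite card_ord -[_ *+ #|_|]mulr_natl -[r *+ _]mulr_natl mulrCA.
have c0 : (0 : R) < #|{: {ffun 'I_D -> bool}}|%:R.
  by rewrite ltr0n; apply/card_gt0P; exists [ffun=> true].
rewrite -[#|xpredT|]/(#|{: {ffun 'I_D -> bool}}|).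
by rewrite (ler_pM2l c0) -[_ *+ D]mulr_natr mulrCA.
Qed.

End hypercube.

(** * Ellipsoids and the critical dimension *)

Lemma nneseries_finite_support {R : realType} (u : (\bar R)^nat) n :
  (forall i, 0 <= u i)%E -> (forall i, (n <= i)%N -> u i = 0%E) ->
  (\sum_(i <oo) u i = \sum_(i < n) u i)%E.
Proof.
move=> u0 un; rewrite (@nneseries_split _ u 0 n)// add0n big_mkord.
by rewrite [X in (_ + X)%E]eseries0 ?adde0// => i /un ->.
Qed.

Section ellipsoid_facts.
Context {R : realType}.
Variables (alpha0 B eps : R).
Hypotheses (alpha00 : 0 < alpha0) (B0 : 0 < B) (eps0 : 0 < eps).
Local Notation v := (eps ^+ 2).
Let v0 : 0 < v. Proof. by rewrite exprn_gt0. Qed.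
Let BB0 : 0 < B ^+ 2. Proof. by rewrite exprn_gt0. Qed.

Lemma powR_split (x : R) : x `^ (2 * alpha0 + 1) = x `^ (2 * alpha0) * x `^ 1.
Proof. by rewrite powRD// gt_eqF// addr_gt0// mulr_gt0. Qed.

Lemma vertex_ellipsoid D (s : {ffun 'I_D -> bool}) :
  v * D%:R `^ (2 * alpha0 + 1) <= B ^+ 2 -> ellipsoid alpha0 B (vertex eps s).
Proof.
move=> DB; split.
  rewrite /l2/= /sqnorm (@nneseries_finite_support _ _ D) => [|i|i Di].
  - by rewrite sumEFin ltry.
  - by rewrite lee_fin sqr_ge0.
  - by rewrite vertex_tail// expr0n.
rewrite (@nneseries_finite_support _ _ D) => [|i|i Di].
- rewrite sumEFin lee_fin; apply: le_trans DB.
  rewrite (eq_bigr (fun i : 'I_D => i.+1%:R `^ (2 * alpha0) * v)) => [|i _]; last first.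
    by rewrite sqr_vertex.
  rewrite -mulr_suml mulrC ler_pM2l// powR_split powRr1//.
  rewrite [leRHS](_ : _ = \sum_(i < D) D%:R `^ (2 * alpha0)); last first.
    by rewrite sumr_const card_ord mulr_natr.
  apply: ler_sum => i _.
  by apply: ge0_ler_powR; rewrite ?nnegrE ?ler_nat// mulr_ge0// ltW.
- by rewrite lee_fin mulr_ge0 ?powR_ge0 ?sqr_ge0.
- by rewrite vertex_tail// expr0n/= mulr0.
Qed.

Lemma sup_risk_lower D (est : seqspace R -> seqspace R) :
  v * D%:R `^ (2 * alpha0 + 1) <= B ^+ 2 -> measurable_fun setT est ->
  ((hypercube_constant * (v * D%:R) / B ^+ 2)%:E <= sup_risk eps alpha0 B est)%E.
Proof.
move=> DB mest.
have h (s : {ffun 'I_D -> bool}) : (\int[model eps (vertex eps s)]_x sqnorm (fun j => est x j - vertex eps s j)%R <=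
    (B ^+ 2)%:E * sup_risk eps alpha0 B est)%E.
  rewrite -lee_pdivrMl//; apply: ereal_sup_ubound.
  by exists (vertex eps s) => //; exact: (@vertex_ellipsoid D).
have := @hypercube_lower_bound _ _ _ eps0 _ _ mest h.
by move=> hS; rewrite EFinM [X in (X <= _)%E]muleC lee_pdivrMl.
Qed.

Lemma ellipsoid_partial theta n : ellipsoid alpha0 B theta ->
  \sum_(i < n) i.+1%:R `^ (2 * alpha0) * theta i ^+ 2 <= B ^+ 2.
Proof.
case=> _ h; rewrite -lee_fin; apply: le_trans h.
rewrite -sumEFin -(big_mkord xpredT (fun i : nat => (i.+1%:R `^ (2 * alpha0) * theta i ^+ 2)%:E)).
by apply: nneseries_lim_ge => i _ _; rewrite lee_fin mulr_ge0 ?powR_ge0 ?sqr_ge0.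
Qed.

Section upper.
Variables (N k0 : nat) (theta : seqspace R).
Hypotheses (N0 : (0 < N)%N) (k0alpha : alpha0 <= k0%:R).
Hypothesis BN : B ^+ 2 <= v * N%:R `^ (2 * alpha0 + 1).
Hypothesis theta_in : ellipsoid alpha0 B theta.

Let N0' : (0 : R) < N%:R. Proof. by rewrite ltr0n. Qed.
Let Np0 : (0 : R) < N%:R `^ (2 * alpha0). Proof. exact: powR_gt0. Qed.

Let weight_le n (w : nat -> R) : (forall i, (i < n)%N -> w i <= (i.+1%:R / N%:R) `^ (2 * alpha0)) ->
  \sum_(i < n) w i * theta i ^+ 2 <= v * N%:R.
Proof.
move=> hw; rewrite -(ler_pM2l Np0).
apply: (@le_trans _ _ (B ^+ 2)); last first.
  by rewrite mulrCA -[X in _ * (_ * X)]powRr1// -powR_split.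
apply: le_trans (ellipsoid_partial n theta_in).
rewrite mulr_sumr; apply: ler_sum => i _; rewrite mulrA ler_wpM2r ?sqr_ge0//.
rewrite mulrC -ler_pdivlMr//; apply: le_trans (hw _ (ltn_ord i)) _.
by rewrite powRM ?invr_ge0 ?ler0n// ler_wpM2l ?powR_ge0// -powR_inv1 ?ler0n// powRAC powR_inv1 ?powR_ge0.
Qed.

Lemma ellipsoid_head : \sum_(i < N) shrink N k0 i * theta i ^+ 2 <= v * N%:R.
Proof.
apply: weight_le => i iN; apply: le_trans (shrink_le_power k0 iN) _.
have q0 : (0 : R) < i.+1%:R / N%:R by rewrite divr_gt0// ltr0n.
rewrite -(powR_mulrn _ (ltW q0)); apply: ger_powR.
  by rewrite q0 ler_pdivrMr// mul1r ler_nat.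
rewrite natrD natrM; move: k0alpha; lra.
Qed.

Lemma ellipsoid_tail n : \sum_(N <= i < n) theta i ^+ 2 <= v * N%:R.
Proof.
have [nN|/ltnW Nn] := leqP n N; first by rewrite big_geq// mulr_ge0// ltW.
apply: (@le_trans _ _ (\sum_(i < n) (N <= i)%N%:R * theta i ^+ 2)).
  rewrite (sumr_ord_split (fun i => (N <= i)%N%:R * theta i ^+ 2) Nn).
  rewrite [X in _ <= X + _]big1 ?add0r => [|i _]; last by rewrite /= leqNgt ltn_ord mul0r.
  by apply: ler_sum_nat => i /andP[-> _]; rewrite mul1r.
apply: (@weight_le n (fun i => (N <= i)%N%:R)) => i ilt; case: leqP => /= Ni; last exact: powR_ge0.
have r1 : 1 <= i.+1%:R / N%:R :> R by rewrite ler_pdivlMr// mul1r ler_nat ltnW.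
rewrite -[X in X <= _](powRr0 (i.+1%:R / N%:R)); apply: (ler_powR r1).
by rewrite mulr_ge0// ltW.
Qed.

End upper.

(** The conditions on [N] and [k0] say that the comparison component is adapted to
    the ellipsoid: [shrink N k0 i] is at most [(i / N) ^ (2 alpha0)] below [N], with
    coordinates counted from one, and the signal above [N] is at most [v N]. *)
Lemma sup_risk_upper eta gamma N k0 (post : R.-pker (seqspace R) ~> (seqspace R)) :
  0 < eta -> 0 < gamma -> (0 < N)%N -> (0 < k0)%N -> alpha0 <= k0%:R ->
  B ^+ 2 <= v * N%:R `^ (2 * alpha0 + 1) ->
  is_posterior eps (prior eps eta gamma) post ->
  (sup_risk eps alpha0 B (posterior_mean post) <=
   (upper_constant eta gamma k0 * (v * N%:R) / B ^+ 2)%:E)%E.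
Proof.
move=> eta0 gamma0 N0 k00 k0alpha BN hpost; apply: ge_ereal_sup => _ [theta theta_in <-].
rewrite /risk EFinM [leRHS]muleC lee_pmul2l ?fin_numE//; last by rewrite lte_fin invr_gt0.
apply: (posterior_risk_le eps0 eta0 gamma0 N0 k00 theta_in.1 _ _ hpost).
- exact: ellipsoid_head.
- exact: ellipsoid_tail.
Qed.

(** The integer part of [(B / eps) ^ (2 / (2 alpha0 + 1))], which is positive
    because [eps <= B]. *)
Lemma critical_dimension : eps <= B -> exists D : nat,
  [/\ (0 < D)%N, v * D%:R `^ (2 * alpha0 + 1) <= B ^+ 2 &
      B ^+ 2 <= v * D.+1%:R `^ (2 * alpha0 + 1)].
Proof.
move=> epsB; have p0 : 0 < 2 * alpha0 + 1 by rewrite addr_gt0// mulr_gt0.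
pose t := (B / eps) `^ (2 / (2 * alpha0 + 1)).
have r1 : 1 <= B / eps by rewrite ler_pdivlMr// mul1r.
have r0 : 0 <= B / eps by rewrite divr_ge0// ltW.
have t1 : 1 <= t.
  by rewrite -[1](powRr0 (B / eps)); apply: ler_powR => //; rewrite divr_ge0// ltW.
have t0 : 0 <= t by exact: powR_ge0.
have tp : v * t `^ (2 * alpha0 + 1) = B ^+ 2.
  rewrite -powRrM divfK ?gt_eqF// powR_mulrn// expr_div_n mulrCA divff ?mulr1//.
  by rewrite gt_eqF.
have /andP[Dt tD] := truncn_itv t0.
exists (Num.truncn t); split; first by rewrite truncn_gt0.
- rewrite -tp ler_pM2l//; apply: ge0_ler_powR => //; first exact: ltW.
  by rewrite nnegrE.
- rewrite -tp ler_pM2l//; apply: ge0_ler_powR => //; [exact: ltW|by rewrite nnegrE|exact: ltW].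
Qed.

End ellipsoid_facts.

Theorem corollary2 (R : realType) (eta gamma alpha0 : R)
    (eta_gt0 : 0 < eta) (gamma_gt0 : 0 < gamma) (alpha0_gt0 : 0 < alpha0) :
  exists2 C3 : R, 0 < C3 &
    forall B : R, 0 < B ->
    forall eps : R, 0 < eps -> eps <= B ->
    forall post : R.-pker (seqspace R) ~> (seqspace R),
      is_posterior eps (prior eps eta gamma) post ->
      (sup_risk eps alpha0 B (posterior_mean post) <=
       C3%:E * ereal_inf [set sup_risk eps alpha0 B est | est in estimator])%E.
Proof.
pose k0 := (Num.truncn alpha0).+1.
have k0alpha : alpha0 <= k0%:R by apply/ltW; have /andP[] := truncn_itv (ltW alpha0_gt0).
pose U := upper_constant eta gamma k0; pose c : R := hypercube_constant.
have U0 : 0 < U.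
  have h : 0 <= expR (gamma * k0%:R / 2) * (half_mass gamma * half_mass eta).
    by rewrite mulr_ge0 ?expR_ge0// mulr_ge0 ?half_mass_ge0.
  by rewrite /U /upper_constant; have := ler0n R k0; lra.
have c0 : 0 < c.
  by rewrite /c /hypercube_constant divr_gt0 ?expR_gt0// sqrtr_gt0; lra.
(* The factor [2] absorbs the step from [D] to [D + 1 <= 2 D]. *)
exists (2 * U / c); first by rewrite divr_gt0// mulr_gt0.
move=> B B0 eps eps0 epsB post hpost.
have [D [D0 DB BD]] := critical_dimension alpha0_gt0 B0 eps0 epsB.
have v0 : 0 < eps ^+ 2 by rewrite exprn_gt0.
have BB0 : 0 < B ^+ 2 by rewrite exprn_gt0.
apply: le_trans (sup_risk_upper alpha0_gt0 B0 eps0 eta_gt0 gamma_gt0 (ltn0Sn D)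
  (ltn0Sn _) k0alpha BD hpost) _.
apply: (@le_trans _ _ ((2 * U / c)%:E * (c * (eps ^+ 2 * D%:R) / B ^+ 2)%:E)%E).
  rewrite -EFinM lee_fin -/U.
  have -> : 2 * U / c * (c * (eps ^+ 2 * D%:R) / B ^+ 2) =
      U * (eps ^+ 2 * (2 * D%:R)) / B ^+ 2 by field; rewrite !gt_eqF.
  rewrite ler_pM2r ?invr_gt0// ler_pM2l// ler_pM2l// -natrM ler_nat mul2n -addnn.
  by rewrite -addn1 leq_add2l.
apply: lee_wpmul2l; first by rewrite lee_fin divr_ge0 ?mulr_ge0 ?ltW.
by apply: le_ereal_inf_tmp => _ [est mest <-]; exact: sup_risk_lower.
Qed.
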